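(* Let $p$ be an odd prime, let $k$ be an algebraically closed field of characteristic $p$, and let $\mathcal{F}$ be a nonconstrained saturated fusion system on an extraspecial $p$-group $S$ of order $p^3$ and exponent $p$. Then $\lim\mathcal{A}^2_\mathcal{F}=0$; that is, the only compatible family for $\mathcal{F}$ is the trivial one ($\alpha_Q=0$ for all $\mathcal{F}$-centric $Q$).
   Context: A saturated fusion system $\mathcal{F}$ on $S$ is constrained if it has a normal subgroup $Q$ (i.e. $Q\trianglelefteq\mathcal{F}$) with $C_S(Q)\le Q$; nonconstrained otherwise. $\mathcal{F}^c$ is the set of $\mathcal{F}$-centric subgroups and $\operatorname{Out}_\mathcal{F}(Q)=\operatorname{Aut}_\mathcal{F}(Q)/\operatorname{Inn}(Q)$. $\mathcal{A}^2_\mathcal{F}$ is the functor on the orbit category of $\mathcal{F}^c$ sending $Q$ to $H^2(\operatorname{Out}_\mathcal{F}(Q),k^\times)$, and its inverse limit $\lim\mathcal{A}^2_\mathcal{F}$ is the group of compatible families: families $(\alpha_Q)_{Q\in\mathcal{F}^c}$, $\alpha_Q\in H^2(\operatorname{Out}_\mathcal{F}(Q),k^\times)$, compatible with $\mathcal{F}$-isomorphisms and such that for $Q\le R$ in $\mathcal{F}^c$ the pullbacks of $\alpha_R$ and $\alpha_Q$ to the group of automorphisms in $\operatorname{Aut}_\mathcal{F}(R)$ normalizing $Q$ (via the projection to $\operatorname{Out}_\mathcal{F}(R)$, resp. restriction to $Q$ followed by projection to $\operatorname{Out}_\mathcal{F}(Q)$) coincide. *)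

(* Defs.v *)
From HB Require Import structures.
From mathcomp Require Import all_boot all_order all_algebra all_fingroup all_solvable all_field.
Set Implicit Arguments. Unset Strict Implicit. Unset Printing Implicit Defensive.
Import GRing.Theory.
Local Open Scope group_scope.

Section FusionDefs.
Variable gT : finGroupType.
Implicit Types (S P Q R : {set gT}) (f g : {ffun gT -> gT}).

(* A morphism of a fusion system with domain P is an ffun that is an injective
   homomorphism P -> S and the identity outside P (a normal form: morphisms
   are determined by their restriction to P).  Hom_F(P,Q) = { f in F P | f @: P \subset Q }. *)
Definition inj_hom_into S P f : Prop :=
  [/\ group_set P && (P \subset S),
      {in P &, forall x y, f (x * y) = f x * f y},
      {in P &, injective f}, f @: P \subset S
    & {in ~: P, forall x, f x = x}].

Definition res P f : {ffun gT -> gT} := [ffun x => if x \in P then f x else x].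
Definition cjmap (s : gT) : {ffun gT -> gT} := [ffun x => x ^ s].
Definition compmap P g f : {ffun gT -> gT} := res P [ffun x => g (f x)].

(* F P = set of F-morphisms with domain P (with arbitrary target in S). *)
Definition fusion_system S (F : {set gT} -> {set {ffun gT -> gT}}) : Prop :=
  [/\ (forall P f, f \in F P -> inj_hom_into S P f),
      (forall P : {group gT}, P \subset S -> forall s, s \in S -> res P (cjmap s) \in F P),
      (forall P f g, f \in F P -> g \in F (f @: P) -> compmap P g f \in F P),
      (forall P (R : {group gT}) f, f \in F P -> R \subset P -> res R f \in F R)
    &
      (forall P f, f \in F P -> exists2 g, g \in F (f @: P) & {in P, forall x, g (f x) = x})].

Variable S : {group gT}.
Variable F : {set gT} -> {set {ffun gT -> gT}}.

Definition fully_normalized P := forall f, f \in F P -> #|'N_S(f @: P)| <= #|'N_S(P)|.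
Definition fully_centralized P := forall f, f \in F P -> #|'C_S(f @: P)| <= #|'C_S(P)|.

Definition centric (P : {group gT}) :=
  P \subset S /\ forall f, f \in F P -> 'C_S(f @: P) \subset f @: P.

Definition AutF P : {set {perm gT}} := [set a in Aut P | finfun a \in F P].
Definition AutS P : {set {perm gT}} :=
  [set a in Aut P | [exists s in 'N_S(P), [forall x in P, a x == x ^ s]]].
Definition InnSet P : {set {perm gT}} :=
  [set a in Aut P | [exists s in P, [forall x in P, a x == x ^ s]]].
Definition InnG P : {group {perm gT}} := <<InnSet P>>%G.
Definition OutF P : {set coset_of (InnG P)} := AutF P / InnG P.

(* saturation (Broto-Levi-Oliver) *)
Definition saturated (p : nat) : Prop :=
  [/\ fusion_system S F,
      (forall P : {group gT}, P \subset S -> fully_normalized P ->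
         fully_centralized P /\ p.-Sylow(AutF P) (AutS P))
    &
      (forall (P : {group gT}) f, P \subset S -> f \in F P -> fully_centralized (f @: P) ->
         let Nf := [set g in 'N_S(P) | [exists h in 'N_S(f @: P),
                        [forall x in P, f (x ^ g) == f x ^ h]]] in
         exists2 fb, fb \in F Nf & {in P, forall x, fb x = f x})].

Definition normal_in_fusion (Q : {group gT}) : Prop :=
  Q <| S /\
  forall (P : {group gT}) f, P \subset S -> f \in F P ->
    exists2 fb, fb \in F (P * Q) & ({in P, forall x, fb x = f x} /\ fb @: Q = Q).

Definition constrained : Prop :=
  exists Q : {group gT}, normal_in_fusion Q /\ 'C_S(Q) \subset Q.

End FusionDefs.

Section Cohomology.
Variables (T : finGroupType) (k : fieldType).
Implicit Type G : {set T}.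

Definition cocycle2 G (c : T -> T -> k) : Prop :=
  {in G &, forall x y, c x y != 0%R} /\
  {in G & G & G, forall x y z,
     (c x y * c (x * y)%g z = c y z * c x (y * z)%g)%R}.

Definition cohomologous G (c c' : T -> T -> k) : Prop :=
  exists g : T -> k, {in G, forall x, g x != 0%R} /\
    {in G &, forall x y, c x y = (c' x y * (g x * g y / g (x * y)%g))%R}.
End Cohomology.

Section Compatible.
Variables (gT : finGroupType) (k : fieldType) (S : {group gT}).
Variable F : {set gT} -> {set {ffun gT -> gT}}.

(* a family of representatives alpha_Q of classes in H^2(Out_F(Q), k^x) *)
Definition h2family := forall Q : {set gT}, coset_of (InnG Q) -> coset_of (InnG Q) -> k.

Definition compatible_family (alpha : h2family) : Prop :=
  [/\ (forall Q : {group gT}, centric S F Q -> cocycle2 (OutF F Q) (alpha Q)),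
      (forall (Q Q' : {group gT}) f, centric S F Q -> centric S F Q' ->
         f \in F Q -> f @: Q = Q' ->
         exists g : coset_of (InnG Q) -> k, {in OutF F Q, forall x, g x != 0%R} /\
           forall a b a' b', a \in AutF F Q -> b \in AutF F Q ->
             a' \in AutF F Q' -> b' \in AutF F Q' ->
             {in Q, forall x, a' (f x) = f (a x)} -> {in Q, forall x, b' (f x) = f (b x)} ->
             alpha Q (coset (InnG Q) a) (coset (InnG Q) b) =
             (alpha Q' (coset (InnG Q') a') (coset (InnG Q') b') *
               (g (coset (InnG Q) a) * g (coset (InnG Q) b) /
                g (coset (InnG Q) (a * b)%g)))%R)
    & (* compatibility with inclusions Q <= R: pullbacks to N_{Aut_F(R)}(Q) agree *)
      (forall Q R : {group gT}, centric S F Q -> centric S F R -> Q \subset R ->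
         cohomologous [set a in AutF F R | a @: Q == Q]
           (fun a b => alpha R (coset (InnG R) a) (coset (InnG R) b))
           (fun a b => alpha Q (coset (InnG Q) (restr_perm Q a))
                               (coset (InnG Q) (restr_perm Q b))))].
End Compatible.

(* Main.v *)
(* In characteristic p the group H^2(-, k^x) is detected on Sylow l-subgroups with
   l <> p.  The l-subgroups of SL_2(p) are cyclic or generalized quaternion, so every
   subgroup of SL_2(p) has trivial H^2, and so has every group between SL_2(p) and
   GL_2(p), because SL_2(p) has no characters into k^x.

   The centric subgroups of S are S and the rank-two subgroups Q.  If no Aut_F(Q) moved
   Z(S), every morphism would extend to S and F would be constrained.  So some Aut_F(Q)
   moves Z(S); it then contains SL_2(p), hence alpha_Q = 0, and alpha_S vanishes on the
   stabilizer of Q in Out_F(S), a p'-subgroup G of GL_2(p).  The automorphism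
   diag(t, t^-1) of Q extends to S and gives tau in G with eigenvalue t^-1 on Q / Z(S)
   and determinant t, for a generator t of F_p^x.  Writing G as the product of
   G_0 = G n SL_2(p) and <tau>, the class alpha_S becomes a character of G_0 up to
   coboundaries; elements of G_0 commuting with a nonscalar power of tau fix Q, where
   the character is trivial.  This settles each prime l, with separate arguments for
   quaternion Sylow 2-subgroups and for l = 3 when the 3-part of tau is scalar.
   Finally, if Aut_F(Q) fixes Z(S), it is the image of the stabilizer of Q in Aut_F(S)
   under restriction, with p-group kernel, so alpha_Q = 0 follows from alpha_S = 0. *)
Require Import Defs.
From HB Require Import structures.
From mathcomp Require Import all_boot all_order all_algebra all_fingroup all_solvable all_field.
From mathcomp Require Import mxabelem ring.
Set Implicit Arguments. Unset Strict Implicit. Unset Printing Implicit Defensive.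
Import GRing.Theory.
Local Open Scope group_scope.
Local Open Scope ring_scope.

(** Everything rests on one cyclic-extension step. If [G = N <y>] and a splitting of the class over
    [N] is fixed, conjugation by [y] changes it by a character of [N], called [twist]. As k^x is
    divisible, a cyclic quotient contributes no class of its own, so only this character has to be
    removed, if need be by correcting the splitting with a character of [N]. The determinant
    supplies the cyclic quotient, with [N] the part of [G] inside SL_2(p). The commutator map from
    S/Z(S) to Z(S) is alternating, so an automorphism acts on Z(S) through its determinant on
    S/Z(S); hence tau has determinant t and eigenvalues t^-1 and t^2. On l-parts these agree only
    when the l-part of t has cube 1, so a nontrivial scalar l-part of tau can occur only for l = 3.
    Since t generates F_p^x and p is odd, det tau and the determinant of its 2-part are nonsquares;
    most contradictions in the quaternion cases exhibit one of them as a square. *)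

(** * Extending multiplicative maps across a cyclic quotient *)

Section ExtendMultiplicative.
Variables (T : finGroupType) (B : pzSemiRingType) (N : {group T}) (y : T).
Hypothesis nNy : y \in 'N(N)%g.
Variables (s : T -> B) (Y : B).
Hypothesis sM : {in N &, forall a b, s (a * b)%g = s a * s b}.
Hypothesis sY : {in N, forall a, Y * s a = s (a ^ y^-1)%g * Y}.
Let m := #[coset N y].
Hypothesis Ym : Y ^+ m = s (y ^+ m)%g.

Lemma expg_mem_order_coset i : (y ^+ i \in N)%g = (m %| i)%N.
Proof.
rewrite order_dvdn -morphX //; apply/idP/eqP => [|yi1]; first exact: coset_id.
by apply: coset_idr yi1; rewrite groupX.
Qed.

(** The proof never inverts [Y], so [B] can be [k], which extends characters, or a matrix ring,
    which extends splittings inside a twisted group algebra. *)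
Lemma extend_mult :
  exists S : T -> B, {in N, forall a i, S (a * y ^+ i)%g = s a * Y ^+ i}.
Proof.
(* Only positive multiples: [sM] makes [s 1] an idempotent, possibly different from [1]. *)
have YmN d : Y ^+ (m * d.+1) = s (y ^+ (m * d.+1))%g.
  elim: d => [|d IH]; first by rewrite muln1.
  rewrite mulnS exprD expgD sM -?Ym ?IH // expg_mem_order_coset ?dvdnn //.
  exact: dvdn_mulr.
have wd a b i j : a \in N -> b \in N -> (i <= j)%N ->
    (a * y ^+ i = b * y ^+ j)%g -> s a * Y ^+ i = s b * Y ^+ j.
  move=> Na Nb /subnK <-; move: (j - i)%N => d; rewrite expgD mulgA.
  move/mulIg=> Da; rewrite exprD mulrA; congr (_ * _); case: d Da => [|d] Da.
    by rewrite Da expg0 mulg1 expr0 mulr1.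
  have Nd : (y ^+ d.+1 \in N)%g.
    have -> : (y ^+ d.+1 = b^-1 * a)%g by rewrite Da mulKg.
    by rewrite groupM ?groupV.
  move: (Nd); rewrite expg_mem_order_coset => /dvdnP[[|q] Dq] //.
  rewrite Dq mulnC YmN -sM //; last by rewrite mulnC -Dq.
  by rewrite mulnC -Dq Da.
pose S z := if [pick i : 'I_#[y] | (z * y ^- i \in N)%g] is Some i
            then s (z * y ^- i)%g * Y ^+ i else 0.
exists S => a Na i; rewrite /S; case: pickP => [j Nj | /(_ (Ordinal _)) no].
  have E : (a * y ^+ i * y ^- j * y ^+ j = a * y ^+ i)%g by rewrite mulgKV.
  case: (leqP i j) => [ij|/ltnW ji]; last exact: wd.
  by apply/esym/wd.
have lt_i : (i %% #[y] < #[y])%N by rewrite ltn_mod order_gt0.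
by have := no _ lt_i; rewrite /= expg_mod_order mulgK Na.
Qed.

Lemma extend_mult_hom :
  exists S : T -> B,
    [/\ {in N, forall a i, S (a * y ^+ i)%g = s a * Y ^+ i},
        {in N, S =1 s} &
        {in (N * <[y]>)%g &, forall a b, S (a * b)%g = S a * S b}].
Proof.
have [S SE] := extend_mult; exists S; split=> //.
  by move=> a Na; have := SE _ Na 0%N; rewrite expg0 expr0 mulg1 mulr1.
have sYi i a : a \in N -> Y ^+ i * s a = s (a ^ (y ^- i))%g * Y ^+ i.
  elim: i a => [|i IH] a Na; first by rewrite expg0 invg1 conjg1 expr0 mulr1 mul1r.
  rewrite exprS -mulrA IH // mulrA sY ?memJ_norm ?groupV ?groupX //.
  by rewrite -conjgM -invMg -expgS -mulrA.
move=> _ _ /mulsgP[a _ Na /cycleP[i ->] ->] /mulsgP[b _ Nb /cycleP[j ->] ->].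
have -> : (a * y ^+ i * (b * y ^+ j) = a * b ^ (y ^- i) * y ^+ (i + j))%g.
  by rewrite conjgE invgK expgD !mulgA mulgKV.
have Nbi : (b ^ (y ^- i))%g \in N by rewrite memJ_norm // groupV groupX.
rewrite !SE ?(groupM Na Nbi) // sM // exprD -!mulrA; congr (_ * _).
by rewrite !mulrA sYi.
Qed.
End ExtendMultiplicative.

Section RootExists.
Variable k : closedFieldType.
Lemma nth_root_exists (a : k) n : (0 < n)%N -> exists x, x ^+ n = a.
Proof.
move=> n_gt0; have [x Dx] := solve_monicpoly (fun i => if i == 0%N then a else 0) n_gt0.
exists x; rewrite Dx; case: n n_gt0 {Dx} => // n _.
rewrite big_ord_recl /= mulr1 big1 ?addr0 // => i _.
by rewrite mul0r.
Qed.
End RootExists.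

(** k^x is divisible: elements [y] of [A] are adjoined one at a time, each sent to a root of the
    value already prescribed on its first positive power lying in [D]. *)
Lemma extend_char (k : closedFieldType) (T : finGroupType) (D A : {group T})
    (chi : T -> k) :
  abelian A -> D \subset A ->
  {in D &, forall a b, chi (a * b)%g = chi a * chi b} ->
  {in D, forall a, chi a != 0} ->
  exists psi : T -> k, [/\ {in A &, forall a b, psi (a * b)%g = psi a * psi b},
     {in A, forall a, psi a != 0} & {in D, psi =1 chi}].
Proof.
move=> cAA; move: {2}(#|A| - #|D|)%N (leqnn (#|A| - #|D|)) => n.
elim: n D chi => [|n IH] D chi le_n sDA chiM chi0.
  have eDA : D :=: A by apply/eqP; rewrite eqEcard sDA -subn_eq0 -leqn0.
  by exists chi; rewrite -eDA.
have [sAD|] := boolP (A \subset D).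
  have eDA : D :=: A by apply/eqP; rewrite eqEsubset sDA.
  by exists chi; rewrite -eDA.
case/subsetPn=> y Ay notDy.
have cDy : y \in 'C(D)%g by apply: (subsetP (centS sDA)); apply: (subsetP cAA).
have nDy : y \in 'N(D)%g by apply: (subsetP (cent_sub _)).
have [Y DY] := nth_root_exists (chi (y ^+ #[coset D y])%g) (order_gt0 (coset D y)).
have [S [_ SN SM]] : exists S : T -> k,
    [/\ {in D, forall a i, S (a * y ^+ i)%g = chi a * Y ^+ i},
        {in D, S =1 chi} &
        {in (D * <[y]>)%g &, forall a b, S (a * b)%g = S a * S b}].
  apply: (extend_mult_hom nDy chiM _ DY) => a Da.
  have -> : (a ^ y^-1 = a)%g.
    by apply/conjg_fixP/commgP/commuteV/commute_sym/(centP cDy).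
  by rewrite mulrC.
pose H := (D <*> <[y]>)%G.
have eH : H :=: (D * <[y]>)%g by rewrite /= norm_joinEr // cycle_subG.
have sHA : H \subset A by rewrite join_subG sDA cycle_subG.
have sDH : D \subset H := joing_subl _ _.
have Hy : y \in H by rewrite -cycle_subG joing_subr.
have [|||psi [pM p0 pD]] := IH H S _ sHA.
- have pDH : D \proper H by rewrite properE sDH; apply/subsetPn; exists y.
  rewrite leq_subLR; move/proper_card: pDH; move: le_n; rewrite leq_subLR => le1 le2.
  by apply: leq_trans le1 _; rewrite addnS -addSn leq_add2r.
- by rewrite eH.
- have S1 : S 1%g != 0 by rewrite SN ?chi0.
  move=> a Ha; apply: contra S1 => /eqP Sa0.
  by rewrite -(mulgV a) SM -?eH ?groupV // Sa0 mul0r.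
exists psi; split=> // a Da; rewrite pD ?SN //.
exact: (subsetP sDH).
Qed.

(** * Triviality of 2-cocycles with values in a field *)

Section Trivial.
Variables (k : fieldType) (T : finGroupType).
Implicit Types (G H N : {group T}) (c : T -> T -> k).

Definition trivializes (H : {set T}) c (g : T -> k) :=
  {in H, forall x, g x != 0} /\ {in H &, forall x y, c x y * g (x * y)%g = g x * g y}.

Definition triv (H : {set T}) c := exists g, trivializes H c g.

Lemma cohomologous1P H c : cohomologous H c (fun _ _ => 1) <-> triv H c.
Proof.
split=> [] [g [g0 gE]]; exists g; split=> // x y Hx Hy.
  by rewrite gE // mul1r divfK // g0 // groupM.
by rewrite mul1r -gE // mulfK // g0 // groupM.
Qed.

Lemma trivS (H K : {set T}) c : H \subset K -> triv K c -> triv H c.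
Proof.
move=> /subsetP sHK [g [g0 gE]]; exists g.
by split=> [x /sHK /g0 // | x y /sHK Kx /sHK Ky]; rewrite gE.
Qed.

Lemma cocycle2S (H K : {set T}) c : H \subset K -> cocycle2 K c -> cocycle2 H c.
Proof.
move=> /subsetP sHK [c0 cE]; split=> [x y /sHK Kx /sHK Ky | x y z /sHK Kx /sHK Ky /sHK Kz].
  exact: c0.
exact: cE.
Qed.

(** Later this turns triviality on the line stabilizer into the vanishing of [twist]. *)
Lemma triv_comm H c x y : triv H c -> x \in H -> y \in H -> commute x y -> c x y = c y x.
Proof.
move=> [g [g0 gE]] Hx Hy cxy; apply: (@mulIf _ (g (x * y)%g)); first by rewrite g0 ?groupM.
by rewrite gE // cxy gE // mulrC.
Qed.

Section Cocycle.
Variables (G : {group T}) (c : T -> T -> k).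
Hypothesis cocG : cocycle2 G c.

Lemma cocycle_neq0 x y : x \in G -> y \in G -> c x y != 0.
Proof. by move=> Gx Gy; apply: (proj1 cocG). Qed.

Lemma cocycleE x y z : x \in G -> y \in G -> z \in G ->
  c x y * c (x * y)%g z = c y z * c x (y * z)%g.
Proof. by move=> Gx Gy Gz; apply: (proj2 cocG). Qed.

Lemma cocycle1l x : x \in G -> c 1%g x = c 1%g 1%g.
Proof.
move=> Gx; have := @cocycleE 1%g 1%g x (group1 _) (group1 _) Gx.
rewrite !mul1g => /mulIf -> //; exact: cocycle_neq0.
Qed.

Lemma cocycle1r x : x \in G -> c x 1%g = c 1%g 1%g.
Proof.
move=> Gx; have := @cocycleE x 1%g 1%g Gx (group1 _) (group1 _).
rewrite !mulg1 => /mulIf -> //; exact: cocycle_neq0.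
Qed.

(* Right multiplication in the twisted group algebra. *)
Lemma twisted_repr : exists n (M : T -> 'M[k]_n),
  {in G &, forall x y, M x * M y = c x y *: M (x * y)%g} /\ {in G, forall x, M x != 0}.
Proof.
pose M x : 'M[k]_#|T| := \matrix_(i, j)
  (if (enum_val i \in G) && (enum_val j == enum_val i * x)%g then c (enum_val i) x else 0).
exists #|T|, M; split=> [x y Gx Gy | x Gx].
  apply/matrixP=> i j; rewrite !mxE.
  have [Gi|notGi] /= := boolP (enum_val i \in G); last first.
    rewrite mulr0 big1 // => l _; by rewrite !mxE (negPf notGi) mul0r.
  rewrite (bigD1 (enum_rank (enum_val i * x)%g)) //= !mxE enum_rankK Gi eqxx /=.
  rewrite groupM //= big1 ?addr0 => [|l nel]; last first.
    rewrite !mxE; case: eqP => [El|_]; last by rewrite andbF mul0r.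
    by rewrite -El enum_valK eqxx in nel.
  rewrite mulgA; case: eqP => _; rewrite ?mulr0 //.
  exact: cocycleE.
apply/eqP => /matrixP/(_ (enum_rank 1%g) (enum_rank x)); rewrite !mxE !enum_rankK.
by rewrite group1 mul1g eqxx /=; apply/eqP/cocycle_neq0.
Qed.

Section Twist.
Variables (N : {group T}) (g : T -> k).
Hypotheses (sNG : N \subset G) (gN : trivializes N c g).

(* If s n := M n / g n is the splitting of the central extension over N given
   by g, then M y * s n = twist y n *: (s (n ^ y^-1) * M y). *)
Definition twist y n := c y n * g (n ^ y^-1)%g / (c (n ^ y^-1)%g y * g n).

Lemma conjVE (y n : T) : (n ^ y^-1 = y * n * y^-1)%g.
Proof. by rewrite conjgE invgK mulgA. Qed.

Lemma conjVM (y n : T) : (n ^ y^-1 * y = y * n)%g.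
Proof. by rewrite conjVE mulgKV. Qed.

Lemma memN_G n : n \in N -> n \in G. Proof. exact: (subsetP sNG). Qed.

Lemma trivializes_neq0 n : n \in N -> g n != 0. Proof. exact: (proj1 gN). Qed.

Lemma twist_neq0 y n : y \in G -> y \in 'N(N)%g -> n \in N -> twist y n != 0.
Proof.
move=> Gy nNy Nn; have Nny : (n ^ y^-1 \in N)%g by rewrite memJ_norm ?groupV.
by rewrite /twist mulf_neq0 ?invr_eq0 ?mulf_neq0 ?cocycle_neq0 ?trivializes_neq0 // ?memN_G.
Qed.

Lemma twistE y n : y \in G -> y \in 'N(N)%g -> n \in N ->
  twist y n * (c (n ^ y^-1)%g y * g n) = c y n * g (n ^ y^-1)%g.
Proof.
move=> Gy nNy Nn; have Nny : (n ^ y^-1 \in N)%g by rewrite memJ_norm ?groupV.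
by rewrite divfK // mulf_neq0 ?cocycle_neq0 ?trivializes_neq0 // ?memN_G.
Qed.

(** The splitting over [N] and its conjugate by [y] differ by a character. With n' and m' the
    conjugates of [n] and [m] by [y^-1], the computation combines the cocycle identities at (y, n,
    m), (n', y, m) and (n', m', y). *)
Lemma twistM y n m : y \in G -> y \in 'N(N)%g -> n \in N -> m \in N ->
  twist y (n * m)%g = twist y n * twist y m.
Proof.
move=> Gy nNy Nn Nm.
have Nny : (n ^ y^-1 \in N)%g by rewrite memJ_norm ?groupV.
have Nmy : (m ^ y^-1 \in N)%g by rewrite memJ_norm ?groupV.
have Nnm : (n * m \in N)%g by rewrite groupM.
have GN := memN_G.
have e1 := @cocycleE y n m Gy (GN _ Nn) (GN _ Nm).
have e2 := @cocycleE (n ^ y^-1)%g y m (GN _ Nny) Gy (GN _ Nm).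
have e3 := @cocycleE (n ^ y^-1)%g (m ^ y^-1)%g y (GN _ Nny) (GN _ Nmy) Gy.
rewrite conjVM in e2; rewrite conjVM in e3.
have g1 := proj2 gN n m Nn Nm; have g2 := proj2 gN _ _ Nny Nmy.
rewrite -conjMg in g2 e3.
rewrite /twist.
have cn := cocycle_neq0; have gn := trivializes_neq0.
have Nnmy : ((n * m) ^ y^-1 \in N)%g by rewrite memJ_norm ?groupV.
rewrite mulf_div; apply/eqP; rewrite eqr_div; last 2 first.
- by rewrite mulf_neq0 ?cn ?gn // ?GN.
- by rewrite !mulf_neq0 ?cn ?gn // ?GN.
apply/eqP.
have h1 : c n m != 0 by apply: cn; apply: GN.
have h2 : c (n ^ y^-1)%g (m ^ y^-1)%g != 0 by apply: cn; apply: GN.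
have h3 : c (n ^ y^-1)%g (y * m)%g != 0 by apply: cn; [apply: GN | rewrite groupM // GN].
have h4 : c (y * n)%g m != 0 by apply: cn; [rewrite groupM // GN | apply: GN].
apply: (mulfI (mulf_neq0 (mulf_neq0 h1 h2) (mulf_neq0 h3 h4))).
transitivity ((c n m * c y (n * m)%g) * (c (n ^ y^-1)%g (m ^ y^-1)%g * g ((n * m) ^ y^-1)%g)
  * (c (n ^ y^-1)%g y * c (y * n)%g m * (c (m ^ y^-1)%g y * c (n ^ y^-1)%g (y * m)%g)) * (g n * g m)).
  ring.
rewrite -e1 g2 e2 -e3 -g1; ring.
Qed.

(** [M (y * z)] is proportional to [M y * M z], so it is moved past the splitting first across [z],
    then across [y]. *)
Lemma twist_comp y z n : y \in G -> z \in G -> y \in 'N(N)%g -> z \in 'N(N)%g -> n \in N ->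
  twist (y * z)%g n = twist y (n ^ z^-1)%g * twist z n.
Proof.
move=> Gy Gz nNy nNz Nn.
have GN := memN_G; have cn := cocycle_neq0; have gn := trivializes_neq0.
have Nz : (n ^ z^-1 \in N)%g by rewrite memJ_norm ?groupV.
have Ny : ((n ^ z^-1) ^ y^-1 \in N)%g by rewrite memJ_norm ?groupV.
rewrite /twist invMg conjgM; set m := (n ^ z^-1)%g in Nz Ny *; set l := (m ^ y^-1)%g in Ny *.
have e1 := @cocycleE y z n Gy Gz (GN _ Nn).
have e2 := @cocycleE y m z Gy (GN _ Nz) Gz.
have e3 := @cocycleE l y z (GN _ Ny) Gy Gz.
rewrite -(conjVM z n) -/m in e1; rewrite -(conjVM y m) -/l in e2.
rewrite mulf_div; apply/eqP; rewrite eqr_div; last 2 first.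
- by rewrite mulf_neq0 ?cn ?gn // ?(groupM Gy Gz) // GN.
- by rewrite !mulf_neq0 ?cn ?gn // ?GN.
apply/eqP.
have h1 : c y z != 0 by apply: cn.
have h2 : c y (m * z)%g != 0 by apply: cn; [| rewrite groupM // GN].
have h3 : c (l * y)%g z != 0 by apply: cn; [rewrite groupM // GN |].
apply: (mulfI (mulf_neq0 h1 (mulf_neq0 h2 h3))).
transitivity ((c y z * c (y * z)%g n) * (c m z * c y (m * z)%g) * (c l y * c (l * y)%g z) * g l * g m * g n).
  ring.
rewrite e1 -e2 e3; ring.
Qed.

Lemma twist1 n : n \in N -> twist 1%g n = 1.
Proof.
move=> Nn; rewrite /twist invg1 conjg1 cocycle1l ?cocycle1r // ?memN_G //.
by rewrite divff // mulf_neq0 ?cocycle_neq0 ?trivializes_neq0.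
Qed.

Lemma twist_sym y n : y \in G -> n \in N -> commute y n -> c y n = c n y -> twist y n = 1.
Proof.
move=> Gy Nn cyn eyn; rewrite /twist (_ : n ^ y^-1 = n)%g ?eyn; last first.
  by apply/conjg_fixP/commgP/commuteV.
by rewrite divff // mulf_neq0 ?cocycle_neq0 ?trivializes_neq0 // ?memN_G.
Qed.

End Twist.
End Cocycle.
End Trivial.

(** * Cyclic extensions of a group on which the class is trivial *)

Section Extension.
Variables (k : closedFieldType) (T : finGroupType).
Implicit Types (c : T -> T -> k) (g : T -> k).

(** A trivial twist says that [M y] conjugates the splitting over [N] to itself. Rescaling [M y] by
    a root makes its m-th power equal to the splitting at [y ^+ m], so the splitting extends to [G].
    Its values are scalar multiples of the [M x], and the inverse scalars trivialize [c]. *)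
Lemma triv_cyclic_ext (G N : {group T}) y c g :
    cocycle2 G c -> N \subset G -> y \in G -> y \in 'N(N)%g -> G :=: (N * <[y]>)%g ->
    trivializes N c g -> {in N, forall n, twist c g y n = 1} ->
  triv G c.
Proof.
move=> cocG sNG Gy nNy defG gN tw1.
have GN n : n \in N -> n \in G by apply: (subsetP sNG).
have cn := cocycle_neq0 cocG; have gn := trivializes_neq0 gN.
have [d [M [MM M0]]] := twisted_repr cocG.
pose s n : 'M[k]_d := (g n)^-1 *: M n.
have sM : {in N &, forall a b, s (a * b)%g = s a * s b}.
  move=> a b Na Nb; have e := proj2 gN a b Na Nb.
  rewrite /s -[_ * _]/(_ *m _) -scalemxAl -scalemxAr [_ *m _]MM // ?GN // !scalerA.
  congr (_ *: _); apply: (mulfI (mulf_neq0 (gn _ Na) (gn _ Nb))).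
  transitivity (c a b); first by rewrite -e mulfK // gn ?groupM.
  by field; rewrite !gn.
have sY0 : {in N, forall a, M y * s a = s (a ^ y^-1)%g * M y}.
  move=> a Na; have Nay : (a ^ y^-1 \in N)%g by rewrite memJ_norm ?groupV.
  have := twistE cocG sNG gN Gy nNy Na; rewrite tw1 // mul1r => e.
  rewrite /s -[LHS]/(_ *m _) -[RHS]/(_ *m _) -scalemxAl -scalemxAr.
  rewrite [M y *m _]MM // ?GN // [M _ *m _]MM // ?GN // conjVM !scalerA; congr (_ *: _).
  apply: (mulfI (mulf_neq0 (gn _ Na) (gn _ Nay))).
  transitivity (c y a * g (a ^ y^-1)%g); first by field; rewrite gn.
  by rewrite -e; field; rewrite gn.
set m := #[coset N y].
have m_gt0 : (0 < m)%N := order_gt0 _.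
(* The exponent starts at 1 because [M 1] is not known to be a multiple of the identity matrix. *)
have Mpow i : exists2 b, b != 0 & M y ^+ i.+1 = b *: M (y ^+ i.+1)%g.
  elim: i => [|i [b b0 IH]]; first by exists 1; rewrite ?oner_eq0 // scale1r.
  exists (b * c y (y ^+ i.+1)%g); first by rewrite mulf_neq0 ?cn ?groupX.
  rewrite exprS IH -[_ * _]/(_ *m _) -scalemxAr [_ *m _]MM ?groupX // scalerA.
  by rewrite -expgS.
have [b b0 Db] := Mpow m.-1; rewrite prednK // in Db.
have Nym : (y ^+ m \in N)%g by rewrite expg_mem_order_coset.
have [a Da] := nth_root_exists (b * g (y ^+ m)%g)^-1 m_gt0.
have a0 : a != 0.
  apply/negP=> /eqP a0; move/eqP: Da; rewrite a0 expr0n (gtn_eqF m_gt0) /=.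
  by rewrite eq_sym invr_eq0 mulf_eq0 (negPf b0) (negPf (gn _ Nym)).
have Ym : (a *: M y) ^+ m = s (y ^+ m)%g.
  rewrite /s; transitivity (a ^+ m *: M y ^+ m).
    elim: (m) => [|i IH]; first by rewrite !expr0 scale1r.
    by rewrite !exprS IH -[LHS]/(_ *m _) -scalemxAl -scalemxAr scalerA.
  by rewrite Da Db scalerA invfM mulrAC mulVf // mul1r.
have sY : {in N, forall n, (a *: M y) * s n = s (n ^ y^-1)%g * (a *: M y)}.
  move=> n Nn; rewrite -[LHS]/(_ *m _) -[RHS]/(_ *m _) -scalemxAl.
  by rewrite -[RHS]scalemxAr; congr (_ *: _); apply: sY0.
have [S [SE _ SM]] := extend_mult_hom nNy sM sY Ym.
have Sx x : exists h, x \in G -> h != 0 /\ S x = h *: M x.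
  have [|notGx] := boolP (x \in G); last by exists 0.
  rewrite defG => /mulsgP[n _ Nn /cycleP[i ->] ->]; rewrite SE //.
  have [b' b'0 Db'] : exists2 b', b' != 0 & s n * (a *: M y) ^+ i = b' *: M (n * y ^+ i)%g.
    elim: i => [|i [b' b'0 IH]].
      by exists (g n)^-1; rewrite ?invr_eq0 ?gn // expr0 mulr1 expg0 mulg1.
    exists (b' * a * c (n * y ^+ i)%g y).
      by rewrite !mulf_neq0 ?cn ?groupM ?groupX // ?GN.
    rewrite exprSr mulrA IH -[_ * _]/(_ *m _) -scalemxAl -scalemxAr [_ *m _]MM ?groupM ?groupX // ?GN //.
    by rewrite !scalerA expgSr mulgA.
  by exists b'.
have [h hE] := fin_all_exists Sx.
exists (fun x => (h x)^-1); split=> [x /hE[] | x y' Gx Gy'].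
  by rewrite invr_eq0.
have [hx Dx] := hE x Gx; have [hy Dy] := hE y' Gy'.
have [hxy Dxy] := hE (x * y')%g (groupM Gx Gy').
have := SM x y'; rewrite -defG => /(_ Gx Gy').
rewrite Dx Dy Dxy -[_ * _]/(_ *m _) -scalemxAl -scalemxAr [_ *m _]MM // !scalerA.
move/eqP; rewrite -subr_eq0 -scalerBl scaler_eq0 (negPf (M0 _ (groupM Gx Gy'))) orbF.
rewrite subr_eq0 => /eqP->; have cxy := cn x y' Gx Gy'.
by field; rewrite hx hy cxy.
Qed.

(* twist y factors through n |-> [n, y] modulo N', so it is the coboundary of a
   character of N / N', which corrects the splitting over N. *)
Lemma triv_cyclic_ext_der (G N : {group T}) y c g :
    cocycle2 G c -> N \subset G -> y \in G -> y \in 'N(N)%g -> G :=: (N * <[y]>)%g ->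
    trivializes N c g ->
    {in N, forall n, (n ^ y^-1 * n^-1)%g \in N^`(1)%g -> twist c g y n = 1} ->
  triv G c.
Proof.
move=> cocG sNG Gy nNy defG gN tw1.
have gn := trivializes_neq0 gN.
pose D n := coset N^`(1) (n ^ y^-1 * n^-1)%g.
have nNN n : n \in N -> n \in 'N(N^`(1))%g by apply: (subsetP (der_norm _ _)).
have Ny n : n \in N -> (n ^ y^-1 \in N)%g by move=> Nn; rewrite memJ_norm ?groupV.
have NyV n : n \in N -> (n ^ y^-1 * n^-1 \in N)%g.
  by move=> Nn; apply: groupM; [apply: Ny | rewrite groupV].
have abNN : abelian (N / N^`(1)) := sub_der1_abelian (subxx _).
have DM : {in N &, {morph D : a b / (a * b)%g}}.
  move=> a b Na Nb; rewrite /D.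
  have -> : ((a * b) ^ y^-1 * (a * b)^-1 =
     (a ^ y^-1 * a^-1) * (b ^ y^-1 * b^-1) ^ a^-1)%g.
    by rewrite conjMg !conjgE !invMg !invgK !mulgA !mulgKV.
  have NaV : (a^-1 \in N)%g by rewrite groupV.
  have Na' := NyV _ Na; have Nb' := NyV _ Nb.
  have Nb'' : ((b ^ y^-1 * b^-1) ^ a^-1 \in N)%g by rewrite groupJ.
  rewrite (morphM _ (nNN _ Na') (nNN _ Nb'')); congr (_ * _)%g.
  rewrite (morphJ _ (nNN _ Nb') (nNN _ NaV)).
  by apply/conjg_fixP/commgP; apply: (centsP abNN); apply: mem_quotient.
pose Dm := Morphism DM.
have tw_ker a b : a \in N -> b \in N -> D a = D b -> twist c g y a = twist c g y b.
  move=> Na Nb eD; have Nab : (a * b^-1 \in N)%g by rewrite groupM ?groupV.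
  have : Dm (a * b^-1)%g = 1%g by rewrite morphM ?morphV ?groupV //= eD mulgV.
  move/coset_idr; rewrite nNN ?NyV // => /(_ isT) /(tw1 _ Nab) e.
  by rewrite -[a in LHS](mulgKV b) (twistM cocG sNG gN) // e mul1r.
pose chi d := if [pick n in N | D n == d] is Some n then twist c g y n else 0.
have chiE n : n \in N -> chi (D n) = twist c g y n.
  move=> Nn; rewrite /chi; case: pickP => [m /andP[Nm /eqP eD]|/(_ n)].
    exact: tw_ker.
  by rewrite /= Nn eqxx.
have sDA : (Dm @* N)%G \subset (N / N^`(1))%G.
  apply/subsetP=> _ /morphimP[n _ Nn ->]; exact: mem_quotient (NyV _ Nn).
have [|| psi [pM p0 pD]] := @extend_char k _ (Dm @* N)%G (N / N^`(1))%G chi abNN sDA.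
- move=> _ _ /morphimP[a _ Na ->] /morphimP[b _ Nb ->].
  rewrite -morphM //= !chiE ?groupM //; exact: (twistM cocG sNG gN).
- move=> _ /morphimP[a _ Na ->]; rewrite chiE //; exact: (twist_neq0 cocG sNG gN).
have pN n : n \in N -> psi (coset N^`(1) n) != 0.
  by move=> Nn; rewrite p0 ?mem_quotient.
(* Dividing [g] by [psi] divides the twist at [n] by [psi (D n)], which is the old twist itself. *)
apply: (@triv_cyclic_ext G N y c (fun n => g n / psi (coset N^`(1) n))) => //.
  split=> [n Nn|a b Na Nb]; first by rewrite mulf_neq0 ?invr_eq0 ?gn ?pN.
  rewrite morphM ?nNN // pM ?mem_quotient // mulrA (proj2 gN) //.
  by field; rewrite !pN.
move=> n Nn; rewrite /twist.
have ePsi : psi (coset N^`(1) (n ^ y^-1))%g = twist c g y n * psi (coset N^`(1) n).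
  rewrite -chiE // -pD ?(mem_morphim Dm) // -pM ?mem_quotient ?NyV // -morphM ?nNN ?NyV //.
  by rewrite mulgKV.
rewrite ePsi; have t0 := twist_neq0 cocG sNG gN Gy nNy Nn.
have cyn : c (n ^ y^-1)%g y != 0 by apply: (cocycle_neq0 cocG) => //; apply: (subsetP sNG); apply: Ny.
apply: (mulfI t0); rewrite mulr1 {3}/twist; field.
by rewrite t0 !gn ?pN // cyn.
Qed.
End Extension.

(** * Transfer and reduction to Sylow subgroups *)

Section Transfer.
Variables (k : fieldType) (T : finGroupType).
Implicit Types (c : T -> T -> k) (g : T -> k).

(** Corestriction after restriction multiplies by the index. Concretely, with r and r' the
    representatives of [C] and [C :* x], and s the splitting over [H], the twisted algebra gives M r
    * M x = b C x * s (h C x) * M r'. The product of these monomial coefficients over all cosets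
    trivializes the power of [c]. *)
Lemma triv_transfer (G H : {group T}) c :
  cocycle2 G c -> H \subset G -> triv H c -> triv G (fun x y => c x y ^+ #|G : H|%g).
Proof.
move=> cocG sHG [g gH]; have gn := trivializes_neq0 gH; have cn := cocycle_neq0 cocG.
have GH h : h \in H -> h \in G by apply: (subsetP sHG).
have rG (C : {set T}) : C \in rcosets H G -> repr C \in G.
  case/rcosetsP=> z Gz ->; have /rcosetP[h Hh ->] := mem_repr_rcoset H z.
  by rewrite groupM // GH.
have rM (C : {set T}) x : C \in rcosets H G -> x \in G -> (C :* x)%g \in rcosets H G.
  by case/rcosetsP=> z Gz -> Gx; rewrite -rcosetM; apply/rcosetsP; exists (z * x)%g; rewrite ?groupM.
pose h (C : {set T}) (x : T) := (repr C * x * (repr (C :* x))^-1)%g.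
have hH (C : {set T}) x : C \in rcosets H G -> h C x \in H.
  case/rcosetsP=> z Gz ->; rewrite /h -rcosetM -mem_rcoset.
  rewrite (rcoset_eqP (mem_repr_rcoset H (z * x))) rcosetM.
  by rewrite mem_rcoset mulgK mem_repr_rcoset.
have hE (C : {set T}) x : (h C x * repr (C :* x) = repr C * x)%g by rewrite mulgKV.
pose b (C : {set T}) (x : T) := c (repr C) x * g (h C x) / c (h C x) (repr (C :* x)%g).
have b0 (C : {set T}) x : C \in rcosets H G -> x \in G -> b C x != 0.
  move=> HC Gx; rewrite /b !mulf_neq0 ?invr_eq0 //.
  - by apply: cn; rewrite ?rG.
  - by apply: gn; apply: hH.
  by apply: cn; [apply/GH/hH | apply/rG/rM].
have bM (C : {set T}) x y : C \in rcosets H G -> x \in G -> y \in G ->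
    c x y * b C (x * y)%g = b C x * b (C :* x)%g y.
  move=> HC Gx Gy; have HCx := rM _ _ HC Gx; have HCy := rM _ _ HCx Gy.
  have Hx := hH C x HC; have Hy := hH _ y HCx.
  have eh : h C (x * y)%g = (h C x * h (C :* x) y)%g.
    by rewrite /h rcosetM !mulgA mulgKV.
  rewrite /b rcosetM eh.
  move: (hE C x) (hE (C :* x)%g y) (rG _ HC) (rG _ HCx) (rG _ HCy) Hx Hy.
  move: (h C x) (h (C :* x)%g y) (repr C) (repr (C :* x)%g) (repr (C :* x :* y)%g).
  move=> a d r r' r'' Er Er' Gr Gr' Gr'' Ha Hd.
  have Ga := GH _ Ha; have Gd := GH _ Hd.
  have e1 := cocycleE cocG Gr Gx Gy.
  have e2 := cocycleE cocG Ga Gr' Gy; rewrite Er in e2.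
  have e3 := cocycleE cocG Ga Gd Gr''; rewrite Er' in e3.
  have e4 := proj2 gH a d Ha Hd.
  have n1 := cn _ _ Ga Gd; have n2 := cn _ _ (groupM Ga Gd) Gr''.
  have n3 := cn _ _ Ga Gr'; have n4 := cn _ _ Gd Gr''.
  have n5 := cn _ _ Ga (groupM Gr' Gy); have n6 := cn _ _ (groupM Gr Gx) Gy.
  apply: (mulfI (mulf_neq0 (mulf_neq0 n2 n1) (mulf_neq0 n3 n4))).
  apply: (mulfI n6).
  transitivity ((c x y * c r (x * y)%g) * (c a d * g (a * d)%g) *
      (c a r' * c (r * x)%g y) * c d r'').
    by field.
  rewrite -e1 e4 e2.
  transitivity (c r x * c (r * x)%g y * (g a * g d) * c r' y * (c d r'' * c a (r' * y)%g)).
    by ring.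
  by rewrite -e3; field; rewrite n3 n4.
exists (fun x => \prod_(C in rcosets H G) b C x); split=> [x Gx | x y Gx Gy].
  by apply/prodf_neq0 => C HC; apply: b0.
rewrite /indexg -prodr_const -big_split /=.
transitivity (\prod_(C in rcosets H G) (b C x * b (C :* x)%g y)).
  by apply: eq_bigr => C HC; apply: bM.
rewrite big_split /=; congr (_ * _); symmetry.
have injx : injective (fun C : {set T} => (C :* x)%g).
  by apply: (can_inj (g := fun C : {set T} => (C :* x^-1)%g)) => C; rewrite -rcosetM mulgV mulg1.
rewrite (reindex_inj injx) /=; apply: eq_bigl => C.
apply/idP/idP => HC; last exact: rM.
by have := rM _ x^-1%g HC; rewrite groupV -rcosetM mulgV mulg1; apply.
Qed.

Lemma triv_expn (G : {group T}) c m n :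
  triv G (fun x y => c x y ^+ m) -> triv G (fun x y => c x y ^+ (m * n)).
Proof.
move=> [g [g0 gE]]; exists (fun x => g x ^+ n); split=> [x Gx|x y Gx Gy].
  by rewrite expf_neq0 ?g0.
by rewrite exprM -exprMn gE // exprMn.
Qed.

Lemma triv_expn_sub (G : {group T}) c m n : cocycle2 G c -> (n <= m)%N ->
  triv G (fun x y => c x y ^+ m) -> triv G (fun x y => c x y ^+ n) ->
  triv G (fun x y => c x y ^+ (m - n)).
Proof.
move=> cocG le_nm [g [g0 gE]] [h [h0 hE]]; exists (fun x => g x / h x); split=> [x Gx|x y Gx Gy].
  by rewrite mulf_neq0 ?invr_eq0 ?g0 ?h0.
have c0 := cocycle_neq0 cocG Gx Gy.
apply: (mulfI (expf_neq0 n c0)); rewrite [LHS]mulrA -exprD subnKC //.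
have := gE _ _ Gx Gy; have := hE _ _ Gx Gy => e1 e2.
apply: (mulfI (h0 _ (groupM Gx Gy))).
transitivity (c x y ^+ m * g (x * y)%g); first by field; rewrite h0 ?groupM.
rewrite e2 [RHS](_ : _ = (c x y ^+ n * h (x * y)%g) * (g x / h x * (g y / h y))); last by ring.
by rewrite e1; field; rewrite !h0.
Qed.

(** The exponents killing the class are closed under multiples and differences, so a Bezout relation
    applies. *)
Lemma triv_exp_gcd (G : {group T}) c m n : cocycle2 G c -> (0 < m)%N ->
  triv G (fun x y => c x y ^+ m) -> triv G (fun x y => c x y ^+ n) ->
  triv G (fun x y => c x y ^+ gcdn m n).
Proof.
move=> cocG m0 tm tn; have [a b Eab _] := egcdnP n m0.
have -> : gcdn m n = (a * m - b * n)%N by rewrite Eab addnC addnK.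
by apply: triv_expn_sub; rewrite ?Eab ?leq_addr // -?Eab mulnC; apply: triv_expn.
Qed.
End Transfer.

Section Criterion.
Variables (k : closedFieldType) (p : nat) (charp : p \in [pchar k]%R).

Lemma pchar_expI e (a b : k) : a ^+ (p ^ e) = b ^+ (p ^ e) -> a = b.
Proof.
elim: e a b => [|e IH] a b; first by rewrite !expr1.
rewrite expnS !exprM => /IH; rewrite -!(pFrobenius_autE charp).
exact: fmorph_inj.
Qed.

(** Frobenius is injective on [k], so the coboundary identity passes to p^e-th roots: the class
    group has no p-torsion. *)
Lemma triv_pcharX (T : finGroupType) (G : {group T}) (c : T -> T -> k) e :
  triv G (fun x y => c x y ^+ (p ^ e)) -> triv G c.
Proof.
move=> [g [g0 gE]].
have pe0 : (0 < p ^ e)%N by rewrite expn_gt0 prime_gt0 ?(pcharf_prime charp).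
have [h hE] := fin_all_exists (fun x => nth_root_exists (g x) pe0).
exists h; split=> [x /g0|x y Gx Gy].
  by rewrite -hE; apply: contraNneq => ->; rewrite expr0n gtn_eqF.
by apply: (@pchar_expI e); rewrite !exprMn !hE gE.
Qed.

(** Descent on an exponent [n] killing the class, initially the order of [G] by transfer from the
    trivial group. A prime l <> p dividing [n] is removed by taking the gcd with an index prime to
    l; a power of [p] is absorbed by Frobenius. *)
Lemma triv_Sylow (T : finGroupType) (G : {group T}) (c : T -> T -> k) :
    cocycle2 G c ->
    (forall l, prime l -> l != p ->
      exists2 H : {group T}, H \subset G /\ triv H c & ~~ (l %| #|G : H|)%N) ->
  triv G c.
Proof.
move=> cocG Hl; pose P n := (0 < n)%N /\ triv G (fun x y => c x y ^+ n).
have t1 : triv 1%G c.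
  have c0 := cocycle_neq0 cocG (group1 _) (group1 _).
  exists (fun=> c 1%g 1%g); split=> // x y /set1P-> /set1P->.
  by [].
have P0 : P #|G| by split; rewrite // -indexg1; apply: triv_transfer; rewrite ?sub1G.
suffices [e te] : exists e, triv G (fun x y => c x y ^+ (p ^ e)) by apply: triv_pcharX te.
have {P0}: exists n, P n by exists #|G|.
case=> n; elim/ltn_ind: n => n IH [n0 tn].
have p_pr := pcharf_prime charp.
have [pn|] := boolP (p.-nat n).
  by case/p_natP: pn => e En; exists e; rewrite -En.
rewrite /pnat n0 => /allPn[l]; rewrite mem_primes inE /= => /and3P[l_pr _ ln] nlp.
have [H [sHG tH] nl] := Hl l l_pr nlp.
apply: (IH (gcdn n #|G : H|%g)).
  rewrite ltn_neqAle dvdn_leq ?dvdn_gcdl // andbT.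
  apply: contra nl => /eqP E; apply: dvdn_trans ln _.
  by rewrite -E dvdn_gcdr.
split; first by rewrite gcdn_gt0 n0.
by apply: triv_exp_gcd => //; apply: triv_transfer.
Qed.

Lemma pgroup_char_triv (T : finGroupType) (N : {group T}) (f : T -> k) n :
  {in N &, forall x y, f (x * y)%g = f x * f y} -> {in N, forall x, f x != 0} ->
  n \in N -> p.-elt n -> f n = 1.
Proof.
move=> fM f0 Nn pn.
have f1 : f 1%g = 1.
  by apply: (@mulIf _ (f 1%g)); rewrite ?f0 // -fM // mulg1 mul1r.
have fX i : f (n ^+ i)%g = f n ^+ i.
  by elim: i => [|i IH]; rewrite ?expg0 ?expr0 // expgS fM ?groupX // IH exprS.
have /p_natP[e En] : p.-nat #[n] := pn.
by apply: (@pchar_expI e); rewrite -fX -En expg_order f1 expr1n.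
Qed.

Section Descent.
Variables (T rT : finGroupType) (A : {group T}) (f : {morphism A >-> rT}).
Variable c : rT -> rT -> k.

Lemma cocycle2_pull (H : {set rT}) (B : {group T}) : B \subset A -> f @* B \subset H ->
  cocycle2 H c -> cocycle2 B (fun a b => c (f a) (f b)).
Proof.
move=> sBA /subsetP sfB [c0 cE]; have BA := subsetP sBA.
have Bf a : a \in B -> f a \in H by move=> Ba; rewrite sfB ?mem_morphim ?BA.
split=> [a b Ba Bb | a b d Ba Bb Bd]; first by rewrite c0 ?Bf.
by rewrite !morphM ?BA // cE ?Bf.
Qed.

Lemma triv_pull (B : {group T}) : B \subset A ->
  triv (f @* B) c -> triv B (fun a b => c (f a) (f b)).
Proof.
move=> sBA [g [g0 gE]]; have BA := subsetP sBA.
exists (g \o f); split=> [a Ba|a b Ba Bb] /=; first by rewrite g0 ?mem_morphim ?BA.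
by rewrite morphM ?BA // gE ?mem_morphim ?BA.
Qed.

(* A trivialization of the pullback is constant on the p-group kernel, which has no
   nontrivial characters in characteristic p. *)
Lemma triv_descent (B : {group T}) : B \subset A -> cocycle2 (f @* B) c ->
  p.-group ('ker_B f) -> triv B (fun a b => c (f a) (f b)) -> triv (f @* B) c.
Proof.
move=> sBA cocB pK [g [g0 gE]]; have BA := subsetP sBA.
pose K := 'ker_B f; have c10 := cocycle_neq0 cocB (group1 _) (group1 _).
pose d := c 1%g 1%g.
have KB n : n \in K -> [/\ n \in B, n \in A & f n = 1%g].
  by case/setIP=> Bn /mker ->; rewrite Bn BA.
have g1 n : n \in K -> g n = d.
  move=> Kn; suffices /eqP : g n / d = 1.
    by rewrite -subr_eq0 -(divff c10) -mulrBl mulf_eq0 invr_eq0 (negPf c10) orbF subr_eq0 => /eqP.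
  apply: (@pgroup_char_triv _ ('ker_B f)%G (fun n => g n / d)) => //; last first.
  - exact: mem_p_elt Kn.
  - by move=> m /KB[Bm _ _]; rewrite mulf_neq0 ?invr_eq0 ?g0.
  move=> m l /KB[Bm Am fm] /KB[Bl Al fl].
  have := gE m l Bm Bl; rewrite fm fl -/d mulf_div => <-.
  by rewrite /d; field.
have gK a b : a \in B -> b \in B -> f a = f b -> g a = g b.
  move=> Ba Bb eab; have Kab : (b^-1 * a)%g \in K.
    by rewrite inE groupM ?groupV //=; apply/kerP; rewrite ?groupM ?groupV ?BA // morphM ?morphV ?groupV ?BA // eab mulVg.
  have [Bn An fn] := KB _ Kab.
  have := gE b _ Bb Bn; rewrite mulKVg fn (g1 _ Kab) (cocycle1r cocB) ?mem_morphim ?BA // -/d mulrC.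
  by move/(mulIf c10).
pose G x := if [pick a in B | f a == x] is Some a then g a else 0.
have GE a : a \in B -> G (f a) = g a.
  move=> Ba; rewrite /G; case: pickP => [b /andP[Bb /eqP eb]|/(_ a)]; first exact: gK.
  by rewrite /= Ba eqxx.
exists G; split=> [_ /morphimP[a Aa Ba ->]|_ _ /morphimP[a Aa Ba ->] /morphimP[b Ab Bb ->]].
  by rewrite GE // g0.
by rewrite -morphM // !GE ?groupM // gE.
Qed.
End Descent.
End Criterion.

(** * Two-by-two matrices: centralizers and eigenlines *)

Section Matrix2.
Variable F : fieldType.
Implicit Types (A B X : 'M[F]_2) (w u : 'rV[F]_2).
Local Notation i0 := (0 : 'I_2).
Local Notation i1 := (1 : 'I_2).

Lemma ord2P (i : 'I_2) : (i = i0) \/ (i = i1).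
Proof. by case: i => [[|[|i]] Hi] //; [left | right]; apply: val_inj. Qed.

Lemma mx2P A B : A i0 i0 = B i0 i0 -> A i0 i1 = B i0 i1 -> A i1 i0 = B i1 i0 ->
  A i1 i1 = B i1 i1 -> A = B.
Proof.
by move=> *; apply/matrixP=> i j; case: (ord2P i) => ->; case: (ord2P j) => ->.
Qed.

Lemma mulmx2 m n (A : 'M[F]_(m, 2)) (B : 'M_(2, n)) i j :
  (A *m B) i j = A i i0 * B i0 j + A i i1 * B i1 j.
Proof.
rewrite mxE !big_ord_recl big_ord0 addr0.
by rewrite (_ : lift ord0 ord0 = i1) //; apply: val_inj.
Qed.

Lemma det2 A : \det A = A i0 i0 * A i1 i1 - A i0 i1 * A i1 i0.
Proof.
rewrite (expand_det_row _ i0) !big_ord_recl big_ord0 addr0 /cofactor !det_mx11 !mxE /=.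
rewrite addn0 addn1 expr0 expr1 mul1r mulN1r mulrN.
by congr (A _ _ * A _ _ - A _ _ * A _ _); apply: val_inj.
Qed.

Lemma tr2 A : \tr A = A i0 i0 + A i1 i1.
Proof.
rewrite /mxtrace !big_ord_recl big_ord0 addr0.
by rewrite (_ : lift ord0 ord0 = i1) //; apply: val_inj.
Qed.

Lemma cayley2 A : A *m A = \tr A *: A - (\det A)%:M.
Proof. by apply: mx2P; rewrite mulmx2 tr2 det2 !mxE /=; ring. Qed.

Lemma det2_sub_scalar A a : \det (A - a%:M) = \det A - a * \tr A + a ^+ 2.
Proof. by rewrite !det2 tr2 !mxE /=; ring. Qed.

Lemma eigen_root A w a : w != 0 -> w *m A = a *: w -> \det A - a * \tr A + a ^+ 2 = 0.
Proof.
move=> w0 wA; rewrite -det2_sub_scalar; apply/eqP/det0P; exists w => //.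
by rewrite mulmxBr wA mul_mx_scalar subrr.
Qed.

(** Commuting with [X] means that the triple (A01, A10, A00 - A11) is parallel to that of [X], which
    is nonzero as [X] is nonscalar. So the triples of [A] and [B] are parallel, and the entries of A
    B - B A are, up to sign, their minors. *)
Lemma cent2_comm X A B : (forall a, X != a%:M) ->
  A *m X = X *m A -> B *m X = X *m B -> A *m B = B *m A.
Proof.
move=> nX /matrixP eA /matrixP eB.
have := eA i0 i0; have := eA i0 i1; have := eA i1 i0.
have := eB i0 i0; have := eB i0 i1; have := eB i1 i0.
rewrite !mulmx2 => b1 b2 b3 a1 a2 a3 {eA eB}.
have {nX} : [|| X i0 i1 != 0, X i1 i0 != 0 | X i0 i0 - X i1 i1 != 0].
  apply: contraR (nX (X i0 i0)); rewrite !negb_or !negbK => /and3P[/eqP e1 /eqP e2].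
  by rewrite subr_eq0 => /eqP e3; apply/eqP/mx2P; rewrite !mxE //= ?mulr1n ?mulr0n.
set x := X i0 i0 - X i1 i1; set y := X i0 i1; set z := X i1 i0.
set a := A i0 i0 - A i1 i1; set b := B i0 i0 - B i1 i1.
have {}a1 : A i1 i0 * x = a * z by rewrite /x /a /z; apply/eqP; rewrite -subr_eq0; apply/eqP; move/eqP: a1; rewrite -subr_eq0 => /eqP <-; ring.
have {}a2 : A i0 i1 * x = a * y by rewrite /x /a /y; apply/eqP; rewrite -subr_eq0; apply/eqP; move/eqP: a2; rewrite eq_sym -subr_eq0 => /eqP <-; ring.
have {}a3 : A i0 i1 * z = A i1 i0 * y by rewrite /y /z; apply/eqP; rewrite -subr_eq0; apply/eqP; move/eqP: a3; rewrite -subr_eq0 => /eqP <-; ring.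
have {}b1 : B i1 i0 * x = b * z by rewrite /x /b /z; apply/eqP; rewrite -subr_eq0; apply/eqP; move/eqP: b1; rewrite -subr_eq0 => /eqP <-; ring.
have {}b2 : B i0 i1 * x = b * y by rewrite /x /b /y; apply/eqP; rewrite -subr_eq0; apply/eqP; move/eqP: b2; rewrite eq_sym -subr_eq0 => /eqP <-; ring.
have {}b3 : B i0 i1 * z = B i1 i0 * y by rewrite /y /z; apply/eqP; rewrite -subr_eq0; apply/eqP; move/eqP: b3; rewrite -subr_eq0 => /eqP <-; ring.
move=> nz.
have [m1 m2 m3] : [/\ A i0 i1 * B i1 i0 = B i0 i1 * A i1 i0, A i0 i1 * b = B i0 i1 * a
   & A i1 i0 * b = B i1 i0 * a].
  case/or3P: nz => nz; split; apply: (mulIf nz).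
  - transitivity (A i0 i1 * (B i1 i0 * y)); first by ring.
    by rewrite -b3; transitivity (B i0 i1 * (A i0 i1 * z)); [ring | rewrite a3; ring].
  - by transitivity (A i0 i1 * (b * y)); [ring | rewrite -b2; transitivity (B i0 i1 * (A i0 i1 * x)); [ring | rewrite a2; ring]].
  - by transitivity (A i1 i0 * (b * y)); [ring | rewrite -b2; transitivity (B i0 i1 * (A i1 i0 * x)); [ring | rewrite a1; transitivity (a * (B i0 i1 * z)); [ring | rewrite b3; ring]]].
  - by transitivity (B i1 i0 * (A i0 i1 * z)); [ring | rewrite a3; transitivity (A i1 i0 * (B i1 i0 * y)); [ring | rewrite -b3; ring]].
  - by transitivity (A i0 i1 * (b * z)); [ring | rewrite -b1; transitivity (B i1 i0 * (A i0 i1 * x)); [ring | rewrite a2; transitivity (a * (B i1 i0 * y)); [ring | rewrite -b3; ring]]].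
  - by transitivity (A i1 i0 * (b * z)); [ring | rewrite -b1; transitivity (B i1 i0 * (A i1 i0 * x)); [ring | rewrite a1; ring]].
  - by transitivity ((A i0 i1 * x) * B i1 i0); [ring | rewrite a2; transitivity (a * (B i1 i0 * y)); [ring | rewrite -b3; transitivity (B i0 i1 * (a * z)); [ring | rewrite -a1; ring]]].
  - by transitivity ((A i0 i1 * x) * b); [ring | rewrite a2; transitivity (a * (b * y)); [ring | rewrite -b2; ring]].
  - by transitivity ((A i1 i0 * x) * b); [ring | rewrite a1; transitivity (a * (b * z)); [ring | rewrite -b1; ring]].
apply: mx2P; rewrite !mulmx2; apply/eqP; rewrite -subr_eq0; apply/eqP.
- by move/eqP: m1; rewrite -subr_eq0 => /eqP <-; ring.
- by move/eqP: m2; rewrite eq_sym -subr_eq0 => /eqP <-; rewrite /a /b; ring.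
- by move/eqP: m3; rewrite -subr_eq0 => /eqP <-; rewrite /a /b; ring.
by move/eqP: m1; rewrite eq_sym -subr_eq0 => /eqP <-; ring.
Qed.

Lemma indep2_eq0 w u A : w 0 i0 * u 0 i1 - w 0 i1 * u 0 i0 != 0 ->
  w *m A = 0 -> u *m A = 0 -> A = 0.
Proof.
move=> d wA uA; have A0 j : A i0 j = 0 /\ A i1 j = 0.
  move/matrixP/(_ 0 j): wA; move/matrixP/(_ 0 j): uA; rewrite !mulmx2 !(mxE _ _ 0 j) => eu ew.
  split; apply: (mulfI d); rewrite mulr0.
    transitivity (u 0 i1 * (w 0 i0 * A i0 j + w 0 i1 * A i1 j) - w 0 i1 * (u 0 i0 * A i0 j + u 0 i1 * A i1 j)); first by ring.
    by rewrite eu ew !mulr0 subrr.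
  transitivity (w 0 i0 * (u 0 i0 * A i0 j + u 0 i1 * A i1 j) - u 0 i0 * (w 0 i0 * A i0 j + w 0 i1 * A i1 j)); first by ring.
  by rewrite eu ew !mulr0 subrr.
by apply/matrixP=> i j; rewrite mxE; case: (A0 j); case: (ord2P i) => ->.
Qed.

(** [w *m B] lies in the eigenspace of [A] for [a], which is a line because [A] is not scalar. *)
Lemma eigen_cent2 A B w a : w != 0 -> w *m A = a *: w -> (forall b, A != b%:M) ->
  A *m B = B *m A -> exists b, w *m B = b *: w.
Proof.
move=> w0 wA nA cAB; set u := w *m B.
have uA : u *m A = a *: u by rewrite -mulmxA -cAB mulmxA wA -scalemxAl.
have d0 : w 0 i0 * u 0 i1 - w 0 i1 * u 0 i0 = 0.
  have [//|d] := eqVneq (w 0 i0 * u 0 i1 - w 0 i1 * u 0 i0) 0.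
  case/eqP: (nA a); apply/eqP; rewrite -subr_eq0; apply/eqP/(indep2_eq0 d).
    by rewrite mulmxBr wA mul_mx_scalar subrr.
  by rewrite mulmxBr uA mul_mx_scalar subrr.
have [w00|w00] := eqVneq (w 0 i0) 0.
  have w1 : w 0 i1 != 0.
    apply: contraNneq w0 => w1; apply/eqP/rowP=> j; rewrite mxE.
    by case: (ord2P j) => ->.
  exists (u 0 i1 / w 0 i1); apply/rowP=> j; rewrite [RHS]mxE.
  case: (ord2P j) => ->; last by rewrite divfK.
  move/eqP: d0; rewrite w00 mul0r sub0r oppr_eq0 mulf_eq0 (negPf w1) => /eqP ->.
  by rewrite mulr0.
exists (u 0 i0 / w 0 i0); apply/rowP=> j; rewrite [RHS]mxE.
case: (ord2P j) => ->; first by rewrite divfK.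
apply: (mulfI w00); move/eqP: d0; rewrite subr_eq0 => /eqP->; field => //.
Qed.
End Matrix2.

(** * Subgroups of GL_2(p) *)

Section TrivCyclic.
Variables (k : closedFieldType) (T : finGroupType).
Lemma triv1 (c : T -> T -> k) : c 1%g 1%g != 0 -> trivializes 1%G c (fun=> c 1%g 1%g).
Proof. by move=> c0; split=> // x y /set1P-> /set1P->. Qed.

Lemma twist_1 (G N : {group T}) c (g : T -> k) y : cocycle2 G c -> N \subset G ->
  trivializes N c g -> y \in G -> twist c g y 1%g = 1.
Proof.
move=> cocG sNG gN Gy; apply: (twist_sym cocG sNG gN) => //; first exact: commute1.
by rewrite (cocycle1r cocG) ?(cocycle1l cocG).
Qed.

Lemma triv_cyclic (G : {group T}) (c : T -> T -> k) : cocycle2 G c -> cyclic G -> triv G c.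
Proof.
move=> cocG /cyclicP[x defG]; have Gx : x \in G by rewrite defG cycle_id.
have c0 := cocycle_neq0 cocG (group1 _) (group1 _).
apply: (triv_cyclic_ext (y := x) cocG (sub1G _) Gx _ _ (triv1 c0)).
- by rewrite norm1 inE.
- by rewrite mul1g.
by move=> n /set1P->; apply: (twist_1 cocG (sub1G _) (triv1 c0)).
Qed.
End TrivCyclic.

(* The group is kept abstract so that group-theoretic steps never unfold matrices. *)
Record rep2 (p : nat) := Rep2 {
  rep2_group : finGroupType;
  mx2 : rep2_group -> 'M['F_p]_2;
  mx2M : forall g h, mx2 (g * h)%g = mx2 g *m mx2 h;
  mx21 : mx2 1%g = 1%:M;
  mx2_inj : injective mx2
}.

(** * Elements and subgroups of SL_2(p) of order prime to p *)

Section SL2.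
Variables (p : nat) (p_pr : prime p) (R : rep2 p).
Local Notation F := 'F_p.
Local Notation GL := (rep2_group R).
Implicit Types (g h : GL) (w : 'rV[F]_2).

Lemma mx2MV g : mx2 g *m mx2 g^-1%g = 1%:M. Proof. by rewrite -mx2M mulgV mx21. Qed.
Lemma mx2_unit g : mx2 g \in unitmx.
Proof. by case/mulmx1_unit: (mx2MV g). Qed.
Lemma mx2V g : mx2 g^-1%g = invmx (mx2 g).
Proof. by rewrite -[LHS](mulKmx (mx2_unit g)) mx2MV mulmx1. Qed.
Lemma mx2_det0 g : \det (mx2 g) != 0.
Proof. by have := mx2_unit g; rewrite unitmxE unitfE. Qed.
Lemma mx2J g h : mx2 (g ^ h)%g = invmx (mx2 h) *m mx2 g *m mx2 h.
Proof. by rewrite conjgE !mx2M mx2V mulmxA. Qed.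
Lemma mx2J_tr g h : \tr (mx2 (g ^ h)%g) = \tr (mx2 g).
Proof. by rewrite mx2J mxtrace_mulC mulmxA mulmxV ?mx2_unit // mul1mx. Qed.
Lemma mx2M_det g h : \det (mx2 (g * h)%g) = \det (mx2 g) * \det (mx2 h).
Proof. by rewrite mx2M det_mulmx. Qed.
Lemma mx2V_det g : \det (mx2 g^-1%g) = (\det (mx2 g))^-1.
Proof. by rewrite mx2V det_inv. Qed.
Lemma mx2J_det g h : \det (mx2 (g ^ h)%g) = \det (mx2 g).
Proof. by rewrite conjgE !mx2M_det mx2V_det mulrCA mulVf ?mx2_det0 // mulr1. Qed.
Lemma mx2X_det g n : \det (mx2 (g ^+ n)%g) = \det (mx2 g) ^+ n.
Proof.
elim: n => [|n IH]; first by rewrite expg0 mx21 det1.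
by rewrite expgS mx2M_det IH exprS.
Qed.
Lemma mx2X_eigen g w a n : w *m mx2 g = a *: w -> w *m mx2 (g ^+ n)%g = a ^+ n *: w.
Proof.
move=> wg; elim: n => [|n IH]; first by rewrite expg0 mx21 mulmx1 scale1r.
by rewrite expgSr mx2M mulmxA IH -scalemxAl wg scalerA exprSr.
Qed.
Lemma mx2_comm g h : commute g h <-> mx2 g *m mx2 h = mx2 h *m mx2 g.
Proof.
split=> [cgh|cgh]; first by rewrite -!mx2M cgh.
by apply: mx2_inj; rewrite !mx2M.
Qed.

Lemma pcharF : p \in [pchar F]%R. Proof. exact: pchar_Fp. Qed.

Lemma unipotent_expp g : (mx2 g - 1%:M) *m (mx2 g - 1%:M) = 0 -> (g ^+ p)%g = 1%g.
Proof.
have : mx2 g = 1%:M + (mx2 g - 1%:M) by rewrite addrC subrK.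
move: (_ - _) => N DA NN.
have gX n : mx2 (g ^+ n)%g = 1%:M + n%:R *: N.
  elim: n => [|n IH]; first by rewrite expg0 mx21 scale0r addr0.
  rewrite expgS mx2M IH DA mulmxDl !mulmxDr !mul1mx mulmx1 -scalemxAr NN scaler0 addr0.
  by rewrite -natr1 scalerDl scale1r addrA.
by apply: mx2_inj; rewrite gX (pcharf0 pcharF) scale0r addr0 mx21.
Qed.

(** Determinant 1 and eigenvalue 1 force trace 2, so Cayley-Hamilton makes the matrix unipotent. *)
Lemma sl2_fix_expp g w : \det (mx2 g) = 1 -> w != 0 -> w *m mx2 g = w -> (g ^+ p)%g = 1%g.
Proof.
move=> dg w0 wg; apply: unipotent_expp.
have := eigen_root w0 (a := 1) (A := mx2 g); rewrite scale1r => /(_ wg).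
rewrite dg mul1r expr1n => /eqP; rewrite addrAC subr_eq0 => /eqP trE.
rewrite mulmxBl !mulmxBr !mul1mx mulmx1 cayley2 dg -trE scalerDl !scale1r.
by rewrite opprB addrA [_ - 1%:M - _]addrAC subrK addrK subrr.
Qed.

Lemma sl2_free g w : p^'.-elt g -> \det (mx2 g) = 1 -> w != 0 -> w *m mx2 g = w -> g = 1%g.
Proof.
move=> p'g dg w0 /(sl2_fix_expp dg w0) gp; apply/eqP; rewrite -order_eq1.
apply/eqP/(pnat_1 (pi := p)) => //.
by apply: pnat_dvd (pnat_id p_pr); rewrite order_dvdn gp.
Qed.

Lemma sl2_unit g : p^'.-elt g -> \det (mx2 g) = 1 -> g != 1%g -> mx2 g - 1%:M \in unitmx.
Proof.
move=> p'g dg; apply: contraR; rewrite unitmxE unitfE negbK => /det0P[w w0].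
rewrite mulmxBr mulmx1 => /eqP; rewrite subr_eq0 => /eqP wg.
exact/eqP/(sl2_free p'g dg w0).
Qed.

Definition in_SL2 (H : {set GL}) := {in H, forall g, \det (mx2 g) = 1}.

Lemma sl2_abelian_cyclic (H : {group GL}) :
  p^'.-group H -> in_SL2 H -> abelian H -> cyclic H.
Proof.
move=> p'H dH; apply: (@div_ring_mul_group_cyclic _ H 'M[F]_2 (@mx2 p R) (mx21 R)) => [g h _ _|g].
  exact: mx2M.
by case/setD1P=> g1 Hg; apply: (sl2_unit (mem_p_elt p'H Hg)); rewrite ?dH.
Qed.

(** With a common trace, Cayley-Hamilton gives (h - g) (g h - 1) = 0, and g h - 1 is invertible
    unless g h = 1. It is applied to an element and a conjugate commuting with it: such a
    conjugation fixes or inverts the element. *)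
Lemma sl2_trace (H : {group GL}) g h : p^'.-group H -> in_SL2 H -> g \in H -> h \in H ->
  commute g h -> \tr (mx2 g) = \tr (mx2 h) -> h = g \/ h = g^-1%g.
Proof.
move=> p'H dH Hg Hh /mx2_comm cgh trgh; have Hgh := groupM Hg Hh.
have [gh1|gh1] := eqVneq (g * h)%g 1%g.
  by right; apply/eqP; rewrite eq_sym eq_invg_mul gh1.
left; apply: mx2_inj; apply/eqP; rewrite -subr_eq0.
have uAB := sl2_unit (mem_p_elt p'H Hgh) (dH _ Hgh) gh1.
suffices AB0 : (mx2 h - mx2 g) *m (mx2 (g * h)%g - 1%:M) = 0.
  by rewrite -[_ - _](mulmxK uAB) AB0 mul0mx.
have cg := cayley2 (mx2 g); have ch := cayley2 (mx2 h).
rewrite dH // in cg; rewrite dH // -trgh in ch; set t := \tr _ in cg ch.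
rewrite mx2M mulmxBr mulmx1 mulmxBl mulmxA -cgh -!mulmxA ch [mx2 g *m (_ *m _)]mulmxA cg.
rewrite mulmxBl mulmxBr mulmx1 mul1mx -scalemxAl -scalemxAr.
by apply/eqP; rewrite subr_eq0 opprB addrCA [X in _ + X]addrAC subrr sub0r.
Qed.

Lemma sl2_invol g : p^'.-elt g -> \det (mx2 g) = 1 -> (g ^+ 2)%g = 1%g ->
  g = 1%g \/ mx2 g = - 1%:M.
Proof.
move=> p'g dg g2; have [->|g1] := eqVneq g 1%g; [by left | right].
have ug := sl2_unit p'g dg g1; apply/eqP; rewrite -subr_eq0 opprK; apply/eqP.
have : (mx2 g - 1%:M) *m (mx2 g + 1%:M) = 0.
  by rewrite mulmxBl !mulmxDr mulmx1 !mul1mx -mx2M -expg2 g2 mx21 opprD addrA addrK subrr.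
by move=> e; rewrite -[_ + _](mulKmx ug) e mulmx0.
Qed.

(** The only involution available is -1, so [L] has a single subgroup of order 2; such 2-groups are
    cyclic or generalized quaternion. *)
Lemma sl2_quaternion (L : {group GL}) : odd p -> 2.-group L -> in_SL2 L -> ~~ cyclic L ->
  exists n, (2 < n)%N /\ L \isog 'Q_(2 ^ n)%N.
Proof.
move=> odd_p L2 dL ncL.
have p'L : p^'.-group L.
  by apply: sub_pgroup L2 => q; rewrite !inE => /eqP->; apply: contraTneq odd_p => <-.
have L1 : L :!=: 1%g by apply: contraNneq ncL => ->; rewrite cyclic1.
have [_ d2 _] := pgroup_pdiv L2 L1; have [z Lz oz] := Cauchy (isT : prime 2) d2.
have z2 : (z ^+ 2)%g = 1%g by have := expg_order z; rewrite oz.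
have zP u : u \in L -> (u ^+ 2)%g = 1%g -> u \in <[z]>.
  move=> Lu u2; case: (sl2_invol (mem_p_elt p'L Lu) (dL _ Lu) u2) => [->|mu]; first exact: group1.
  case: (sl2_invol (mem_p_elt p'L Lz) (dL _ Lz)) => [|z1|mz].
  - exact: z2.
  - by rewrite z1 order1 in oz.
  by rewrite (mx2_inj (etrans mu (esym mz))) cycle_id.
have O1 : #|'Ohm_1(L)| = 2.
  suffices -> : 'Ohm_1(L) = <[z]> by rewrite -orderE.
  apply/eqP; rewrite eqEsubset (OhmE _ L2) gen_subG cycle_subG; apply/andP; split.
    by apply/subsetP=> u; rewrite !inE => /andP[Lu /eqP u2]; apply: zP.
  by rewrite mem_gen // !inE Lz expn1 z2 eqxx.
have := introT (prime_Ohm1P L2 L1) O1; rewrite (negPf ncL) /=.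
by case/eqP/quaternion_classP=> n n2 iso; exists n.
Qed.

Lemma sl2_odd_cyclic l (L : {group GL}) :
  l != p -> odd l -> l.-group L -> in_SL2 L -> cyclic L.
Proof.
move=> nlp odd_l lL dL.
have p'L : p^'.-group L by apply: sub_pgroup lL => q; rewrite !inE => /eqP->.
rewrite (odd_pgroup_rank1_cyclic lL); last first.
  by have [e ->] := p_natP lL; rewrite oddX odd_l orbT.
have [E] := p_rank_witness l L; case/pnElemP=> sEL abelE <-.
rewrite -abelem_cyclic //; apply: sl2_abelian_cyclic (abelem_abelian abelE).
  exact: pgroupS p'L.
by move=> g Eg; apply/dL/(subsetP sEL).
Qed.

Section Schur.
Variable k : closedFieldType.
Hypothesis charp : p \in [pchar k]%R.

(** In the quaternion case [N = <[x]>] has index 2 and [y] inverts it, so the only elements of [N]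
    commuting with [y] are 1 and y^2, and the twist is 1 on both. *)
Lemma triv_sl2_lgroup l (L : {group GL}) (c : GL -> GL -> k) :
  odd p -> prime l -> l != p -> l.-group L -> in_SL2 L -> cocycle2 L c -> triv L c.
Proof.
move=> odd_p l_pr nlp lL dL cocL.
have [cycL|ncL] := boolP (cyclic L); first exact: triv_cyclic.
have [odd_l|] := boolP (odd l).
  by rewrite (sl2_odd_cyclic nlp odd_l lL dL) in ncL.
move=> l2; have {l2 l_pr} l2 : l = 2 by case: (even_prime l_pr) => // l_odd; rewrite l_odd in l2.
rewrite {}l2 in nlp lL.
have [n [n2 iso]] := sl2_quaternion odd_p lL dL ncL.
have [[x y] genL _] := generators_quaternion n2 iso.
have [[_ o4 inv] _ [_ _ uinv _ _] _ _] := quaternion_structure n2 genL iso.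
have [oL Lx ox L'y] := genL.
have [_ _ nsX defL _] := extremal_generators_facts (isT : prime 2) genL.
have /setDP[Ly nXy] := L'y.
have sXL : <[x]>%G \subset L by rewrite cycle_subG.
have [|g gX] := @triv_cyclic _ _ <[x]>%G c _ (cycle_cyclic x); first exact: cocycle2S cocL.
have nXy' : y \in 'N(<[x]>)%g by apply: (subsetP (normal_norm nsX)).
apply: (triv_cyclic_ext_der cocL sXL Ly nXy' _ gX) => [//|m Xm].
have -> : <[x]>^`(1)%g = 1%g by apply/derG1P/cycle_abelian.
move/set1gP/eqP; rewrite -eq_mulgV1 => /eqP mE.
have my : (m ^ y = m)%g by rewrite -[in LHS]mE conjgKV.
have m2 : (m ^+ 2 = 1)%g by rewrite expg2 -{1}my inv ?mulVg.
have [->|m1] := eqVneq m 1%g; first exact: twist_1 gX Ly.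
have Lm : m \in L by apply: (subsetP sXL).
have Dm : m = (y ^+ 2)%g.
  have om : #[m] = 2 by apply: nt_prime_order.
  have oy : #[y ^+ 2]%g = 2 by rewrite orderXdiv o4.
  by rewrite (uinv _ Lm om) (uinv _ _ oy) // groupX.
apply: (twist_sym cocL sXL gX) => //; first by rewrite Dm; apply: commuteX.
(* The cocycle identity at (y, y, y) makes [c] symmetric on [y] and y^2. *)
rewrite Dm; have := cocycleE cocL Ly Ly Ly; rewrite -expg2.
by move/(mulfI (cocycle_neq0 cocL Ly Ly)).
Qed.

Lemma triv_sl2 (G : {group GL}) (c : GL -> GL -> k) :
  odd p -> in_SL2 G -> cocycle2 G c -> triv G c.
Proof.
move=> odd_p dG cocG; apply: (triv_Sylow charp cocG) => l l_pr nlp.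
have [L sylL] := Sylow_exists l G; have [sLG lL l'] := and3P sylL.
exists L; last by rewrite -p'natE.
split=> //; apply: triv_sl2_lgroup lL _ _ => //; last exact: cocycle2S cocG.
by move=> g Lg; apply/dG/(subsetP sLG).
Qed.
End Schur.
End SL2.

(** * Groups containing SL_2(p) *)

Section AboveSL2.
Variables (p : nat) (p_pr : prime p) (R : rep2 p).
Local Notation F := 'F_p.
Local Notation GL := (rep2_group R).
Implicit Types (g h : GL) (G : {group GL}).

Definition upper2 (x : F) : 'M[F]_2 := \matrix_(i, j) (if (i, j) == (0, 1) then x else (i == j)%:R).
Definition lower2 (x : F) : 'M[F]_2 := \matrix_(i, j) (if (i, j) == (1, 0) then x else (i == j)%:R).

Lemma upper2_det x : \det (upper2 x) = 1.
Proof. by rewrite det2 !mxE /= mulr0 subr0 mulr1. Qed.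
Lemma lower2_det x : \det (lower2 x) = 1.
Proof. by rewrite det2 !mxE /= mul0r subr0 mulr1. Qed.

(** Elementary matrices generate SL_2: with U and L standing for [upper2] and [lower2], a matrix
    with rows (a, b), (c, d) and c nonzero is U((a-1)/c) L(c) U((d-1)/c). *)
Lemma sl2_ind (P : GL -> Prop) :
  (forall A : 'M[F]_2, \det A = 1 -> exists g, mx2 g = A) ->
  (forall g h, P g -> P h -> P (g * h)%g) ->
  (forall g x, mx2 g = upper2 x -> P g) -> (forall g x, mx2 g = lower2 x -> P g) ->
  forall g, \det (mx2 g) = 1 -> P g.
Proof.
move=> ex PM PU PL.
have main g : \det (mx2 g) = 1 -> mx2 g 1 0 != 0 -> P g.
  set A := mx2 g => dA c0.
  have [u Du] := ex _ (upper2_det ((A 0 0 - 1) / A 1 0)).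
  have [l Dl] := ex _ (lower2_det (A 1 0)).
  have [v Dv] := ex _ (upper2_det ((A 1 1 - 1) / A 1 0)).
  have -> : g = (u * l * v)%g.
    apply: mx2_inj; rewrite !mx2M Du Dl Dv -/A; rewrite det2 in dA.
    apply: mx2P; rewrite !mulmx2 !mxE /=; try by field.
    apply: (mulfI c0).
    have -> : A 1 0 * A 0 1 = A 0 0 * A 1 1 - 1 by rewrite -dA; ring.
    by field.
  exact: PM (PM _ _ (PU _ _ Du) (PL _ _ Dl)) (PU _ _ Dv).
move=> g dg; have [c0|] := eqVneq (mx2 g 1 0) 0; last exact: main.
(* If c = 0 then d is nonzero, and multiplying by [lower2 1] on the right moves d into the
   lower-left corner. *)
have [l Dl] := ex _ (lower2_det 1); have [l' Dl'] := ex _ (lower2_det (-1)).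
have ll' : (l * l')%g = 1%g.
  apply: mx2_inj; rewrite mx2M Dl Dl' mx21.
  by apply: mx2P; rewrite mulmx2 !mxE /=; ring.
rewrite -[g]mulg1 -ll' mulgA; apply: PM; last exact: PL Dl'.
apply: main; first by rewrite mx2M_det dg Dl lower2_det mulr1.
rewrite mx2M Dl mulmx2 !mxE /= c0 mul0r add0r mulr1.
by apply: contra_eqN dg => /eqP d0; rewrite det2 c0 d0 !mulr0 subr0 eq_sym oner_eq0.
Qed.

Definition SLin (G : {group GL}) : {set GL} := [set g in G | \det (mx2 g) == 1].
Lemma SLin_group_set G : group_set (SLin G).
Proof.
apply/group_setP; split=> [|g h]; first by rewrite inE group1 mx21 det1 eqxx.
rewrite !inE => /andP[Gg /eqP dg] /andP[Gh /eqP dh].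
by rewrite groupM // mx2M_det dg dh mulr1 eqxx.
Qed.
Canonical SLin_group G := Group (SLin_group_set G).

Lemma SLin_sub G : SLin G \subset G.
Proof. by apply/subsetP=> g; rewrite inE => /andP[]. Qed.
Lemma SLin_det1 G : in_SL2 (SLin G).
Proof. by move=> g; rewrite inE => /andP[_ /eqP]. Qed.
Lemma SLin_norm G g : g \in 'N(G)%g -> g \in 'N(SLin G)%g.
Proof.
move=> nGg; rewrite inE; apply/subsetP=> _ /imsetP[h + ->]; rewrite !inE => /andP[Gh dh].
by rewrite memJ_norm // Gh mx2J_det.
Qed.

Lemma det_unit g : \det (mx2 g) \is a GRing.unit.
Proof. by rewrite unitfE mx2_det0. Qed.
Definition detu g : {unit F} := FinRing.Unit (det_unit g).
Lemma detuM : {in [set: GL] &, {morph detu : g h / (g * h)%g}}.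
Proof. by move=> g h _ _; apply: val_inj; rewrite /= mx2M_det. Qed.
Canonical detu_morphism := Morphism detuM.

Lemma detu_eq1 g : (detu g == 1%g) = (\det (mx2 g) == 1).
Proof. by rewrite -val_eqE. Qed.

Lemma SLin_cyclic_ext G y : y \in G -> detu @* G \subset <[detu y]> ->
  G :=: (SLin G * <[y]>)%g.
Proof.
move=> Gy sdG; apply/eqP; rewrite eqEsubset mul_subG ?SLin_sub ?cycle_subG // andbT.
apply/subsetP=> g Gg.
have /cycleP[i Di] : detu g \in <[detu y]> by apply: (subsetP sdG); rewrite mem_morphim ?inE.
apply/mulsgP; exists (g * y ^- i)%g (y ^+ i)%g; rewrite ?mem_cycle ?mulgKV //.
rewrite inE groupM ?groupV ?groupX // -detu_eq1 morphM ?inE // morphV ?inE // morphX ?inE //.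
by rewrite /= -Di mulgV.
Qed.

Lemma SLin_cyclic_ext_exists G : exists2 y, y \in G & G :=: (SLin G * <[y]>)%g.
Proof.
have /cyclicP[d Dd] := field_unit_group_cyclic (detu @* G)%G.
have : d \in detu @* G by rewrite [detu @* G]Dd cycle_id.
case/morphimP=> y _ Gy Ey; exists y => //.
by apply: SLin_cyclic_ext; rewrite // [detu @* G]Dd Ey.
Qed.

(** The twist is a character of SL_2(p), and its generators, the elementary matrices, have order
    dividing [p], hence value 1 in characteristic [p]. The argument covers SL_2(3), which is not
    perfect. *)
Lemma triv_above_sl2 (k : closedFieldType) (G : {group GL}) (c : GL -> GL -> k) :
  p \in [pchar k]%R -> odd p -> (forall A : 'M[F]_2, \det A = 1 -> exists2 g, g \in G & mx2 g = A) ->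
  cocycle2 G c -> triv G c.
Proof.
move=> charp odd_p fullG cocG.
have sSLG g : \det (mx2 g) = 1 -> g \in G.
  by case/fullG=> h Gh /mx2_inj <-.
have [y Gy defG] := SLin_cyclic_ext_exists G.
have sNG := SLin_sub G; have coc0 := cocycle2S sNG cocG.
have [g gN] := triv_sl2 p_pr charp odd_p (@SLin_det1 G) coc0.
have nNy : y \in 'N(SLin G)%g by apply: SLin_norm; apply: (subsetP (normG G)).
apply: (triv_cyclic_ext cocG sNG Gy nNy defG gN) => n.
rewrite inE => /andP[_ /eqP]; move: n.
have twM := twistM cocG sNG gN Gy nNy.
have main n : \det (mx2 n) = 1 -> (mx2 n - 1%:M) *m (mx2 n - 1%:M) = 0 ->
    n \in SLin G /\ twist c g y n = 1.
  move=> dn un; have Nn : n \in SLin G by rewrite inE sSLG ?dn ?eqxx.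
  split=> //; apply: (pgroup_char_triv charp (N := [group of SLin G])) => //.
    by move=> m Nm; apply: (twist_neq0 cocG sNG gN).
  rewrite /p_elt; apply: pnat_dvd (pnat_id p_pr).
  by rewrite order_dvdn (unipotent_expp p_pr un).
suffices all n : \det (mx2 n) = 1 -> n \in SLin G /\ twist c g y n = 1.
  by move=> n /all[].
apply: (sl2_ind (P := fun n => n \in SLin G /\ twist c g y n = 1)) n.
- by move=> A /fullG[h _ <-]; exists h.
- move=> n m [Nn tn] [Nm tm]; by rewrite groupM // twM // tn tm mulr1.
- move=> n x Dn; apply: main; rewrite Dn ?upper2_det //.
  by apply: mx2P; rewrite mulmx2 !mxE /=; ring.
move=> n x Dn; apply: main; rewrite Dn ?lower2_det //.
by apply: mx2P; rewrite mulmx2 !mxE /=; ring.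
Qed.
End AboveSL2.

(** * The stabilizer of a line in a group of order prime to p *)

Section Stabilizer.
Variables (p : nat) (p_pr : prime p) (R : rep2 p).
Local Notation F := 'F_p.
Local Notation GL := (rep2_group R).
Implicit Types (g h : GL) (G : {group GL}).

Lemma mx2_conj_comm g h : (h ^ g^-1 = h)%g <-> commute g h.
Proof.
split=> [|cgh]; first by rewrite conjVE => /(canRL (mulgKV _)).
by rewrite conjVE cgh mulgK.
Qed.

Definition scalar_el g := exists a : F, mx2 g = a%:M.

Lemma not_scalar_el g : ~ scalar_el g -> forall a, mx2 g != a%:M.
Proof. by move=> ns a; apply/eqP=> e; apply: ns; exists a. Qed.

Lemma scalar_el_dec g : decidable (scalar_el g).
Proof.
have [e|ne] := eqVneq (mx2 g) ((mx2 g 0 0)%:M); first by left; exists (mx2 g 0 0).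
by right=> [[a e]]; case/eqP: ne; rewrite e mxE eqxx.
Qed.

Lemma scalar_el_comm g h : scalar_el g -> commute g h.
Proof. by case=> a e; apply/mx2_comm; rewrite e scalar_mxC. Qed.

Lemma scalar_el_det g a : mx2 g = a%:M -> \det (mx2 g) = a ^+ 2.
Proof. by move->; rewrite det_scalar. Qed.

Lemma cent_nonscalar g h1 h2 : ~ scalar_el g -> commute h1 g -> commute h2 g -> commute h1 h2.
Proof.
move=> /not_scalar_el ns /mx2_comm c1 /mx2_comm c2; apply/mx2_comm.
exact: cent2_comm ns c1 c2.
Qed.

Variables (w : 'rV[F]_2) (w0 : w != 0).

(** In the application [w] spans Q/Z(S) inside S/Z(S), so this is the image of the stabilizer of Q
    in Aut_F(S). *)
Definition line_stab G : {set GL} := [set g in G | (w *m mx2 g <= w)%MS].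

Lemma line_stabP G g :
  reflect (g \in G /\ exists a, w *m mx2 g = a *: w) (g \in line_stab G).
Proof.
rewrite inE; apply: (iffP andP) => [] [Gg].
  by case/sub_rVP=> a e; split=> //; exists a.
by case=> a e; split=> //; apply/sub_rVP; exists a.
Qed.

Lemma line_stab_group_set G : group_set (line_stab G).
Proof.
apply/group_setP; split=> [|g h].
  by rewrite inE group1 mx21 mulmx1 submx_refl.
case/line_stabP=> Gg [a ea] /line_stabP[Gh [b eb]]; apply/line_stabP.
split; first exact: groupM.
by exists (a * b); rewrite mx2M mulmxA ea -scalemxAl eb scalerA.
Qed.
Canonical line_stab_group G := Group (line_stab_group_set G).

Lemma eigen_neq0 g a : w *m mx2 g = a *: w -> a != 0.
Proof.
move=> e; apply: contraNneq w0 => a0; rewrite a0 scale0r in e.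
by rewrite -[w](mulmxK (mx2_unit g)) e mul0mx.
Qed.

Lemma eigen_inv g a : w *m mx2 g = a *: w -> w *m mx2 g^-1%g = a^-1 *: w.
Proof.
move=> e; have a0 := eigen_neq0 e.
have e' : w = a^-1 *: (w *m mx2 g) by rewrite e scalerA mulVf // scale1r.
by rewrite {1}e' -scalemxAl mx2V mulmxK ?mx2_unit.
Qed.

Section PrimeGroup.
Variable G : {group GL}.
Hypothesis p'G : p^'.-group G.

(** The quotient of the two elements fixes [w] and has determinant 1, so it is trivial in a
    p'-group. This makes the stabilizer of the line abelian. *)
Lemma eigen_det_inj g h a : g \in G -> h \in G -> w *m mx2 g = a *: w ->
  w *m mx2 h = a *: w -> \det (mx2 g) = \det (mx2 h) -> g = h.
Proof.
move=> Gg Gh eg eh dgh; apply/eqP; rewrite eq_mulgV1; apply/eqP.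
have Ggh : (g * h^-1)%g \in G by rewrite groupM ?groupV.
apply: (sl2_free p_pr (mem_p_elt p'G Ggh) _ w0).
  by rewrite mx2M_det mx2V_det dgh divff ?mx2_det0.
rewrite mx2M mulmxA eg -scalemxAl (eigen_inv eh) scalerA divff ?scale1r //.
exact: eigen_neq0 eg.
Qed.

Lemma line_stab_comm g h : g \in line_stab G -> h \in line_stab G -> commute g h.
Proof.
case/line_stabP=> Gg [a ea] /line_stabP[Gh [b eb]].
apply: (eigen_det_inj (a := a * b)); rewrite ?groupM ?mx2M_det 1?[_ * \det _]mulrC //.
  by rewrite mx2M mulmxA ea -scalemxAl eb scalerA.
by rewrite mx2M mulmxA eb -scalemxAl ea scalerA mulrC.
Qed.

Lemma cent_line_stab g h : h \in line_stab G -> ~ scalar_el h -> g \in G -> commute g h ->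
  g \in line_stab G.
Proof.
case/line_stabP=> Gh [a ea] /not_scalar_el ns Gg /mx2_comm cgh; apply/line_stabP; split=> //.
exact: eigen_cent2 w0 ea ns (esym cgh).
Qed.

Variables (k : closedFieldType) (charp : p \in [pchar k]%R) (odd_p : odd p).
Variable c : GL -> GL -> k.
Hypothesis cocG : cocycle2 G c.
Hypothesis trivw : triv (line_stab G) c.

(** Elements of the line stabilizer commute, and [c], being trivial there, is symmetric on them. *)
Lemma twist_stab (N : {group GL}) (g : GL -> k) y n : N \subset G -> trivializes N c g ->
  y \in line_stab G -> n \in N -> n \in line_stab G -> twist c g y n = 1.
Proof.
move=> sNG gN Sy Nn Sn; have cyn := line_stab_comm Sy Sn.
have Gy : y \in G by case/line_stabP: Sy.
exact: (twist_sym cocG sNG gN) (triv_comm trivw Sy Sn cyn).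
Qed.

(** As [SLin H] is abelian, only its elements commuting with [y] have to be tested, and commuting
    with the nonscalar [y] puts them in the line stabilizer. *)
Lemma triv_nonscalar_abelian (H : {group GL}) y : H \subset G -> y \in H -> y \in line_stab G ->
  ~ scalar_el y -> H :=: (SLin H * <[y]>)%g -> abelian (SLin H) -> triv H c.
Proof.
move=> sHG Hy Sy nsy defH abH; have cocH := cocycle2S sHG cocG.
have sNH := SLin_sub H; have sNG := subset_trans sNH sHG.
have [g gN] := triv_sl2 p_pr charp odd_p (@SLin_det1 _ _ H) (cocycle2S sNH cocH).
have nNy : y \in 'N(SLin H)%g by apply: SLin_norm; apply: (subsetP (normG H)).
apply: (triv_cyclic_ext_der cocH sNH Hy nNy defH gN) => n Nn.
have -> : (SLin H)^`(1)%g = 1%g by apply/derG1P.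
move/set1gP/eqP; rewrite -eq_mulgV1 => /eqP/mx2_conj_comm cyn.
apply: (twist_stab sNG gN Sy) => //.
exact: cent_line_stab Sy nsy (subsetP sNG _ Nn) (commute_sym cyn).
Qed.
End PrimeGroup.
End Stabilizer.

(** * Nonabelian 2-subgroups of SL_2(p) with a cyclic subgroup of index 2 *)

Section Index2.
Variables (p : nat) (p_pr : prime p) (R : rep2 p).
Local Notation GL := (rep2_group R).
Implicit Types (g h n m : GL).

Lemma two_elt_odd_cycle (T : finGroupType) (x : T) i : 2.-elt x -> odd i -> x \in <[x ^+ i]>.
Proof.
move=> x2 odd_i; have co : coprime #|<[x]>| i.
  by rewrite -orderE; have [e ->] := p_natP x2; rewrite coprimeXl ?coprime2n.
by rewrite -{1}(expgK co (cycle_id x)) mem_cycle.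
Qed.

Variables (P : {group GL}) (x : GL).
Hypotheses (p'P : p^'.-group P) (slP : in_SL2 P) (P2 : 2.-group P).
Hypotheses (sXP : <[x]> \subset P) (iX : #|P : <[x]>| = 2%N) (nabP : ~~ abelian P).
Local Notation X := <[x]>.

Lemma index2_x : x \in P. Proof. by rewrite -cycle_subG. Qed.
Lemma index2_xelt : 2.-elt x. Proof. exact: mem_p_elt P2 index2_x. Qed.
Lemma index2_nX : X <| P. Proof. exact: index2_normal. Qed.

Lemma index2_ncomm n : n \in P :\: X -> ~ commute x n.
Proof.
move=> P'n cxn; case/negP: nabP; have /setDP[Pn nXn] := P'n.
have dP : P :=: X <*> <[n]>.
  apply/eqP; rewrite eqEsubset andbC join_subG sXP cycle_subG Pn /=.
  apply/subsetP=> m Pm; have [Xm|nXm] := boolP (m \in X); first by rewrite mem_gen // inE Xm.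
  have : m \in X :* n by rewrite (rcoset_index2 sXP iX P'n) inE nXm.
  case/rcosetP=> y Xy ->; rewrite groupM // mem_gen // inE ?Xy // cycle_id orbT //.
rewrite dP abelianY !cycle_abelian cycle_subG /=.
by apply/centP=> _ /cycleP[i ->]; apply/commuteX/commute_sym.
Qed.

Lemma index2_inv n : n \in P :\: X -> (x ^ n)%g = x^-1%g.
Proof.
move=> P'n; have /setDP[Pn nXn] := P'n.
have Xxn : (x ^ n)%g \in X by rewrite memJ_norm ?cycle_id // (subsetP (normal_norm index2_nX)).
have cx : commute x (x ^ n)%g by apply: (centsP (cycle_abelian x)); rewrite ?cycle_id.
have [e|//] := sl2_trace p_pr p'P slP index2_x (subsetP sXP _ Xxn) cx (esym (mx2J_tr _ _)).
by case: (index2_ncomm P'n); apply/commgP/conjg_fixP.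
Qed.

Lemma index2_outside : exists n, n \in P :\: X.
Proof.
apply/set0Pn; rewrite setD_eq0; apply: contraL nabP => sPX; rewrite negbK.
exact: abelianS sPX (cycle_abelian x).
Qed.

Lemma index2_xV : x^-1%g != x.
Proof.
have [n P'n] := index2_outside; apply/negP=> /eqP e.
by case: (index2_ncomm P'n); apply/commgP/conjg_fixP; rewrite index2_inv.
Qed.

Lemma index2_nscalar : ~ scalar_el x.
Proof.
have [n P'n] := index2_outside => sx.
by apply: (index2_ncomm P'n); apply: scalar_el_comm.
Qed.

Lemma index2_inX m n : m \in P :\: X -> n \in P :\: X -> (m * n^-1)%g \in X.
Proof. by move=> P'm P'n; rewrite -mem_rcoset (rcoset_index2 sXP iX P'n). Qed.

Lemma index2_mulX m n : m \in X -> n \in P :\: X -> (m * n)%g \in P :\: X.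
Proof. by move=> Xm P'n; rewrite -(rcoset_index2 sXP iX P'n) mem_rcoset mulgK. Qed.

Lemma index2_invn n : n \in P :\: X -> n^-1%g \in P :\: X.
Proof. by rewrite !inE !groupV. Qed.

(** An odd power of [x] generates [X]; if n^2 were one, [n] would commute with [x]. *)
Lemma index2_sqr n : n \in P :\: X -> (n ^+ 2)%g \in <[(x ^+ 2)%g]>.
Proof.
move=> P'n; have := index2_inX P'n (index2_invn P'n); rewrite invgK -expg2.
case/cycleP=> i e; rewrite e; have [odd_i|ev_i] := boolP (odd i).
  case: (index2_ncomm P'n); have := two_elt_odd_cycle index2_xelt odd_i.
  by rewrite -e => /cycleP[j ->]; apply/commute_sym/commuteX/commuteX.
by rewrite -(odd_double_half i) (negPf ev_i) add0n -mul2n expgM mem_cycle.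
Qed.

Lemma index2_der : P^`(1)%g \subset <[(x ^+ 2)%g]>.
Proof.
have nD : <[(x ^+ 2)%g]> <| P.
  by apply: char_normal_trans index2_nX; apply: cycle_subgroup_char; rewrite cycle_subG mem_cycle.
apply: der1_min; first exact: normal_norm.
have oD : #|X : <[(x ^+ 2)%g]>|%g = 2%N.
  rewrite -divgS ?cycle_subG ?mem_cycle // -!orderE orderXgcd.
  have d2 : (2 %| #[x])%N.
    have [e oe] := p_natP index2_xelt; rewrite oe dvdn_exp // lt0n.
    apply: contraNneq index2_xV => e0; rewrite e0 in oe.
    by move/eqP: oe; rewrite order_eq1 => /eqP->; rewrite invg1.
  by rewrite (gcdn_idPr d2) -{1}(divnK d2) mulKn // divn_gt0 // dvdn_leq ?order_gt0.
have oPD : #|P / <[(x ^+ 2)%g]>|%g = 4%N.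
  rewrite card_quotient ?normal_norm //.
  by rewrite -(Lagrange_index sXP) ?iX ?oD // cycle_subG mem_cycle.
by apply: (@p2group_abelian _ 2); rewrite ?/pgroup oPD.
Qed.

(** n^2 is a power of [x], which [n] both inverts and centralizes, so n^4 = 1. If n^2 were 1, [n]
    would be scalar and commute with [x]. *)
Lemma index2_sqr_N1 n : n \in P :\: X -> mx2 (n ^+ 2)%g = - 1%:M.
Proof.
move=> P'n; have /setDP[Pn nXn] := P'n.
have /cycleP[i e] := index2_sqr P'n.
have n4 : ((n ^+ 2) ^+ 2)%g = 1%g.
  rewrite expg2; apply/eqP; rewrite -eq_invg_mul e -expgVn -expgVn.
  rewrite -(index2_inv P'n) -!conjXg -e; apply/eqP/conjg_fixP/commgP/commute_sym.
  exact: commuteX.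
have Pn2 : (n ^+ 2)%g \in P by rewrite groupX.
have [n2|//] := sl2_invol p_pr (mem_p_elt p'P Pn2) (slP Pn2) n4.
case: (index2_ncomm P'n); apply: commute_sym; apply: scalar_el_comm.
have [->|e'] := sl2_invol p_pr (mem_p_elt p'P Pn) (slP Pn) n2; first by exists 1; rewrite mx21.
by exists (-1); rewrite e' raddfN.
Qed.
End Index2.

(** * The prime 2 with a quaternion Sylow subgroup *)

Section QuaternionSylow.
Variables (p : nat) (p_pr : prime p) (R : rep2 p).
Local Notation F := 'F_p.
Local Notation GL := (rep2_group R).
Variables (w : 'rV[F]_2) (w0 : w != 0) (G : {group GL}) (p'G : p^'.-group G).
Variables (k : closedFieldType) (charp : p \in [pchar k]%R) (odd_p : odd p).
Variable c : GL -> GL -> k.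
Hypotheses (cocG : cocycle2 G c) (trivw : triv (line_stab w G) c).
Variables (P : {group GL}) (y : GL).
Hypotheses (sPG : P \subset G) (P2 : 2.-group P) (Py : y \in P) (nsy : ~ scalar_el y).
Hypothesis defP : P :=: (SLin P * <[y]>)%g.
Hypothesis ncP : ~~ cyclic (SLin P).
Let s : F := \det (mx2 y).
Hypothesis wy : w *m mx2 y = s^-1 *: w.
Hypothesis s_nsq : forall a : F, a ^+ 2 != s.

Let P0 := SLin P.

Let sP0P : P0 \subset P := SLin_sub P.
Let sP0G : P0 \subset G := subset_trans sP0P sPG.
Let p'P0 : p^'.-group P0 := pgroupS sP0G p'G.
Let P02 : 2.-group P0 := pgroupS sP0P P2.
Let slP0 : in_SL2 P0 := @SLin_det1 _ _ P.
Let nP0 g : g \in P -> g \in 'N(P0)%g.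
Proof. by move=> Pg; apply: SLin_norm; apply: (subsetP (normG P)). Qed.

(** Above order 8 the cyclic subgroup of index 2 is unique, hence normalized by [P]. In order 8
    there are three, and a normal subgroup of [P] of order 4 inside [P0] selects one. *)
Lemma quaternion_normal_cycle : exists x, [/\ <[x]> \subset P0, <[x]> <| P & #|P0 : <[x]>|%g = 2%N].
Proof.
have [n [n2 iso]] := sl2_quaternion p_pr odd_p P02 slP0 ncP.
have [[x z] gen _] := generators_quaternion n2 iso.
have [_ _ _ _ uniqX] := quaternion_structure n2 gen iso.
have [oP Px ox P'z] := gen; have sXP : <[x]> \subset P0 by rewrite cycle_subG.
have iX : #|P0 : <[x]>|%g = 2%N.
  rewrite -divgS // oP -orderE ox -[in LHS](ltn_predK n2) expnS mulnK //.
  by rewrite expn_gt0.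
have [n3|] := ltnP 3 n.
  exists x; split=> //; apply/andP; split; first exact: subset_trans sXP sP0P.
  apply/subsetP=> g Pg; rewrite inE; have [_ _ uX] := uniqX n3.
  have nPg := nP0 Pg; have sXg : <[x]> :^ g \subset P0 by rewrite -(normP nPg) conjSg.
  rewrite [<[x]> :^ g](uX (<[x]> :^ g)%G) ?cyclicJ ?cycle_cyclic //.
  by rewrite -divgS // cardJg divgS.
move=> n3; have {n2 n3} n3 : n = 3%N by apply/eqP; rewrite eqn_leq n3 n2.
rewrite n3 in oP.
have nsP0P : P0 <| P by apply/andP; split=> //; apply/subsetP=> g; apply: nP0.
have [|X [sXP0 nXP oX]] := @normal_pgroup 2 _ 2 P [group of P0] P2 nsP0P.
  by rewrite /= oP pfactorK.
have cX : cyclic X.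
  apply: (sl2_abelian_cyclic p_pr); first exact: pgroupS p'P0.
    by move=> g Xg; apply/slP0/(subsetP sXP0).
  by apply: (@p2group_abelian _ 2); rewrite ?/pgroup oX.
have [x' defX] := cyclicP cX; exists x'; rewrite -defX; split=> //.
by rewrite -divgS // oP oX.
Qed.

Lemma triv_quaternion_Sylow : triv P c.
Proof.
have [x [sXP nXP iX]] := quaternion_normal_cycle.
have nabP : ~~ abelian P0 by apply: contra ncP; apply: sl2_abelian_cyclic.
have cocP := cocycle2S sPG cocG.
have [g gN] := triv_sl2 p_pr charp odd_p slP0 (cocycle2S sP0P cocP).
have Gy : y \in G by apply: (subsetP sPG).
have Sy : y \in line_stab w G by apply/line_stabP; split=> //; exists s^-1.
have nNy := nP0 Py.
have twM := twistM cocP sP0P gN Py nNy.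
have s0 : s != 0 by apply: mx2_det0.
have P0G m : m \in P0 -> m \in G by apply: (subsetP sP0G).
have XP0 m : m \in <[x]> -> m \in P0 by apply: (subsetP sXP).
pose XX := index2_inv p_pr p'P0 slP0 sXP iX nabP.
have xV := index2_xV p_pr p'P0 slP0 sXP iX nabP.
have nsx := index2_nscalar sXP iX nabP.
have ncm := index2_ncomm sXP iX nabP.
have der := index2_der p_pr p'P0 slP0 P02 sXP iX nabP.
have [n0 P'n0] := index2_outside x nabP.
have x0 : x \in P0 by rewrite -cycle_subG.
have stab_tw m : m \in P0 -> commute y m -> twist c g y m = 1.
  move=> Pm cym; apply: (twist_stab p_pr w0 p'G cocG trivw sP0G gN Sy) => //.
  exact: (cent_line_stab w0 Sy nsy (P0G _ Pm) (commute_sym cym)).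
have Xy : (x ^ y^-1)%g \in <[x]>.
  by rewrite memJ_norm ?cycle_id // groupV (subsetP (normal_norm nXP)).
have cxy : commute x (x ^ y^-1)%g by apply: (centsP (cycle_abelian x)); rewrite ?cycle_id.
have dlt m : m \in P0 -> (m ^ y^-1 * m^-1)%g \in P0^`(1)%g -> (m ^ y^-1 * m^-1)%g \in <[(x ^+ 2)%g]>.
  by move=> _; apply: (subsetP der).
have [/mx2_conj_comm cyx|yx] := sl2_trace p_pr p'P0 slP0 x0 (XP0 _ Xy) cxy (esym (mx2J_tr _ _)).
  (* For m outside <x>, conjugation by m swaps the eigenvalues s^-1 and s^2 of y, so
     y * (y ^ m^-1)^-1 acts on w by s^-3, which is not a square. *)
  have Sx : x \in line_stab w G by exact: (cent_line_stab w0 Sy nsy (P0G _ x0) (commute_sym cyx)).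
  apply: (triv_cyclic_ext_der cocP sP0P Py nNy defP gN) => m Pm /dlt -/(_ Pm) dm.
  have [Xm|nXm] := boolP (m \in <[x]>).
    by apply: stab_tw => //; case/cycleP: Xm => i ->; apply: commuteX.
  have P'm : m \in P0 :\: <[x]> by rewrite inE nXm.
  have P'mV := index2_invn P'm.
  pose y' := (y ^ m^-1)%g.
  have Gm := P0G _ Pm; have Gy' : y' \in G by rewrite groupJ ?groupV.
  have cy'x : commute y' x.
    have : commute y' (x ^ m^-1)%g by rewrite /commute -!conjMg cyx.
    by rewrite XX // => /commuteV; rewrite invgK.
  have cyy' : commute y' y by exact: (cent_nonscalar nsx cy'x cyx).
  have /line_stabP[_ [mu wy']] : y' \in line_stab w G by exact: (cent_line_stab w0 Sy nsy Gy' cyy').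
  have e1 := eigen_root w0 wy; have e2 := eigen_root w0 wy'.
  rewrite mx2J_tr mx2J_det -/s in e2; rewrite -/s in e1.
  (* Determinant s and eigenvalue s^-1 make s^2 the other eigenvalue. *)
  have trE : \tr (mx2 y) = s ^+ 2 + s^-1.
    apply: (mulfI s0); apply: (mulfI s0); apply/eqP; rewrite -subr_eq0.
    apply/eqP; rewrite -[RHS](mulr0 (- s ^+ 3)) -[in RHS]e1; field; exact: s0.
  have : (mu - s^-1) * (mu - s ^+ 2) == 0.
    by apply/eqP; rewrite -[RHS]e2 trE; field.
  rewrite mulf_eq0 !subr_eq0 => /orP[] /eqP emu.
    rewrite emu in wy'.
    have yy' : y = y' by apply: (eigen_det_inj p_pr w0 p'G Gy Gy' wy wy'); rewrite mx2J_det.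
    have cym : commute m y by apply/mx2_conj_comm; rewrite -/y' -yy'.
    by case: (ncm _ P'm); exact: (cent_nonscalar nsy (commute_sym cyx) cym).
  have dE : (m ^ y^-1 * m^-1 = y * y'^-1)%g.
    by rewrite /y' !conjgE !invMg !invgK !mulgA.
  rewrite dE in dm; case/cycleP: dm => i; rewrite -expgM => dm.
  have /line_stabP[_ [la wx]] := Sx.
  have := mx2X_eigen (2 * i) wx; rewrite -dm mx2M mulmxA wy -scalemxAl (eigen_inv w0 wy') scalerA emu.
  move/eqP; rewrite -subr_eq0 -scalerBl scaler_eq0 (negPf w0) orbF subr_eq0 => /eqP e3.
  (* From s^-3 = la^(2 i) follows s = s^4 s^-3 = (s^2 la^i)^2. *)
  case/eqP: (s_nsq (s ^+ 2 * la ^+ i)); rewrite exprMn -!exprM [(i * 2)%N]mulnC -e3.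
  by field.
(* Now y inverts x, so y^2 is scalar, which forces s = -1 and y^2 = 1. *)
have yxV : commute (y ^+ 2)%g x.
  apply/mx2_conj_comm; rewrite expg2 invMg conjgM yx conjVg yx invgK //.
have [a Da] : scalar_el (y ^+ 2)%g.
  case: (scalar_el_dec (y ^+ 2)%g) => // ns2.
  have /mx2_conj_comm : commute y x.
    by apply: cent_nonscalar ns2 _ (commute_sym yxV); apply: commuteX.
  by rewrite yx => e; rewrite e eqxx in xV.
have wy2 := mx2X_eigen 2 wy; rewrite Da mul_mx_scalar in wy2.
have {wy2} ea : a = s^-1 ^+ 2.
  by move/eqP: wy2; rewrite -subr_eq0 -scalerBl scaler_eq0 (negPf w0) orbF subr_eq0 => /eqP.
(* det (y^2) is both s^2 and a^2 = s^-4. Since s has 2-power order, s^6 = 1 then improves to s^2 =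
   1. *)
have s6 : s ^+ 6 = 1.
  have := mx2X_det y 2; rewrite Da det_scalar ea -/s => e.
  by rewrite (_ : 6 = 2 + 4)%N // exprD -e; field.
have s2 : s ^+ 2 = 1.
  have [e oy] := p_natP (mem_p_elt P2 Py).
  have sy : s ^+ (2 ^ e) = 1 by rewrite -mx2X_det -oy expg_order mx21 det1.
  have co : coprime 3 (2 ^ e) by rewrite coprimeXr.
  have [u v Euv _] := egcdnP (2 ^ e) (isT : 0 < 3)%N; rewrite (eqP co) in Euv.
  have s23 : (s ^+ 2) ^+ 3 = 1 by rewrite -exprM.
  have : (s ^+ 2) ^+ (u * 3) = 1 by rewrite mulnC exprM s23 expr1n.
  have e1 : (s ^+ 2) ^+ (v * 2 ^ e) = 1 by rewrite -exprM mulnA mulnC exprM sy expr1n.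
  by rewrite Euv exprD e1 mul1r expr1.
have y2 : (y ^+ 2)%g = 1%g.
  by apply: mx2_inj; rewrite Da ea exprVn s2 invr1 mx21.
have sN1 : s = -1.
  have : (s - 1) * (s + 1) == 0 by rewrite -subr_sqr s2 expr1n subrr.
  rewrite mulf_eq0 subr_eq0 addr_eq0 => /orP[/eqP s1|/eqP //].
  by case/eqP: (s_nsq 1); rewrite expr1n s1.
have yxi i : ((x ^+ i) ^ y^-1)%g = (x ^- i)%g by rewrite conjXg yx expgVn.
(* Otherwise this commutator is x^(2 i), and x^i m commutes with [y], so it has an eigenvalue mu on
   [w]. Its square is the scalar -1, whence mu^2 = -1 = s. *)
have noP' m : m \in P0 :\: <[x]> -> (m ^ y^-1 * m^-1)%g \notin <[(x ^+ 2)%g]>.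
  move=> P'm; apply/negP=> /cycleP[i]; rewrite -expgM => em.
  have em' : (m ^ y^-1 = x ^+ (2 * i) * m)%g by rewrite -em mulgKV.
  have P'm' := index2_mulX sXP iX (mem_cycle x i) P'm.
  have /setDP[Pm' _] := P'm'.
  have cm' : commute y (x ^+ i * m)%g.
    apply/mx2_conj_comm; rewrite conjMg yxi em' mul2n -addnn expgD !mulgA mulVg mul1g.
    by [].
  have /line_stabP[_ [mu wm]] : (x ^+ i * m)%g \in line_stab w G.
    exact: (cent_line_stab w0 Sy nsy (P0G _ Pm') (commute_sym cm')).
  have := mx2X_eigen 2 wm.
  rewrite (index2_sqr_N1 p_pr p'P0 slP0 P02 sXP iX nabP P'm') mulmxN mulmx1 -scaleN1r.
  move/eqP; rewrite -subr_eq0 -scalerBl scaler_eq0 (negPf w0) orbF subr_eq0 => /eqP e3.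
  by case/eqP: (s_nsq mu); rewrite -e3 sN1.
have twX m i : m \in P0 -> twist c g y (m ^+ i)%g = twist c g y m ^+ i.
  move=> Pm; elim: i => [|i IH]; first by rewrite expg0 (twist_1 cocP sP0P gN Py).
  by rewrite expgS twM ?groupX // IH exprS.
have tw0 m : m \in P0 -> twist c g y m != 0 by apply: (twist_neq0 cocP sP0P gN Py nNy).
have /setDP[Pn0 nXn0] := P'n0.
have tx2 : twist c g y x ^+ 2 = 1.
  have e : twist c g y (x ^ n0)%g = twist c g y x.
    have := twM n0 (x ^ n0)%g Pn0; rewrite -conjgC twM // mulrC => /(_ (groupJ x0 Pn0)).
    by move/(mulfI (tw0 _ Pn0)).
  rewrite XX // in e; have := twM x x^-1%g x0; rewrite mulgV e groupV expr2 => /(_ x0) <-.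
  by rewrite (twist_1 cocP sP0P gN Py).
have P'ny : (n0 ^ y^-1)%g \in P0 :\: <[x]>.
  rewrite inE memJ_norm ?nXn0 ?memJ_norm ?groupV // (subsetP (normal_norm nXP)) //.
have /cycleP[i ei] := index2_inX sXP iX P'ny P'n0.
have odd_i : odd i.
  apply: contraR (noP' _ P'n0) => /negPf ev_i; rewrite ei -(odd_double_half i) ev_i add0n.
  by rewrite -mul2n expgM mem_cycle.
have tn2 : twist c g y n0 ^+ 2 = 1.
  rewrite -twX //; have /cycleP[j ->] := index2_sqr P02 sXP iX nabP P'n0.
  by rewrite twX ?groupX // twX // tx2 expr1n.
(* Expanding the twist of y^2 = 1 at [n0] gives 1 = (twist x)^i (twist n0)^2, with i odd and both
   twists of square 1. *)
have tx : twist c g y x = 1.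
  have := twist_comp cocP sP0P gN Py Py nNy nNy Pn0.
  rewrite -expg2 y2 (twist1 cocP sP0P gN) // -[(n0 ^ y^-1)%g](mulgKV n0) ei.
  rewrite twM ?groupX // twX // -mulrA -expr2 tn2 mulr1.
  rewrite -(odd_double_half i) odd_i exprD.
  by rewrite expr1 -mul2n exprM tx2 expr1n mulr1 => <-.
apply: (triv_cyclic_ext_der cocP sP0P Py nNy defP gN) => m Pm /dlt -/(_ Pm) dm.
have [Xm|nXm] := boolP (m \in <[x]>).
  by case/cycleP: Xm => j ->; rewrite twX // tx expr1n.
by have := noP' m; rewrite inE nXm Pm dm => /(_ isT).
Qed.
End QuaternionSylow.

(** * Elements of order 3 acting on quaternion groups *)

Section OrderThree.
Variables (p : nat) (p_pr : prime p) (R : rep2 p).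
Local Notation F := 'F_p.
Local Notation GL := (rep2_group R).

(** Equality up to sign, as for the elements of order 4 in a quaternion group. *)
Definition sim (T : finGroupType) (a b : T) := a = b \/ a = b^-1%g.

Lemma simJ (T : finGroupType) (a b h : T) : sim a b -> sim (a ^ h)%g (b ^ h)%g.
Proof. by case=> ->; [left | right; rewrite conjVg]. Qed.

Lemma sim_trans (T : finGroupType) (a b c : T) : sim a b -> sim b c -> sim a c.
Proof. by case=> -> [] ->; rewrite ?invgK; [left|right|right|left]. Qed.

Lemma sim_sym (T : finGroupType) (a b : T) : sim a b -> sim b a.
Proof. by case=> ->; rewrite /sim ?invgK; [left|right]. Qed.

Lemma sim_commute (T : finGroupType) (a b c d : T) : sim a c -> sim b d -> commute c d -> commute a b.
Proof.
move=> ac bd ccd; have cad : commute a d.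
  by case: ac => ->; [| apply/commute_sym/commuteV/commute_sym].
by case: bd => ->; [| apply/commuteV].
Qed.

Lemma commuteJ (T : finGroupType) (a b h : T) : commute (a ^ h)%g (b ^ h)%g -> commute a b.
Proof. by rewrite /commute -!conjMg => /conjg_inj. Qed.

(** Inner automorphisms of the group generated by [i] and [j] realize all sign changes, so some [q]
    undoes those of [h]. Then [h * q] centralizes two noncommuting elements and must be scalar. *)
Lemma quat_scalar (i j h : GL) : (i ^ j)%g = i^-1%g -> (j ^ i)%g = j^-1%g -> ~ commute i j ->
  sim (i ^ h)%g i -> sim (j ^ h)%g j ->
  exists2 q, q \in <<[set i; j]>> & scalar_el (h * q)%g.
Proof.
move=> ij ji ncij ih jh.
have Qi : i \in <<[set i; j]>> by rewrite mem_gen // !inE eqxx.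
have Qj : j \in <<[set i; j]>> by rewrite mem_gen // !inE eqxx orbT.
have main q : q \in <<[set i; j]>> -> (i ^ (h * q) = i)%g -> (j ^ (h * q) = j)%g ->
    exists2 q, q \in <<[set i; j]>> & scalar_el (h * q)%g.
  move=> Qq /conjg_fixP/commgP ci /conjg_fixP/commgP cj; exists q => //.
  case: (scalar_el_dec (h * q)%g) => // ns; case: ncij.
  exact: (cent_nonscalar ns ci cj).
have ii : (i ^ i = i)%g by apply/conjg_fixP/commgP.
have jj : (j ^ j = j)%g by apply/conjg_fixP/commgP.
case: ih => ih; case: jh => jh.
- by apply: (main 1%g); rewrite ?group1 // mulg1.
- by apply: (main i) => //; rewrite conjgM ?ih ?jh ?conjVg ?ii ?ji ?invgK.
- by apply: (main j) => //; rewrite conjgM ?ih ?jh ?conjVg ?jj ?ij ?invgK.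
apply: (main (i * j)%g); rewrite ?groupM //.
  by rewrite conjgM ih conjgM conjVg ii conjVg ij invgK.
by rewrite conjgM jh conjgM conjVg ji invgK jj.
Qed.

Section QuaternionAction.
Variables (P : {group GL}) (u : GL).
Hypotheses (p'P : p^'.-group P) (slP : in_SL2 P) (P2 : 2.-group P) (odd_p : odd p).
Hypotheses (ncP : ~~ cyclic P) (nPu : u \in 'N(P)%g) (u3 : (u ^+ 3)%g = 1%g).
Hypothesis (ncu : u \notin 'C(P)%g).

Let nabP : ~~ abelian P.
Proof. by apply: contra ncP; apply: (sl2_abelian_cyclic p_pr). Qed.

Lemma conj_u3 (a : GL) : (((a ^ u) ^ u) ^ u = a)%g.
Proof. by rewrite -!conjgM -[RHS]conjg1 -u3 !expgS expg0 mulg1 ?mulgA. Qed.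

(** If [u] normalized [<[x]>], it would fix [x], as u^3 = 1 excludes inversion. For [n] outside,
    [n ^ u] is x^i n, and u^3 = 1 gives x^(3 i) = 1, so x^i = 1 and [u] would centralize [P]. *)
Lemma cent_cycle_u x : <[x]> \subset P -> #|P : <[x]>|%g = 2%N -> (x ^ u)%g \notin <[x]>.
Proof.
move=> sXP iX; apply: contra ncu => Xxu.
have Px : x \in P by rewrite -cycle_subG.
have Pxu : (x ^ u)%g \in P by apply: (subsetP sXP).
have cx : commute x (x ^ u)%g by apply: (centsP (cycle_abelian x)); rewrite ?cycle_id.
have xu : (x ^ u)%g = x.
  have [//|e] := sl2_trace p_pr p'P slP Px Pxu cx (esym (mx2J_tr _ _)).
  have := conj_u3 x; rewrite e conjVg e invgK e => xV.
  by have := index2_xV p_pr p'P slP sXP iX nabP; rewrite xV eqxx.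
have xui i : ((x ^+ i) ^ u = x ^+ i)%g by rewrite conjXg xu.
have nXu : u \in 'N(<[x]>)%g by apply/normP; rewrite -cycleJ xu.
apply/centP=> n Pn; apply/commute_sym/commgP/conjg_fixP.
have [/cycleP[i ->] //|nXn] := boolP (n \in <[x]>).
have P'n : n \in P :\: <[x]> by rewrite inE nXn.
have P'nu : (n ^ u)%g \in P :\: <[x]> by rewrite inE !memJ_norm ?nXn.
have /cycleP[i ei] := index2_inX sXP iX P'nu P'n.
have en : (n ^ u = x ^+ i * n)%g by rewrite -ei mulgKV.
have x3 : ((x ^+ i) ^+ 3 = 1)%g.
  have en2 : ((x ^+ i * n) ^ u = x ^+ i * (x ^+ i * n))%g by rewrite (conjMg (x ^+ i)) xui en.
  have := conj_u3 n; rewrite en en2 (conjMg (x ^+ i)) xui en2 => e.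
  by apply: (mulIg n); rewrite mul1g -[RHS]e !expgS expg0 mulg1 ?mulgA.
suffices xi1 : (x ^+ i)%g = 1%g by rewrite en xi1 mul1g.
have x2 : 2.-elt (x ^+ i)%g by apply: mem_p_elt P2 _; rewrite groupX.
apply/eqP; rewrite -order_eq1; apply/eqP; apply: (pnat_1 x2).
by apply: (@pnat_dvd _ 3); rewrite // order_dvdn x3.
Qed.

(** In a larger quaternion group [u] would normalize the unique cyclic subgroup of index 2. So [P]
    has order 8 and [u] permutes its three subgroups of order 4 cyclically. *)
Lemma quaternion_action : exists i, let j := (i ^ u)%g in let k := (j ^ u)%g in
  [/\ i \in P, (i ^ j)%g = i^-1%g, (j ^ i)%g = j^-1%g, (i ^+ 2)%g != 1%g &
      forall a, a \in P -> (a ^+ 2)%g != 1%g -> [\/ sim a i, sim a j | sim a k]].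
Proof.
have [n [n2 iso]] := sl2_quaternion p_pr odd_p P2 slP ncP.
have [[x z] gen _] := generators_quaternion n2 iso.
have [_ _ _ _ uniqX] := quaternion_structure n2 gen iso.
have [oP Px ox P'z] := gen; have sXP : <[x]> \subset P by rewrite cycle_subG.
have iX : #|P : <[x]>|%g = 2%N.
  rewrite -divgS // oP -orderE ox -[in LHS](ltn_predK n2) expnS mulnK //.
  by rewrite expn_gt0.
have nXu := cent_cycle_u sXP iX.
have Pu a : a \in P -> (a ^ u)%g \in P by move=> Pa; rewrite memJ_norm.
have sJP : <[(x ^ u)%g]> \subset P by rewrite cycle_subG Pu.
have iJ : #|P : <[(x ^ u)%g]>|%g = 2%N by rewrite -divgS // -orderE orderJ orderE divgS.
have n3 : (n <= 3)%N.
  rewrite leqNgt; apply/negP=> /uniqX[_ _ uX].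
  by case/negP: nXu; rewrite -(uX <[(x ^ u)%g]>%G (cycle_cyclic _) sJP iJ) cycle_id.
have {n2 n3} n3 : n = 3%N by apply/eqP; rewrite eqn_leq n3 n2.
rewrite {}n3 /= in ox.
have x4 : (x ^+ 4)%g = 1%g by have := expg_order x; rewrite ox.
have P'j : (x ^ u)%g \in P :\: <[x]> by rewrite inE nXu Pu.
have P'i : x \in P :\: <[(x ^ u)%g]>.
  rewrite inE Px andbT; apply: contra nXu => Jx.
  have sXJ : <[x]> \subset <[(x ^ u)%g]> by rewrite cycle_subG.
  have /eqP -> : <[x]> == <[(x ^ u)%g]> by rewrite eqEcard sXJ -!orderE orderJ leqnn.
  exact: cycle_id.
have inv2 := index2_inv p_pr p'P slP.
have ij := inv2 _ sXP iX nabP _ P'j; have ji := inv2 _ sJP iJ nabP _ P'i.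
exists x; split=> //.
  by apply/eqP => x2; have := index2_xV p_pr p'P slP sXP iX nabP; rewrite eq_invg_mul -expg2 x2 eqxx.
move=> a Pa a2.
have in4 (b : GL) : (b ^+ 4)%g = 1%g -> a \in <[b]> -> sim a b.
  move=> b4 /cycleP[e Da]; move: a2; rewrite Da (divn_eq e 4) expgD mulnC expgM b4 expg1n mul1g.
  have : (e %% 4 < 4)%N by rewrite ltn_mod.
  case: (e %% 4)%N => [|[|[|[|//]]]] _.
  - by rewrite expg0 expg1n eqxx.
  - by left.
  - by rewrite -expgM b4 eqxx.
  by right; apply/eqP; rewrite eq_sym eq_invg_mul -expgS b4.
have [Xa|nXa] := boolP (a \in <[x]>); first by apply: Or31; apply: in4.
have [Ja|nJa] := boolP (a \in <[(x ^ u)%g]>).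
  by apply: Or32; apply: in4 => //; rewrite -conjXg x4 conj1g.
apply: Or33; set k := ((x ^ u) ^ u)%g.
have Pk : k \in P by rewrite !Pu.
have nJk : k \notin <[(x ^ u)%g]> by apply: cent_cycle_u.
have nXk : k \notin <[x]>.
  have [_] := setDP P'i; apply: contra => Xk.
  have : (k ^ u)%g \in <[x]> :^ u by rewrite memJ_conjg.
  by rewrite conj_u3 -cycleJ.
have P'a : a \in P :\: <[x]> by rewrite inE nXa.
have P'a' : a \in P :\: <[(x ^ u)%g]> by rewrite inE nJa.
have P'k : k \in P :\: <[x]> by rewrite inE nXk.
have P'k' : k \in P :\: <[(x ^ u)%g]> by rewrite inE nJk.
(* [a] and [k] lie outside both cyclic subgroups, so [a * k^-1] lies in both. There [x ^ u]
   centralizes it and also inverts it, so its square is 1. *)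
have Xe := index2_inX sXP iX P'a P'k; have Je := index2_inX sJP iJ P'a' P'k'.
set e := (a * k^-1)%g in Xe Je; have Da : (a = e * k)%g by rewrite mulgKV.
have e2 : (e ^+ 2)%g = 1%g.
  have : (e ^ (x ^ u) = e)%g.
    by case/cycleP: Je => d ->; apply/conjg_fixP/commgP/commute_sym/commuteX.
  case/cycleP: Xe => d ->; rewrite conjXg ij expgVn => /eqP.
  by rewrite eq_invg_mul -expg2 => /eqP.
have Pe : e \in P by rewrite groupM ?groupV.
have k2 := index2_sqr_N1 p_pr p'P slP P2 sXP iX nabP P'k.
have [e1|e1] := sl2_invol p_pr (mem_p_elt p'P Pe) (slP Pe) e2.
  by left; rewrite Da e1 mul1g.
right; have ek : e = (k ^+ 2)%g by apply: mx2_inj; rewrite e1 k2.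
rewrite Da ek; apply/eqP; rewrite eq_sym eq_invg_mul -ek.
have -> : (k * (e * k) = e * e)%g by rewrite ek; rewrite expg2 !mulgA.
by rewrite -expg2 e2.
Qed.
End QuaternionAction.
End OrderThree.

(** * The prime 3 when the 3-part of tau is scalar *)

Section CubicTwist.
Variables (p : nat) (p_pr : prime p) (R : rep2 p).
Local Notation F := 'F_p.
Local Notation GL := (rep2_group R).
Variables (w : 'rV[F]_2) (w0 : w != 0) (G : {group GL}) (p'G : p^'.-group G).
Variables (k : closedFieldType) (charp : p \in [pchar k]%R) (odd_p : odd p).
Variable c : GL -> GL -> k.
Hypotheses (cocG : cocycle2 G c) (trivw : triv (line_stab w G) c).
Variables (tau z : GL).
Hypotheses (Stau : tau \in line_stab w G) (defG : G :=: (SLin G * <[tau]>)%g).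
Hypothesis nsq : forall a : F, a ^+ 2 != \det (mx2 tau).
Hypotheses (Gz : z \in G) (scz : scalar_el z) (z3 : (z ^+ 3)%g = 1%g).
Hypothesis G0_3 : ~~ (9 %| #|SLin G|)%N.
Variable g : GL -> k.
Hypothesis gN : trivializes (SLin G) c g.

Let G0 := SLin_group G.
Let sG0 : G0 \subset G := SLin_sub G.
(** As [z] is scalar with cube 1, this is a [G]-invariant character of [G0] whose values are cube
    roots of unity. *)
Let phi n := twist c g z n.
Let Gtau : tau \in G. Proof. by case/line_stabP: Stau. Qed.
Let nsc_tau : ~ scalar_el tau.
Proof. by case=> a /scalar_el_det e; case/eqP: (nsq a). Qed.
Let nG0 h : h \in G -> h \in 'N(G0)%g.
Proof. by move=> Gh; apply: SLin_norm; apply: (subsetP (normG G)). Qed.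

Let conjz (n : GL) : (n ^ z^-1)%g = n.
Proof. by apply/mx2_conj_comm/scalar_el_comm. Qed.

Let phiM n m : n \in G0 -> m \in G0 -> phi (n * m)%g = phi n * phi m.
Proof. exact: (twistM cocG sG0 gN Gz (nG0 Gz)). Qed.
Let phi0 n : n \in G0 -> phi n != 0.
Proof. exact: (twist_neq0 cocG sG0 gN Gz (nG0 Gz)). Qed.
Let phi1 : phi 1%g = 1. Proof. exact: (twist_1 cocG sG0 gN Gz). Qed.
Let phiX n i : n \in G0 -> phi (n ^+ i)%g = phi n ^+ i.
Proof.
move=> Gn; elim: i => [|i IH]; first by rewrite expg0 phi1.
by rewrite expgS phiM ?groupX // IH exprS.
Qed.

Let phi3 n : n \in G0 -> phi n ^+ 3 = 1.
Proof.
move=> Gn; have tw i : twist c g (z ^+ i)%g n = phi n ^+ i.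
  elim: i => [|i IH]; first by rewrite expg0 (twist1 cocG sG0 gN).
  rewrite expgS (twist_comp cocG sG0 gN) ?nG0 ?groupX // IH exprS; congr (twist _ _ _ _ * _).
  by apply/mx2_conj_comm/commute_sym/commuteX/commute_sym/scalar_el_comm.
by rewrite -tw z3 (twist1 cocG sG0 gN).
Qed.

Let phi_stab n : n \in G0 -> n \in line_stab w G -> phi n = 1.
Proof.
move=> Gn Sn; apply: (twist_stab p_pr w0 p'G cocG trivw sG0 gN) => //.
apply: (cent_line_stab w0 Stau nsc_tau Gz); exact: scalar_el_comm.
Qed.

(** [z] and [tau] commute, so the twist of their product can be expanded in both orders. *)
Let phi_tau n : n \in G0 -> phi (n ^ tau^-1)%g = phi n.
Proof.
move=> Gn; have := twist_comp cocG sG0 gN Gz Gtau (nG0 Gz) (nG0 Gtau) Gn.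
rewrite (scalar_el_comm tau scz) (twist_comp cocG sG0 gN Gtau Gz (nG0 Gtau) (nG0 Gz) Gn).
rewrite conjz mulrC => /mulIf e; apply/esym/e.
exact: (twist_neq0 cocG sG0 gN Gtau (nG0 Gtau)).
Qed.

Let phiJ h n : h \in G -> n \in G0 -> phi (n ^ h)%g = phi n.
Proof.
rewrite {1}defG => /mulsgP[m _ Gm /cycleP[i ->] ->] Gn.
have phit j m' : m' \in G0 -> phi (m' ^ (tau ^+ j))%g = phi m'.
  elim: j m' => [|j IH] m' Gm'; first by rewrite expg0 conjg1.
  have Gm'' : (m' ^ tau)%g \in G0 by rewrite memJ_norm ?nG0.
  by rewrite expgS conjgM IH // -[in RHS](conjgK tau m') phi_tau.
rewrite conjgM phit ?groupJ //.
apply: (mulfI (phi0 Gm)); rewrite -phiM ?groupJ // -conjgC phiM // mulrC.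
by [].
Qed.

Definition phi_ker : {set GL} := [set n in G0 | phi n == 1].
Lemma phi_kerE n : (n \in phi_ker) = (n \in G0) && (phi n == 1).
Proof. exact: in_set. Qed.
Lemma phi_ker_group_set : group_set phi_ker.
Proof.
apply/group_setP; split=> [|n m]; first by rewrite phi_kerE group1 phi1 eqxx.
rewrite !phi_kerE => /andP[Gn /eqP en] /andP[Gm /eqP em].
by rewrite groupM // phiM // en em mulr1 eqxx.
Qed.
Let M := Group phi_ker_group_set.

Let sMG0 : M \subset G0. Proof. by apply/subsetP=> n; rewrite phi_kerE => /andP[]. Qed.
Let nMG : M <| G.
Proof.
apply/andP; split; first exact: subset_trans sMG0 sG0.
apply/subsetP=> h Gh; rewrite inE; apply/subsetP=> _ /imsetP[n + ->].
by rewrite !phi_kerE => /andP[Gn en]; rewrite phiJ // en andbT memJ_norm ?nG0.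
Qed.
Let Mphi n : n \in M -> phi n = 1.
Proof. by rewrite phi_kerE => /andP[_ /eqP]. Qed.

Section NonTrivial.
Variable u : GL.
Hypotheses (Gu : u \in G0) (u_3 : 3%N.-elt u) (phiu : phi u != 1).

Let ou : #[u] = 3%N.
Proof.
have [e oe] := p_natP u_3; have du : (#[u] %| #|G0|)%N by apply: order_dvdG.
case: e oe => [|[|e]] oe //.
  by move/eqP: oe; rewrite order_eq1 => /eqP u1; case/eqP: (phiu); rewrite u1 phi1.
by case/negP: G0_3; apply: dvdn_trans du; rewrite oe !expnS mulnA dvdn_mulr.
Qed.
Let u3 : (u ^+ 3)%g = 1%g. Proof. by have := expg_order u; rewrite ou. Qed.

Let M3' : 3%N^'.-group M.
Proof.
rewrite /pgroup p'natE //; apply/negP=> d3; have [v Mv ov] := Cauchy (isT : prime 3) d3.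
have G0v : v \in G0 by apply: (subsetP sMG0).
have logG : logn 3 #|G0| = 1%N.
  apply/eqP; rewrite eqn_leq -pfactor_dvdn ?cardG_gt0 // expn1 -{2}ou order_dvdG // andbT.
  by rewrite leqNgt -pfactor_dvdn ?cardG_gt0.
have sylv : 3.-Sylow(G0) <[v]> by rewrite pHallE cycle_subG G0v p_part logG -orderE ov.
have [||h Gh sub] := Sylow_Jsub sylv (Q := <[u]>%G).
- by rewrite cycle_subG.
- exact: u_3.
have : (u ^ h)%g \in M.
  have sVM : <[v]> \subset M by rewrite cycle_subG.
  by apply/(subsetP sVM)/(subsetP sub); rewrite memJ_conjg cycle_id.
by move/Mphi; rewrite phiJ // ?(subsetP sG0) // => e; case/eqP: (phiu).
Qed.

Let slG0 : in_SL2 G0 := @SLin_det1 _ _ G.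

(** Invariance of [phi] puts the commutator of [u] and [tau] in [M]. If [u] centralized [M], its
    cube would be 1, so it would be trivial; [u] would commute with the nonscalar [tau], hence
    stabilize the line, where [phi] is 1. *)
Lemma cubic_noncentral : u \notin 'C(M)%g.
Proof.
apply/negP=> /centP cuM; case/eqP: (phiu); apply: phi_stab => //.
have Gut : (u ^ tau^-1)%g \in G0 by rewrite memJ_norm ?groupV ?nG0.
set m := (u ^ tau^-1 * u^-1)%g.
have Mm : m \in M.
  rewrite phi_kerE groupM ?groupV //= phiM ?groupV // phi_tau //.
  by rewrite -phiM ?groupV // mulgV phi1.
have em : (u ^ tau^-1 = m * u)%g by rewrite mulgKV.
have m3 : (m ^+ 3)%g = 1%g.
  have : ((m * u) ^+ 3 = 1)%g by rewrite -em -conjXg u3 conj1g.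
  by rewrite expgMn ?u3 ?mulg1 //; apply/commute_sym/cuM.
have m1 : m = 1%g.
  apply/eqP; rewrite -order_eq1; apply/eqP; apply: (pnat_1 (pi := 3%N : nat_pred)).
    by apply: (@pnat_dvd _ 3); rewrite // order_dvdn m3.
  exact: mem_p_elt M3' Mm.
have /mx2_conj_comm ctu : (u ^ tau^-1)%g = u by rewrite em m1 mul1g.
exact: (cent_line_stab w0 Stau nsc_tau (subsetP sG0 _ Gu) (commute_sym ctu)).
Qed.

(* u moves some Sylow subgroup of M, which can only be a quaternion group of order 8;
   an element of M tau normalizes it, hence is scalar modulo it and u, so its
   determinant would be a square. *)
Lemma cubic_absurd : False.
Proof.
have cMu : coprime #|M| #|<[u]>|.
  rewrite -orderE ou coprime_sym prime_coprime //; by rewrite -p'natE.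
have nMu : <[u]> \subset 'N(M)%g.
  rewrite cycle_subG (subsetP (normal_norm nMG)) //; exact: (subsetP sG0).
have Gu' : u \in G by apply: (subsetP sG0).
have [q q_pr dq] : exists2 q, prime q & (q %| #|M : 'C_M[u]|)%N.
  exists (pdiv #|M : 'C_M[u]|%g); last exact: pdiv_dvd.
  rewrite pdiv_prime // indexg_gt1; apply: contra cubic_noncentral.
  rewrite subsetI => /andP[_ /subsetP sMC]; apply/centP=> n /sMC /cent1P.
  exact: commute_sym.
have [P sylP nPu] := @sol_coprime_Sylow_exists _ q <[u]>%G M (abelian_sol (cycle_abelian u)) nMu cMu.
have [sPM qP _] := and3P sylP.
have ncu : u \notin 'C(P)%g.
  apply/negP=> cPu; have sPC : P \subset 'C_M[u].
    rewrite subsetI sPM; apply/subsetP=> n Pn; apply/cent1P; apply: commute_sym; exact: (centP cPu).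
  have : (#|M : 'C_M[u]| %| #|M : P|)%N.
    by rewrite -(Lagrange_index (subsetIl M _) sPC) dvdn_mulr.
  move/(dvdn_trans dq); apply/negP; rewrite -p'natE //.
  by case/and3P: sylP.
rewrite cycle_subG in nPu.
have sPG0 := subset_trans sPM sMG0; have sPG := subset_trans sPG0 sG0.
have p'P := pgroupS sPG p'G.
have slP : in_SL2 P by move=> n Pn; apply/slG0/(subsetP sPG0).
have [cycP|ncP] := boolP (cyclic P).
  have [m dP] := cyclicP cycP; case/negP: ncu.
  have Pm : m \in P by rewrite dP cycle_id.
  have Pmu : (m ^ u)%g \in P by rewrite memJ_norm.
  have cmu : commute m (m ^ u)%g.
    by apply: (centsP (cyclic_abelian cycP)).
  have mu : (m ^ u)%g = m.
    have [//|e] := sl2_trace p_pr p'P slP Pm Pmu cmu (esym (mx2J_tr _ _)).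
    by have := conj_u3 u3 m; rewrite e conjVg e invgK e.
  rewrite dP; apply/centP=> _ /cycleP[i ->]; apply: commuteX.
  by apply/commute_sym/commgP/conjg_fixP.
have q2 : q = 2%N.
  case: (even_prime q_pr) => // odd_q; case/negP: ncP.
  have [q_p|nqp] := eqVneq q p; last exact: sl2_odd_cyclic nqp odd_q qP slP.
  have : P :=: 1%g by apply/eqP; rewrite trivg_card1; apply/eqP/(pnat_1 qP); rewrite q_p.
  by move=> ->; apply: cyclic1.
rewrite q2 in qP sylP.
have [i [Pi ij ji i2 tri]] := quaternion_action p_pr p'P slP qP odd_p ncP nPu u3 ncu.
set j := (i ^ u)%g in ij ji tri; set kk := (j ^ u)%g in tri.
have ncij : ~ commute i j.
  move=> /commgP/conjg_fixP; rewrite ij => /eqP; rewrite eq_invg_mul -expg2; exact/negP.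
have ku : (kk ^ u)%g = i by apply: conj_u3.
have ncjk : ~ commute j kk by move/commuteJ.
have ncki : ~ commute kk i by rewrite -[X in commute _ X]ku => /commuteJ.
have Pj : j \in P by rewrite memJ_norm.
have Pk : kk \in P by rewrite memJ_norm.
have sQP : <<[set i; j]>> \subset P by rewrite gen_subG subUset !sub1set Pi.
have j2 : (j ^+ 2)%g != 1%g by rewrite -conjXg; apply: contra i2 => /eqP/(canRL (conjgK _)); rewrite conj1g => ->.
have k2 : (kk ^+ 2)%g != 1%g by rewrite -conjXg; apply: contra j2 => /eqP/(canRL (conjgK _)); rewrite conj1g => ->.
have /mulsgP[m tau' Mm /setIP[Gt' nPt'] et] : tau \in (M * 'N_G(P))%g by rewrite (Frattini_arg nMG sylP).
have dm : \det (mx2 m) = 1 by apply/slG0/(subsetP sMG0).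
have dt' : \det (mx2 tau') = \det (mx2 tau) by rewrite et mx2M_det dm mul1r.
have triJ h a : h \in 'N(P)%g -> a \in P -> (a ^+ 2)%g != 1%g ->
    [\/ sim (a ^ h)%g i, sim (a ^ h)%g j | sim (a ^ h)%g kk].
  move=> nPh Pa a2; apply: tri; first by rewrite memJ_norm.
  by rewrite -conjXg; apply: contra a2 => /eqP/(canRL (conjgK _)); rewrite conj1g => ->.
(* [u] permutes [i], [j], [kk] cyclically, so one of its powers brings the image of [i] back. *)
have [e e_i] : exists e, sim (i ^ (tau' * u ^+ e))%g i.
  case: (triJ tau' i nPt' Pi i2) => s.
  - by exists 0%N; rewrite expg0 mulg1.
  - by exists 2%N; rewrite conjgM expg2 conjgM -[X in sim _ X]ku; do 2!apply: simJ.
  by exists 1%N; rewrite conjgM expg1 -[X in sim _ X]ku; apply: simJ.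
set h := (tau' * u ^+ e)%g in e_i.
have Gh : h \in G by rewrite groupM ?groupX.
have nPh : h \in 'N(P)%g by rewrite groupM ?groupX.
have dh : \det (mx2 h) = \det (mx2 tau).
  by rewrite mx2M_det dt' mx2X_det (slG0 Gu) expr1n mulr1.
have nij a b c' : ~ commute a b -> sim (a ^ h)%g c' -> ~ sim (b ^ h)%g c'.
  by move=> nab sa sb; apply: nab; apply: (@commuteJ _ _ _ h); apply: sim_commute sa sb _.
have slQ q' : q' \in <<[set i; j]>> -> \det (mx2 q') = 1.
  by move=> /(subsetP sQP) Pq; apply: slP.
case: (triJ h j nPh Pj j2) => [/(nij _ _ _ ncij e_i)//|jj|jk].
  have [q' Qq' [a sa]] := quat_scalar ij ji ncij e_i jj.
  by case/eqP: (nsq a); rewrite -(scalar_el_det sa) mx2M_det dh (slQ _ Qq') mulr1.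
have kj : sim (kk ^ h)%g j.
  case: (triJ h kk nPh Pk k2) => // [ki|kk'].
    by case: (nij kk i i ncki ki).
  by case: (nij j kk kk ncjk jk).
have simV a b : sim (a ^ h)%g b -> sim (b ^ h^-1)%g a.
  by move/(simJ h^-1%g); rewrite conjgK => /sim_sym.
(* Here [h] exchanges [j] and [kk] up to sign, so it inverts [u] modulo [P] and scalars. Then [v]
   times some q' in [P] is scalar of determinant 1, hence has square 1, while invariance gives it
   the value (phi u)^2; so (phi u)^4 = phi u is 1. *)
pose v := (u ^ h * u)%g.
have vE a : (a ^ v = (((a ^ h^-1) ^ u) ^ h) ^ u)%g by rewrite /v conjgM [(u ^ h)%g]conjgE !conjgM.
have vi : sim (i ^ v)%g i.
  rewrite vE -[X in sim _ X]ku; apply: simJ.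
  apply: sim_trans (simJ h (simJ u (simV _ _ e_i))) _; exact: jk.
have vj : sim (j ^ v)%g j.
  rewrite vE; apply: (@simJ _ _ i).
  by apply: sim_trans (simJ h (simJ u (simV _ _ kj))) _; rewrite ku.
have Guh : (u ^ h)%g \in G0 by rewrite memJ_norm ?nG0.
have Gv : v \in G0 by rewrite groupM.
have [q' Qq' [a sa]] := quat_scalar ij ji ncij vi vj.
have Mq' : q' \in M by apply: (subsetP sPM); apply: (subsetP sQP).
have Gq' : q' \in G0 by apply: (subsetP sMG0).
have pv : phi (v * q')%g = phi u ^+ 2 by rewrite (phiM Gv Gq') (phiM Guh Gu) phiJ // (Mphi Mq') mulr1 expr2.
have a2 : a ^+ 2 = 1 by rewrite -(scalar_el_det sa); apply: slG0; rewrite groupM.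
have v2 : ((v * q') ^+ 2)%g = 1%g.
  by apply: mx2_inj; rewrite expg2 mx2M sa -scalar_mxM -expr2 a2 mx21.
have := phiX 2 (groupM Gv Gq'); rewrite v2 phi1 pv -exprM => e4.
by case/eqP: (phiu); rewrite [RHS]e4 exprS phi3 // mulr1.
Qed.
End NonTrivial.

Lemma cubic_twist_trivial n : n \in G0 -> phi n = 1.
Proof.
move=> Gn; apply/eqP/negP=> /negP ne.
have Gn3 : n.`_(3%N) \in G0 by rewrite groupX.
apply: (@cubic_absurd n.`_(3%N) Gn3 (p_elt_constt 3%N n)).
apply: contra ne => /eqP e; rewrite -(consttC 3%N n) phiM ?groupX // e mul1r.
apply/eqP; set m := n.`_(3%N^').
have Gm : m \in G0 by rewrite groupX.
have m3' : 3%N^'.-elt m := p_elt_constt _ _.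
have [a b Eab _] := egcdnP 3 (order_gt0 m).
have co : coprime #[m] 3 by rewrite coprime_sym prime_coprime // -p'natE.
rewrite (eqP co) in Eab.
have : phi m ^+ (a * #[m]) = 1 by rewrite mulnC exprM -phiX // expg_order phi1 expr1n.
by rewrite Eab exprD mulnC exprM phi3 // expr1n mul1r expr1.
Qed.
End CubicTwist.

(** * All primes together: triviality from the line stabilizer *)

Section LineStabilizer.
Variables (p : nat) (p_pr : prime p) (R : rep2 p).
Local Notation F := 'F_p.
Local Notation GL := (rep2_group R).

Lemma card_rep2_dvd (H : {group GL}) : (#|H| %| p * p.-1 ^ 2 * p.+1)%N.
Proof.
have uG (g : GL) : (mx2 g : 'M[F]_(2.-1.+1)) \is a GRing.unit := mx2_unit g.
pose f (g : GL) : {'GL_2(p)} := FinRing.Unit (uG g).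
have fM : {in H &, {morph f : g h / (g * h)%g}}.
  by move=> g h _ _; apply: val_inj; apply: mx2M.
have injf : 'injm (Morphism fM).
  by apply/injmP=> g h _ _ /(congr1 val) /mx2_inj.
have := card_GL_2 F; rewrite (card_Fp p_pr) => <-.
by rewrite -(card_injm injf (subxx H)) cardSg ?subsetT.
Qed.

Variables (w : 'rV[F]_2) (w0 : w != 0) (G : {group GL}) (p'G : p^'.-group G).
Variables (k : closedFieldType) (charp : p \in [pchar k]%R) (odd_p : odd p).
Variable c : GL -> GL -> k.
Hypotheses (cocG : cocycle2 G c) (trivw : triv (line_stab w G) c).
Variable tau : GL.
Hypotheses (Gtau : tau \in G) (wtau : w *m mx2 tau = (\det (mx2 tau))^-1 *: w).
Hypothesis gen_tau : forall x : {unit F}, x \in <[detu tau]>.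

Let Stau : tau \in line_stab w G.
Proof. by apply/line_stabP; split=> //; exists (\det (mx2 tau))^-1. Qed.

Let o_tau : #[detu tau] = p.-1.
Proof.
have -> : #[detu tau] = #|[set: {unit F}]|.
  rewrite orderE; congr #|pred_of_set _|; apply/eqP; rewrite eqEsubset subsetT.
  by apply/subsetP=> x _; apply: gen_tau.
by rewrite card_finField_unit card_Fp.
Qed.

Let detX n : \det (mx2 (tau ^+ n)%g) = \det (mx2 tau) ^+ n := mx2X_det tau n.

Let wtauX n : w *m mx2 (tau ^+ n)%g = (\det (mx2 (tau ^+ n)%g))^-1 *: w.
Proof. by rewrite detX -exprVn; apply: mx2X_eigen. Qed.

Let detu_constt (l : nat) : detu tau.`_l = (detu tau).`_l.
Proof. by rewrite (morph_constt [morphism of @detu p R]) ?inE. Qed.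

(** A square root would be a power of the generator; comparing 2-parts gives the right side odd
    order, so it would be 1, although p - 1 is even. *)
Lemma nonsquare_part (x : {unit F}) : (x ^+ 2)%g != (detu tau).`_2%N.
Proof.
apply/eqP=> e; have /cycleP[j Dx] := gen_tau x.
set y := (detu tau).`_2%N in e.
have y2 : (y ^+ (j * 2))%g = y.
  have : ((detu tau) ^+ (j * 2)).`_2%N = y by rewrite expgM -Dx e constt_p_elt // p_elt_constt.
  by rewrite consttX.
have y1 : y = 1%g.
  have y_2 : 2%N.-elt y := p_elt_constt _ _.
  case: j Dx y2 => [|j] Dx y2; first by rewrite -y2.
  have : (y ^+ (j.*2).+1)%g = 1%g.
    by apply: (mulIg y); rewrite mul1g -expgSr -[RHS]y2 mulSn muln2.
  move/eqP; rewrite -order_dvdn => d; apply/eqP; rewrite -order_eq1; apply/eqP.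
  apply: (pnat_1 y_2); apply: pnat_dvd d _; rewrite p'natE // dvdn2 /= odd_double //.
have := order_constt 2%N (detu tau); rewrite -/y y1 order1 o_tau => /esym/eqP.
rewrite partn_eq1 ?p'natE ?dvdn2 // -?subn1 ?subn_gt0 ?prime_gt1 //.
by rewrite oddB ?prime_gt0 // odd_p.
Qed.

Lemma nonsquare_det2 (a : F) : a ^+ 2 != \det (mx2 (tau.`_2%N)).
Proof.
apply/eqP=> e; have a0 : a \is a GRing.unit.
  by rewrite unitfE; apply: contraNneq (mx2_det0 tau.`_2%N) => a0; rewrite -e a0 expr0n.
have := nonsquare_part (FinRing.Unit a0); rewrite -detu_constt => /eqP; apply.
by apply: val_inj; rewrite /= -e.
Qed.

Lemma nonsquare_det (a : F) : a ^+ 2 != \det (mx2 tau).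
Proof.
apply/eqP=> e; have [m em] : exists m, tau.`_2%N = (tau ^+ m)%g by rewrite /constt; eexists.
by case/eqP: (nonsquare_det2 (a ^+ m)); rewrite em detX -exprM mulnC exprM e.
Qed.

Let l_part (l : nat) g : g \in G -> l.-elt g -> detu g \in <[detu tau.`_l]>.
Proof.
move=> Gg lg; have /cycleP[i Di] := gen_tau (detu g).
have lx : l.-elt (detu g) by rewrite (morph_p_elt [morphism of @detu p R]) ?inE.
by rewrite detu_constt -(constt_p_elt lx) Di consttX mem_cycle.
Qed.

(** The action on [w] makes [a] the inverse of the determinant, which is itself a^2. *)
Lemma scalar_part_det (l : nat) a : mx2 tau.`_l = a%:M ->
  a = (\det (mx2 tau.`_l))^-1 /\ \det (mx2 tau.`_l) ^+ 3 = 1.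
Proof.
move=> ea; have e1 : a = (\det (mx2 tau.`_l))^-1.
  have [m em] : exists m, tau.`_l = (tau ^+ m)%g by rewrite /constt; eexists.
  have := wtauX m; rewrite -em {1}ea mul_mx_scalar => /eqP.
  by rewrite -subr_eq0 -scalerBl scaler_eq0 (negPf w0) orbF subr_eq0 => /eqP.
split=> //; have := scalar_el_det ea; set d := \det _ in e1 *; rewrite e1 => e.
have d0 : d != 0 by apply: mx2_det0.
by rewrite exprS {1}e; field.
Qed.

(** The determinant of the 3-part has order 3, so 3 divides p - 1 exactly once and the 3-part of p
    (p-1)^2 (p+1) is 9. Adjoining [z], of order 3 and outside SL_2, to a group of order divisible by
    9 would give 27. *)
Lemma card_SLin_9 : scalar_el tau.`_3%N -> \det (mx2 tau.`_3%N) != 1 -> ~~ (9 %| #|SLin G|)%N.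
Proof.
set z := tau.`_3%N => [[a ea] d1]; have [e1 d3] := scalar_part_det ea.
have Gz : z \in G by rewrite groupX.
have z3 : (z ^+ 3)%g = 1%g.
  apply: mx2_inj; rewrite mx21 !expgS expg0 mulg1 !mx2M ea -!scalar_mxM e1.
  by rewrite -!invfM -[X in X^-1]/(\det (mx2 z) ^+ 3) d3 invr1.
have oz : #[z] = 3%N by apply: nt_prime_order => //; apply: contraNneq d1 => ->; rewrite mx21 det1.
have odz : #[detu z] = 3%N.
  have ndz : detu z != 1%g by rewrite detu_eq1.
  apply: nt_prime_order ndz => //.
  by rewrite -(morphX [morphism of @detu p R]) ?inE // z3 morph1.
have lp : logn 3 p.-1 = 1%N.
  have := order_constt 3%N (detu tau); rewrite -detu_constt odz o_tau p_part => /esym/eqP.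
  by rewrite -[X in _ == X]expn1 eqn_exp2l // => /eqP.
have p3 : (3 %| p.-1)%N.
  by have := pfactor_dvdn 1 (isT : prime 3) (_ : 0 < p.-1)%N; rewrite lp expn1 => -> //; rewrite -subn1 subn_gt0 prime_gt1.
apply/negP=> d9.
have TI : SLin G :&: <[z]> = 1%g.
  rewrite setIC; apply: prime_TIg; first by rewrite -orderE oz.
  by rewrite cycle_subG inE negb_and d1 orbT.
have nz : <[z]> \subset 'N(SLin G)%g.
  by rewrite cycle_subG; apply: SLin_norm; apply: (subsetP (normG G)).
have := card_rep2_dvd (SLin G <*> <[z]>)%G; rewrite /= norm_joinEr // TI_cardMg // -orderE oz.
move=> d; have {d} d : (27 %| p * p.-1 ^ 2 * p.+1)%N.
  by apply: dvdn_trans d; rewrite (_ : 27 = 9 * 3)%N // dvdn_mul.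
have p0 : (0 < p)%N := prime_gt0 p_pr.
have p10 : (0 < p.-1)%N by rewrite -subn1 subn_gt0 prime_gt1.
rewrite (_ : 27 = 3 ^ 3)%N // pfactor_dvdn ?muln_gt0 ?expn_gt0 ?p0 ?p10 // in d.
move: d; rewrite !lognM ?muln_gt0 ?expn_gt0 ?p0 ?p10 // !lp.
have n1 : ~~ (3 %| p)%N by rewrite -(prednK p0) -(addn1 p.-1) dvdn_addr.
have n2 : ~~ (3 %| p.+1)%N by rewrite -(prednK p0) -(addn2 p.-1) dvdn_addr.
by rewrite (lognE 3 p) (lognE 3 p.+1) (negPf n1) (negPf n2) !andbF.
Qed.

Theorem triv_of_line_stab : triv G c.
Proof.
apply: (triv_Sylow charp cocG) => l l_pr nlp; set y := tau.`_l.
have Gy : y \in G by rewrite groupX.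
have [L sylL sYL] : {L : {group GL} | l.-Sylow(G) L & <[y]> \subset L}.
  by apply: Sylow_superset; rewrite ?cycle_subG //; apply: p_elt_constt.
have [sLG lL l'] := and3P sylL.
exists L; last by rewrite -p'natE.
split=> //; have Ly : y \in L by rewrite -cycle_subG.
have sdL : (@detu p R) @* L \subset <[detu y]>.
  apply/subsetP=> _ /morphimP[g _ Lg ->]; apply: l_part; first exact: (subsetP sLG).
  exact: mem_p_elt Lg.
have defL := SLin_cyclic_ext Ly sdL.
have cocL := cocycle2S sLG cocG.
have Sy : y \in line_stab w G by rewrite groupX.
have sL0L := SLin_sub L.
have [scy|nscy] := scalar_el_dec y; last first.
  have [cyc|ncyc] := boolP (cyclic (SLin L)).
    exact: (triv_nonscalar_abelian p_pr w0 p'G charp odd_p cocG trivw sLG Ly Sy nscy defL (cyclic_abelian cyc)).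
  have [odd_l|l2] := boolP (odd l).
    case/negP: ncyc; apply: sl2_odd_cyclic nlp odd_l (pgroupS sL0L lL) _ => //.
    exact: SLin_det1.
  have {l2} l2 : l = 2%N by case: (even_prime l_pr) => // l_odd; rewrite l_odd in l2.
  rewrite l2 in lL y Gy sYL Ly sdL defL Sy nscy *.
  apply: (triv_quaternion_Sylow p_pr w0 p'G charp odd_p cocG trivw sLG lL Ly nscy defL ncyc).
    have [m em] : exists m, y = (tau ^+ m)%g by rewrite /y /constt; eexists.
    by rewrite em wtauX.
  exact: nonsquare_det2.
have [a ea] := scy; have [_ d3] := scalar_part_det ea.
have [d1|d1] := eqVneq (\det (mx2 y)) 1.
  have slL : in_SL2 L.
    move=> g Lg; apply/eqP; rewrite -detu_eq1; apply/eqP.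
    have : detu g \in <[detu y]> by apply: (subsetP sdL); rewrite mem_morphim ?inE.
    have -> : detu y = 1%g by apply/eqP; rewrite detu_eq1 d1.
    by rewrite cycle1 => /set1P.
  exact: (triv_sl2 p_pr charp odd_p slL cocL).
have l3 : l = 3%N.
  apply/eqP; apply: contraNT d1 => nl3; rewrite -detu_eq1 -order_eq1; apply/eqP.
  have ly : l.-elt (detu y) by rewrite (morph_p_elt [morphism of @detu p R]) ?inE ?p_elt_constt.
  apply: (pnat_1 ly); apply: (@pnat_dvd _ 3); last by rewrite pnatE // !inE eq_sym.
  by rewrite order_dvdn -(morphX [morphism of @detu p R]) ?inE //= detu_eq1 mx2X_det d3.
rewrite {}l3 in lL y Gy sYL Ly sdL defL Sy scy ea d3 d1 sylL *.
have sG0 := SLin_sub G.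
have [g gN] := triv_sl2 p_pr charp odd_p (@SLin_det1 _ _ G) (cocycle2S sG0 cocG).
have y3 : (y ^+ 3)%g = 1%g.
  have [e1 _] := scalar_part_det ea.
  apply: mx2_inj; rewrite mx21 !expgS expg0 mulg1 !mx2M ea -!scalar_mxM e1.
  by rewrite -!invfM -[X in X^-1]/(\det (mx2 y) ^+ 3) d3 invr1.
have defG : G :=: (SLin G * <[tau]>)%g.
  by apply: SLin_cyclic_ext => //; apply/subsetP=> x _; apply: gen_tau.
have ph := cubic_twist_trivial p_pr w0 p'G odd_p cocG trivw Stau defG nonsquare_det Gy scy y3
  (card_SLin_9 scy d1) gN.
have ny : y \in 'N(SLin G)%g by apply: SLin_norm; apply: (subsetP (normG G)).
(* The vanishing of the twist uses invariance under all of [G], so it is obtained on the whole of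
   [SLin G]; the resulting group [H] contains [L]. *)
pose H := (SLin G <*> <[y]>)%G.
have defH : H :=: (SLin G * <[y]>)%g by rewrite /= norm_joinEr ?cycle_subG.
have sHG : H \subset G by rewrite join_subG sG0 cycle_subG.
apply: (@trivS _ _ L H).
  rewrite defH {1}defL; apply: mulSg.
  by apply/subsetP=> n; rewrite !inE => /andP[/(subsetP sLG) -> ->].
apply: (triv_cyclic_ext (cocycle2S sHG cocG) (joing_subl _ _) _ ny defH gN ph).
by rewrite -cycle_subG joing_subr.
Qed.
End LineStabilizer.

(** * Pushing cocycles to a quotient, and linear coordinates *)

Section Push.
Variables (k : fieldType) (T rT : finGroupType) (A : {group T}) (f : {morphism A >-> rT}).

Lemma push_cocycle (c : T -> T -> k) : cocycle2 A c ->
  (forall a a' b b', a \in A -> a' \in A -> b \in A -> b' \in A ->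
     f a = f a' -> f b = f b' -> c a b = c a' b') ->
  exists2 c' : rT -> rT -> k, cocycle2 (f @* A) c' & {in A &, forall a b, c' (f a) (f b) = c a b}.
Proof.
move=> [c0 cE] cf.
pose l x := odflt 1%g [pick a in A | f a == x].
have lP a : a \in A -> l (f a) \in A /\ f (l (f a)) = f a.
  move=> Aa; rewrite /l; case: pickP => [b /andP[Ab /eqP eb]|/(_ a)] //=.
  by rewrite Aa eqxx.
pose c' x y := c (l x) (l y).
have c'E : {in A &, forall a b, c' (f a) (f b) = c a b}.
  by move=> a b Aa Ab; have [A1 e1] := lP a Aa; have [A2 e2] := lP b Ab; apply: cf.
exists c' => //; split.
  by move=> _ _ /morphimP[a Aa _ ->] /morphimP[b Ab _ ->]; rewrite c'E ?c0.
move=> _ _ _ /morphimP[a Aa _ ->] /morphimP[b Ab _ ->] /morphimP[d Ad _ ->].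
by rewrite -!morphM // !c'E ?groupM // cE.
Qed.
End Push.

Definition GLrep (p : nat) : rep2 p :=
  @Rep2 p {'GL_2(p)} (fun g => GLval g : 'M['F_p]_2) (fun _ _ => erefl) erefl (@val_inj _ _ _).

Section Coordinates.
Variables (p : nat) (p_pr : prime p) (gT : finGroupType).
Local Notation F := 'F_p.
Local Notation e0 := (delta_mx 0 0 : 'rV[F]_2).
Local Notation e1 := (delta_mx 0 1 : 'rV[F]_2).

Lemma rV2E (r : 'rV[F]_2) : r = r 0 0 *: e0 + r 0 1 *: e1.
Proof.
by apply/rowP=> j; rewrite !mxE; case: (ord2P j) => ->; rewrite /= ?mulr1 ?mulr0 ?addr0 ?add0r.
Qed.

Lemma natFp (x : F) : (x : nat)%:R = x.
Proof. exact: natr_Zp. Qed.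

Lemma abelem_coord (E : {group gT}) u v :
    p.-abelem E -> #|E| = (p ^ 2)%N -> u \in E -> v \in E -> u != 1%g -> v \notin <[u]> ->
  exists kap : gT -> 'rV[F]_2, [/\ {in E &, forall x y, kap (x * y)%g = kap x + kap y},
    {in E &, injective kap}, kap u = e0 & kap v = e1].
Proof.
move=> abE oE Eu Ev u1 nuv.
have : E \isog [set: 'rV[F]_2].
  rewrite (isog_abelem_card _ abE) cardsT card_mx mul1n card_Fp // oE eqxx andbT.
  exact: mx_Fp_abelem.
case/isogP=> f injf imf.
have fM : {in E &, forall x y, f (x * y)%g = f x + f y} by move=> x y Ex Ey; rewrite morphM.
have fX x n : x \in E -> f (x ^+ n)%g = n%:R *: f x.
  move=> Ex; elim: n => [|n IH]; first by rewrite expg0 scale0r morph1.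
  by rewrite expgS fM ?groupX // IH -natr1 scalerDl scale1r addrC.
pose C : 'M[F]_2 := \matrix_(i, j) (if i == 0 then f u 0 j else f v 0 j).
have rC (r : 'rV[F]_2) : r *m C = r 0 0 *: f u + r 0 1 *: f v.
  by apply/rowP=> j; rewrite mulmx2 !mxE.
have uC : C \in unitmx.
  rewrite unitmxE unitfE; apply/negP=> /det0P[r r0]; rewrite rC => r_eq0.
  have [b0|b0] := eqVneq (r 0 1) 0.
    rewrite b0 scale0r addr0 in r_eq0; move/eqP: r_eq0; rewrite scaler_eq0 => /orP[] /eqP e.
      by case/eqP: r0; rewrite [r]rV2E e b0 !scale0r addr0.
    by case/eqP: u1; apply: (injmP injf); rewrite ?morph1.
  case/negP: nuv; apply/cycleP; exists (- (r 0 0 / r 0 1) : F) => //.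
  apply: (injmP injf); rewrite ?groupX // fX // natFp.
  apply: (scalerI b0); rewrite scalerA mulrN mulrCA mulfV // mulr1 scaleNr.
  by apply/eqP; rewrite -addr_eq0 addrC r_eq0.
exists (fun x => f x *m invmx C); split.
- by move=> x y Ex Ey; rewrite fM // mulmxDl.
- move=> x y Ex Ey e; apply: (injmP injf) => //.
  by rewrite -[f x](mulmxK (_ : invmx C \in unitmx)) ?unitmx_inv // invmxK e -{2}[C]invmxK mulmxK ?unitmx_inv.
- have -> : f u = e0 *m C by rewrite rC !mxE /= scale1r scale0r addr0.
  by rewrite mulmxK.
have -> : f v = e1 *m C by rewrite rC !mxE /= scale1r scale0r add0r.
by rewrite mulmxK.
Qed.

Section Linearize.
Variables (P : {group gT}) (kap : gT -> 'rV[F]_2) (u v : gT) (A : {group {perm gT}}).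
Hypothesis kapM : {in P &, forall x y, kap (x * y)%g = kap x + kap y}.
Hypotheses (Pu : u \in P) (Pv : v \in P) (ku : kap u = e0) (kv : kap v = e1).
Hypothesis sAP : A \subset Aut P.
Hypothesis kerA : forall a x, a \in A -> x \in P -> kap x = 0 -> kap (a x) = 0.

Lemma kap1 : kap 1%g = 0.
Proof. by apply: (addIr (kap 1%g)); rewrite -kapM ?group1 // mulg1 add0r. Qed.

Lemma kapX x n : x \in P -> kap (x ^+ n)%g = n%:R *: kap x.
Proof.
move=> Px; elim: n => [|n IH]; first by rewrite expg0 scale0r kap1.
by rewrite expgS kapM ?groupX // IH -natr1 scalerDl scale1r addrC.
Qed.

Lemma kapV x : x \in P -> kap x^-1%g = - kap x.
Proof.
by move=> Px; apply: (addrI (kap x)); rewrite -kapM ?groupV // mulgV kap1 subrr.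
Qed.

Lemma kap_surj (r : 'rV[F]_2) : kap (u ^+ (r 0 0 : F)%R * v ^+ (r 0 1 : F)%R)%g = r.
Proof. by rewrite kapM ?groupX // !kapX // ku kv !natFp -rV2E. Qed.

Lemma autM a x y : a \in A -> x \in P -> y \in P -> a (x * y)%g = (a x * a y)%g.
Proof. by move=> /(subsetP sAP) Aa Px Py; rewrite -!(autmE Aa) morphM. Qed.

Lemma aut_mem a x : a \in A -> x \in P -> a x \in P.
Proof. by move=> /(subsetP sAP) Aa Px; apply: Aut_closed. Qed.

Lemma autX a x n : a \in A -> x \in P -> a (x ^+ n)%g = (a x ^+ n)%g.
Proof. by move=> /(subsetP sAP) Aa Px; rewrite -!(autmE Aa) morphX. Qed.

Definition lin (a : {perm gT}) : 'M[F]_2 := \matrix_(i, j) (if i == 0 then kap (a u) 0 j else kap (a v) 0 j).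

Lemma linE a x : a \in A -> x \in P -> kap (a x) = kap x *m lin a.
Proof.
move=> Aa Px; set r := kap x.
have -> : r *m lin a = r 0 0 *: kap (a u) + r 0 1 *: kap (a v).
  by apply/rowP=> j; rewrite mulmx2 !mxE.
pose y := (u ^+ (r 0 0 : F)%R * v ^+ (r 0 1 : F)%R)%g.
have Py : y \in P by rewrite groupM ?groupX.
have <- : kap (a y) = r 0 0 *: kap (a u) + r 0 1 *: kap (a v).
  by rewrite autM ?groupX // kapM ?aut_mem ?groupX // !autX // !kapX ?aut_mem // !natFp.
have k0 : kap (x * y^-1)%g = 0 by rewrite kapM ?groupV // kapV // kap_surj subrr.
have Pxy : (x * y^-1)%g \in P by rewrite groupM ?groupV.
have -> : kap (a x) = kap (a (x * y^-1)%g) + kap (a y).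
  by rewrite -kapM ?aut_mem // -(autM Aa Pxy Py) mulgKV.
by rewrite (kerA Aa Pxy k0) add0r.
Qed.

Lemma linM a b : a \in A -> b \in A -> lin (a * b)%g = lin a *m lin b.
Proof.
move=> Aa Ab; apply/row_matrixP=> i; rewrite row_mul.
have rowE (c : {perm gT}) : row i (lin c) = kap (c (if i == 0 then u else v)).
  by apply/rowP=> j; rewrite !mxE; case: eqP.
by rewrite !rowE permM linE // aut_mem //; case: ifP.
Qed.

Lemma lin1 : lin 1%g = 1%:M.
Proof.
apply/row_matrixP=> i; rewrite row1; apply/rowP=> j; rewrite !mxE !perm1 ku kv.
by case: (ord2P i) => ->; rewrite !mxE.
Qed.

Lemma lin_unit a : a \in A -> lin a \in unitmx.
Proof.
move=> Aa; have : lin a *m lin a^-1%g = 1%:M by rewrite -linM ?groupV // mulgV lin1.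
by case/mulmx1_unit.
Qed.

Definition linGL (a : {perm gT}) : {'GL_2(p)} := insubd (1%g : {'GL_2(p)}) (lin a : 'M[F]_(2.-1.+1)).

Lemma linGLE a : a \in A -> mx2 (linGL a : rep2_group (GLrep p)) = lin a.
Proof. by move=> Aa; rewrite /= /linGL -[RHS](insubdK (1%g : {'GL_2(p)})) //; apply: lin_unit. Qed.

Lemma linGLM : {in A &, {morph linGL : a b / (a * b)%g >-> (a * b)%g}}.
Proof.
move=> a b Aa Ab; apply: (@mx2_inj _ (GLrep p)).
by rewrite mx2M !linGLE ?groupM // linM.
Qed.

(** [kap] may have a kernel, so one statement serves both Q itself and S modulo Z(S); [kerA] is what
    makes the action on coordinates well defined. *)
Lemma linearize : exists f : {morphism A >-> rep2_group (GLrep p)},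
  forall a x, a \in A -> x \in P -> kap (a x) = kap x *m mx2 (f a).
Proof.
by exists (Morphism linGLM) => a x Aa Px; rewrite linGLE // linE.
Qed.
End Linearize.
End Coordinates.

(** * Fusion systems on extraspecial groups of order p^3 *)

Section FusionBasics.
Variables (gT : finGroupType) (p : nat) (S : {group gT}).
Variable F : {set gT} -> {set {ffun gT -> gT}}.
Hypothesis fsF : fusion_system S F.
Implicit Types (P Q : {group gT}) (f : {ffun gT -> gT}).

Lemma F_hom (P : {set gT}) f : f \in F P -> inj_hom_into S P f.
Proof. by case: fsF => h _ _ _ _; apply: h. Qed.

Lemma F_im_group (P : {set gT}) f : f \in F P -> group_set (f @: P).
Proof.
case: (fsF) => _ _ _ _ inv /inv[g Fg _].
by have [/andP[]] := F_hom Fg.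
Qed.

Lemma F_morph (P : {set gT}) f x y : f \in F P -> x \in P -> y \in P -> f (x * y)%g = (f x * f y)%g.
Proof. by move=> /F_hom[_ fM _ _ _]; apply: fM. Qed.

Lemma F_inj (P : {set gT}) f : f \in F P -> {in P &, injective f}.
Proof. by case/F_hom. Qed.

Lemma F_sub (P : {set gT}) f x : f \in F P -> x \in P -> f x \in S.
Proof. by move=> /F_hom[_ _ _ /subsetP sfS _] Px; apply/sfS/imset_f. Qed.

Lemma F_out (P : {set gT}) f x : f \in F P -> x \notin P -> f x = x.
Proof. by move=> /F_hom[_ _ _ _ out] nPx; apply: out; rewrite inE. Qed.

Lemma F1 P f : f \in F P -> f 1%g = 1%g.
Proof.
by move=> Ff; apply: (mulIg (f 1%g)); rewrite -(F_morph Ff) ?group1 // mulg1 mul1g.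
Qed.

Lemma FX P f x n : f \in F P -> x \in P -> f (x ^+ n)%g = (f x ^+ n)%g.
Proof.
move=> Ff Px; elim: n => [|n IH]; first by rewrite !expg0 (F1 Ff).
by rewrite !expgS (F_morph Ff) ?groupX // IH.
Qed.

Lemma F_conj P s : P \subset S -> s \in S -> res P (cjmap s) \in F P.
Proof. by case: fsF => _ h _ _ _ sPS Ss; apply: h. Qed.

Lemma resE (P : {set gT}) f x : x \in P -> res P f x = f x.
Proof. by move=> Px; rewrite ffunE Px. Qed.

Lemma F_res (P : {set gT}) Q f : f \in F P -> Q \subset P -> res Q f \in F Q.
Proof. by case: fsF => _ _ _ h _; apply: h. Qed.

Lemma F_comp (P : {set gT}) f g : f \in F P -> g \in F (f @: P) ->
  exists2 h, h \in F P & {in P, forall x, h x = g (f x)}.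
Proof.
case: fsF => _ _ h _ _ Ff Fg; exists (compmap P g f); first exact: h.
by move=> x Px; rewrite /compmap resE // ffunE.
Qed.

Lemma F_inv (P : {set gT}) f : f \in F P ->
  exists2 g, g \in F (f @: P) & {in P, forall x, g (f x) = x}.
Proof. by case: fsF => _ _ _ _ h; apply: h. Qed.

(** Morphisms are the identity outside their domain, so one mapping [P] onto itself is already a
    permutation of the whole type. *)
Lemma F_perm P f : f \in F P -> f @: P = P -> exists2 a, a \in AutF F P & a =1 f.
Proof.
move=> Ff fP.
have fPx x : (f x \in P) = (x \in P).
  have [Px|nPx] := boolP (x \in P); first by rewrite -fP imset_f.
  by rewrite (F_out Ff nPx) (negPf nPx).
have injf : injective f.
  move=> x y e; have [Px|nPx] := boolP (x \in P); last first.
    have nPy : y \notin P by rewrite -fPx -e fPx.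
    by rewrite -(F_out Ff nPx) e (F_out Ff nPy).
  by apply: (F_inj Ff) => //; rewrite -fPx -e fPx.
exists (perm injf); last by move=> x; rewrite permE.
have -> : (perm injf \in AutF F P) = (perm injf \in Aut P) && (finfun (perm injf) \in F P).
  by rewrite inE.
apply/andP; split.
  rewrite inE; apply/andP; split.
    apply/subsetP=> x; rewrite inE permE; apply: contraNT => nPx.
    by rewrite (F_out Ff nPx).
  by apply/morphicP=> x y Px Py; rewrite !permE (F_morph Ff).
by have -> : finfun (perm injf) = f by apply/ffunP=> x; rewrite ffunE permE.
Qed.

Lemma AutF_Aut (P : {set gT}) a : a \in AutF F P -> a \in Aut P.
Proof. by rewrite inE => /andP[]. Qed.

Lemma AutF_F (P : {set gT}) a : a \in AutF F P -> exists2 f, f \in F P & a =1 f.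
Proof. by rewrite inE => /andP[_ Fa]; exists (finfun a) => // x; rewrite ffunE. Qed.

Lemma Aut_im P (a : {perm gT}) : a \in Aut P -> a @: P = P.
Proof.
move=> Aa; apply/eqP; rewrite eqEcard card_imset ?leqnn ?andbT; last exact: perm_inj.
by apply/subsetP=> _ /imsetP[x Px ->]; apply: Aut_closed.
Qed.

Lemma AutF_group_set P : P \subset S -> group_set (AutF F P).
Proof.
move=> sPS; apply/group_setP; split.
  rewrite inE group1; have -> : finfun (1 : {perm gT})%g = res P (cjmap 1%g).
    by apply/ffunP=> x; rewrite !ffunE perm1 conjg1 if_same.
  exact: F_conj.
move=> a b Pa Pb; have [f Ff af] := AutF_F Pa; have [g Fg bg] := AutF_F Pb.
have [|h Fh hE] := @F_comp P f g Ff.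
  by rewrite -(eq_imset _ af) Aut_im ?AutF_Aut.
rewrite inE groupM ?AutF_Aut //=.
have -> // : finfun (a * b)%g = h.
apply/ffunP=> x; rewrite ffunE permM.
have [Px|nPx] := boolP (x \in P); first by rewrite hE // af bg.
by rewrite (F_out Fh nPx) (out_Aut (AutF_Aut Pa) nPx) (out_Aut (AutF_Aut Pb) nPx).
Qed.

Lemma InnSetP P a :
  reflect (a \in Aut P /\ exists2 s, s \in P & {in P, forall x, a x = x ^ s}%g) (a \in InnSet P).
Proof.
apply: (iffP setIdP) => [] [Aa].
  by case/exists_inP=> s Ps /forall_inP e; split=> //; exists s => // x /e/eqP.
by case=> s Ps e; split=> //; apply/exists_inP; exists s => //; apply/forall_inP=> x /e->.
Qed.

Lemma InnSet_group_set P : group_set (InnSet P).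
Proof.
apply/group_setP; split.
  apply/InnSetP; split; first exact: group1.
  by exists 1%g; rewrite ?group1 // => x _; rewrite perm1 conjg1.
move=> a b /InnSetP[Aa [s Ps ea]] /InnSetP[Ab [t Pt eb]]; apply/InnSetP; split; first exact: groupM.
exists (s * t)%g; first exact: groupM.
by move=> x Px; rewrite permM ea // eb ?groupJ // conjgM.
Qed.

Lemma InnGE P : InnG P :=: InnSet P.
Proof. exact: gen_set_id (InnSet_group_set P). Qed.

Lemma InnGP P a :
  reflect (a \in Aut P /\ exists2 s, s \in P & {in P, forall x, a x = x ^ s}%g) (a \in InnG P).
Proof.
have -> : (a \in InnG P) = (a \in InnSet P) by rewrite [in LHS]InnGE.
exact: InnSetP.
Qed.

Lemma InnG_norm P : Aut P \subset 'N(InnG P)%g.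
Proof.
apply/subsetP=> b Ab; rewrite inE; apply/subsetP=> _ /imsetP[a /InnGP[Aa [s Ps ea]] ->].
apply/InnGP; split; first exact: groupJ.
exists (b s); first exact: Aut_closed.
move=> x Px; have PbV : (b^-1)%g x \in P by apply: Aut_closed => //; rewrite groupV.
rewrite conjgE !permM ea // -!(autmE Ab) morphJ //= !autmE.
by rewrite permKV.
Qed.

End FusionBasics.

(** * Rank-two subgroups of the extraspecial group *)

Section Extraspecial.
Variables (gT : finGroupType) (p : nat) (S : {group gT}).
Hypotheses (p_pr : prime p) (oS : #|S| = (p ^ 3)%N) (esS : extraspecial S) (expS : exponent S = p).
Implicit Types (P Q : {group gT}).
Local Notation Z := 'Z(S).

Lemma es_pgroup : p.-group S.
Proof. by rewrite /pgroup oS pnatX pnat_id. Qed.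

Lemma es_cardZ : #|Z| = p.
Proof. exact: card_center_extraspecial es_pgroup esS. Qed.

Lemma es_der : S^`(1)%g = Z.
Proof. by case: esS => [[]]. Qed.

Lemma es_nabelian : ~~ abelian S.
Proof.
apply/negP=> /derG1P; rewrite es_der => Z1; have := es_cardZ; rewrite Z1 cards1 => p1.
by move: p_pr; rewrite -p1.
Qed.

Lemma es_expp x : x \in S -> (x ^+ p)%g = 1%g.
Proof. by move=> Sx; rewrite -expS expg_exponent. Qed.

Lemma es_comm x y : x \in S -> y \in S -> [~ x, y]%g \in Z.
Proof. by move=> Sx Sy; rewrite -es_der mem_commg. Qed.

Lemma es_Z_cent x y : x \in Z -> y \in S -> commute x y.
Proof. by move=> /centerP[_ c] Sy; apply: c. Qed.

Lemma es_ZS x : x \in Z -> x \in S. Proof. exact: (subsetP (center_sub S)). Qed.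

Lemma es_order x : x \in S -> x != 1%g -> #[x] = p.
Proof. by move=> Sx x1; apply: nt_prime_order => //; apply: es_expp. Qed.

Lemma es_gen z : z \in Z -> z != 1%g -> Z = <[z]>.
Proof.
move=> Zz z1; apply/eqP; rewrite eq_sym eqEcard cycle_subG Zz /= es_cardZ -orderE.
by rewrite (es_order (es_ZS Zz)).
Qed.

Section Rank2.
Variable Q : {group gT}.
Hypotheses (sQS : Q \subset S) (oQ : #|Q| = (p ^ 2)%N).

Lemma es2_index : #|S : Q|%g = p.
Proof. by rewrite -divgS // oS oQ expnS mulnK // expn_gt0 prime_gt0. Qed.

Lemma es2_abelian : abelian Q.
Proof.
apply: (@p2group_abelian _ p); first exact: pgroupS es_pgroup.
by rewrite oQ pfactorK.
Qed.

Lemma es2_maximal : maximal Q S.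
Proof. by apply: p_index_maximal; rewrite ?es2_index. Qed.

Lemma es2_normal : Q <| S.
Proof. exact: p_maximal_normal es_pgroup es2_maximal. Qed.

(** Otherwise Z(S) meets [Q] trivially, and by orders S = Z(S) Q would be abelian. *)
Lemma es2_Z : Z \subset Q.
Proof.
apply/negP=> nZQ; have /negP := es_nabelian; apply.
have TI : Z :&: Q = 1%g by apply: prime_TIg; rewrite ?es_cardZ //; apply/negP.
have eS : (Z * Q)%g = S.
  apply/eqP; rewrite eqEcard mul_subG ?center_sub //= TI_cardMg // es_cardZ oQ oS.
  by rewrite -expnS.
rewrite -eS abelianM center_abelian es2_abelian /=.
by apply/centsP=> x Qx y Zy; apply/commute_sym/(es_Z_cent Zy)/(subsetP sQS).
Qed.

Lemma es2_cent : 'C_S(Q)%g = Q.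
Proof.
have sQC : Q \subset 'C_S(Q)%g by rewrite subsetI sQS; apply: es2_abelian.
apply/eqP; rewrite eqEsubset sQC andbT.
have [_ maxQ] := maxgroupP es2_maximal.
have [pC|npC] := boolP ('C_S(Q)%g \proper S).
  by rewrite (maxQ ('C_S(Q))%G pC sQC).
have sSC : S \subset 'C(Q)%g.
  by move: npC; rewrite properE subsetIl /= negbK subsetI => /andP[].
have : Q \subset Z by rewrite subsetI sQS centsC.
by move/subset_leq_card; rewrite es_cardZ oQ leqNgt -{1}[p]expn1 ltn_exp2l ?prime_gt1.
Qed.

Lemma es2_abelem : p.-abelem Q.
Proof.
rewrite abelemE // es2_abelian /=; apply/exponentP=> x Qx.
by apply: es_expp; apply: (subsetP sQS).
Qed.

Lemma es2_outZ : exists2 q, q \in Q & q \notin Z.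
Proof.
apply/subsetPn; apply/negP=> /subset_leq_card.
by rewrite es_cardZ oQ leqNgt -{1}[p]expn1 ltn_exp2l ?prime_gt1.
Qed.

Lemma es2_decomp q : q \in Q -> q \notin Z -> Q :=: (<[q]> * Z)%g.
Proof.
move=> Qq nZq; have Sq : q \in S by apply: (subsetP sQS).
have oq : #[q] = p by apply: es_order => //; apply: contraNneq nZq => ->; apply: group1.
have TI : <[q]> :&: Z = 1%g by apply: prime_TIg; rewrite -?orderE ?oq // cycle_subG.
apply/eqP; rewrite eq_sym eqEcard mul_subG ?cycle_subG ?es2_Z //= TI_cardMg //.
by rewrite es_cardZ -orderE oq oQ.
Qed.
End Rank2.

(* [q, _] maps S onto Z when q is not central. *)
Lemma es_conj q x : q \in S -> q \notin Z -> x \in Z -> exists2 h, h \in S & (q ^ h = q * x)%g.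
Proof.
move=> Sq nZq Zx.
have [h0 Sh0 ne] : exists2 h, h \in S & [~ q, h]%g != 1%g.
  apply/exists_inP; apply: contraR nZq; rewrite negb_exists_in => /forall_inP cq.
  apply/centerP; split=> // h Sh; apply/commgP; have := cq h Sh; by rewrite negbK.
have Zc := es_comm Sq Sh0.
move: Zx; rewrite (es_gen Zc ne) => /cycleP[i ->]; exists (h0 ^+ i)%g; first exact: groupX.
rewrite -commgX; last by apply/commute_sym/(es_Z_cent Zc).
by rewrite commgEl mulKVg.
Qed.

Lemma es_notin1 P : P \subset S -> #|P| = p -> P :!=: Z -> P :&: Z = 1%g.
Proof.
move=> sPS oP nPZ; apply: prime_TIg; rewrite ?oP //; apply: contra nPZ => sPZ.
by rewrite eqEcard sPZ oP es_cardZ leqnn.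
Qed.

Lemma es_mulZ P : P \subset S -> #|P| = p -> P :!=: Z -> #|(P * Z)%g| = (p ^ 2)%N.
Proof. by move=> sPS oP nPZ; rewrite TI_cardMg ?es_notin1 // oP es_cardZ. Qed.
End Extraspecial.

(** * If no rank-two subgroup moves the center, the system is constrained *)

Section Radical.
Variables (gT : finGroupType) (p : nat) (S : {group gT}).
Variable F : {set gT} -> {set {ffun gT -> gT}}.
Hypotheses (p_pr : prime p) (oS : #|S| = (p ^ 3)%N) (esS : extraspecial S) (expS : exponent S = p).
Hypothesis satF : saturated S F p.
Implicit Types (P Q : {group gT}) (f : {ffun gT -> gT}).
Local Notation Z := 'Z(S).

Lemma sat_fs : fusion_system S F. Proof. by case: satF. Qed.
Local Notation fsF := sat_fs.

Lemma card_imF (P : {set gT}) f : f \in F P -> #|f @: P| = #|P|.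
Proof. by move=> Ff; apply: card_in_imset; apply: (F_inj fsF Ff). Qed.

Lemma imF_sub (P : {set gT}) f : f \in F P -> f @: P \subset S.
Proof. by move=> Ff; apply/subsetP=> _ /imsetP[x Px ->]; apply: (F_sub fsF Ff). Qed.

Lemma imF_S f : f \in F S -> f @: S = S.
Proof. by move=> Ff; apply/eqP; rewrite eqEcard (imF_sub Ff) (card_imF Ff) leqnn. Qed.

Lemma es_Z1 : exists2 z, z \in Z & z != 1%g.
Proof.
have : Z != 1%g by rewrite trivg_card1 (es_cardZ p_pr oS esS); case: (p) p_pr => [|[]].
by case/trivgPn=> z Zz z1; exists z.
Qed.

Lemma F_S_center f : f \in F S -> {in Z, forall x, f x \in Z}.
Proof.
move=> Ff x Zx; have Sx := es_ZS Zx; apply/centerP; split; first exact: (F_sub fsF Ff).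
move=> y; rewrite -{1}(imF_S Ff) => /imsetP[y' Sy' ->].
by rewrite /commute -!(F_morph fsF Ff) // (es_Z_cent Zx).
Qed.

Lemma fully_centralized2 P : P \subset S -> #|P| = (p ^ 2)%N -> fully_centralized S F P.
Proof.
move=> sPS oP f Ff; have gP := F_im_group fsF Ff; pose P' := Group gP.
have sP'S : P' \subset S := imF_sub Ff.
have oP' : #|P'| = (p ^ 2)%N by rewrite /= (card_imF Ff).
have -> : f @: P = P' by [].
by rewrite (es2_cent p_pr oS esS sP'S oP') (es2_cent p_pr oS esS sPS oP) oP oP'.
Qed.

Lemma sat_extend P f : P \subset S -> f \in F P -> fully_centralized S F (f @: P) ->
  exists D : {group gT}, exists2 fb, fb \in F D & {in P, forall x, fb x = f x} /\
   forall s, s \in 'N_S(P)%g -> (exists2 h, h \in 'N_S(f @: P)%g & {in P, forall x, f (x ^ s) = f x ^ h}%g) ->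
    s \in D.
Proof.
move=> sPS Ff fc; case: (satF) => _ _ /(_ P f sPS Ff fc) /= [fb Ffb fbE].
have [/andP[gD _] _ _ _ _] := F_hom fsF Ffb.
exists (Group gD); exists fb => //; split=> // s Ns [h Nh e].
rewrite inE Ns /=; apply/exists_inP; exists h => //; apply/forall_inP=> x Px; exact/eqP/e.
Qed.

(** For noncentral [q] in [P], any [s] of [S] fixes Z(S) and sends [q] to q [q, s]. As f [q, s] is
    central, some [h] in [S] acts on f q by the same translation, so every [s] lies in the domain
    granted by saturation. *)
Lemma extend_rank2 P f : P \subset S -> #|P| = (p ^ 2)%N -> f \in F P ->
  {in Z, forall x, f x \in Z} -> exists2 fb, fb \in F S & {in P, forall x, fb x = f x}.
Proof.
move=> sPS oP Ff fZ; have gP := F_im_group fsF Ff; pose P' := Group gP.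
have sP'S : P' \subset S := imF_sub Ff.
have oP' : #|P'| = (p ^ 2)%N by rewrite /= (card_imF Ff).
have [D [fb Fb [fbE sD]]] := sat_extend sPS Ff (fully_centralized2 sP'S oP').
have ZP := subsetP (es2_Z p_pr oS esS sPS oP).
have nP := normal_norm (es2_normal p_pr oS sPS oP).
have nP' := normal_norm (es2_normal p_pr oS sP'S oP').
suffices sSD : S \subset D.
  exists (res S fb); first exact: (F_res fsF Fb sSD).
  by move=> x Px; rewrite resE ?fbE // (subsetP sPS).
apply/subsetP=> s Ss; apply: sD; first by rewrite inE Ss (subsetP nP).
have [q Pq nZq] := es2_outZ p_pr oS esS oP.
have Sq : q \in S by apply: (subsetP sPS).
have Zqs : [~ q, s]%g \in Z by apply: (es_comm esS).
have nZfq : f q \notin Z.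
  apply: contra nZq => Zfq.
  have fZZ : f @: Z = Z.
    apply/eqP; rewrite eqEcard card_in_imset; last first.
      by move=> x y Zx Zy; apply: (F_inj fsF Ff); apply: ZP.
    by rewrite leqnn andbT; apply/subsetP=> _ /imsetP[x Zx ->]; apply: fZ.
  by move: Zfq; rewrite -{1}fZZ => /imsetP[x Zx e]; rewrite (F_inj fsF Ff Pq (ZP _ Zx) e).
have [h Sh eh] := es_conj p_pr oS esS expS (F_sub fsF Ff Pq) nZfq (fZ _ Zqs).
exists h; first by rewrite inE Sh (subsetP nP').
move=> x; rewrite {1}(es2_decomp p_pr oS esS expS sPS oP Pq nZq).
case/mulsgP=> _ y /cycleP[i ->] Zy ->.
have Py := ZP _ Zy; have Pc := ZP _ Zqs; have Pqi : (q ^+ i)%g \in P by rewrite groupX.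
have ys : (y ^ s = y)%g by apply/conjg_fixP/commgP/(es_Z_cent Zy).
have fyh : (f y ^ h = f y)%g by apply/conjg_fixP/commgP/(es_Z_cent (fZ _ Zy)).
have qs : (q ^ s = q * [~ q, s])%g by rewrite commgEl mulKVg.
have Pqc : (q * [~ q, s])%g \in P by rewrite groupM.
rewrite conjMg ys conjXg qs (F_morph fsF Ff (groupX i Pqc) Py) (FX fsF i Ff Pqc).
rewrite (F_morph fsF Ff Pq Pc) -eh (F_morph fsF Ff Pqi Py) (FX fsF i Ff Pq).
by rewrite [RHS]conjMg conjXg fyh.
Qed.

Definition moves_center Q := exists2 f, f \in F Q & f @: Q = Q /\ exists2 x, x \in Z & f x \notin Z.

Section NoRadical.
Hypothesis norad : forall Q, Q \subset S -> #|Q| = (p ^ 2)%N -> ~ moves_center Q.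

(** Conjugation by some [s] outside [P], transported by [f], is an automorphism [b] of the image
    with b^p = 1. By [norad] it acts on Z(S) as an i-th power map, and i^p = i mod p makes this
    trivial. So the inverse of [f] sends Z(S) to elements of [P] fixed by [s], which are central. *)
Lemma norad_center P f : P \subset S -> #|P| = (p ^ 2)%N -> f \in F P -> {in Z, forall x, f x \in Z}.
Proof.
move=> sPS oP Ff; have gP := F_im_group fsF Ff; pose P' := Group gP.
have sP'S : P' \subset S := imF_sub Ff.
have oP' : #|P'| = (p ^ 2)%N by rewrite /= (card_imF Ff).
have ZP := subsetP (es2_Z p_pr oS esS sPS oP).
have ZP' := subsetP (es2_Z p_pr oS esS sP'S oP').
have [g Fg gf] := F_inv fsF Ff.
have fg y : y \in P' -> f (g y) = y by case/imsetP=> x Px ->; rewrite gf.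
have gP' y : y \in P' -> g y \in P by case/imsetP=> x Px ->; rewrite gf.
have [s Ss nPs] : exists2 s, s \in S & s \notin P.
  apply/subsetPn; apply/negP=> /subset_leq_card; rewrite oS oP leqNgt ltn_exp2l ?prime_gt1 //.
have nP := normal_norm (es2_normal p_pr oS sPS oP).
have Ps x : x \in P -> (x ^ s)%g \in P by move=> Px; rewrite memJ_norm // (subsetP nP).
have imgP : g @: P' = P.
  apply/eqP; rewrite eqEcard (card_imF Fg) oP oP' leqnn andbT.
  by apply/subsetP=> _ /imsetP[y Py ->]; apply: gP'.
have imP : res P (cjmap s) @: P = P.
  have Fs := F_conj fsF sPS Ss.
  apply/eqP; rewrite eqEcard (card_imF Fs) leqnn andbT.
  by apply/subsetP=> _ /imsetP[y Py ->]; rewrite resE // ffunE Ps.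
have [h1 Fh1 h1E] : exists2 h, h \in F P' & {in P', forall x, h x = (g x ^ s)%g}.
  have [|h Fh hE] := F_comp fsF Fg (g := res P (cjmap s)).
    by rewrite imgP; apply: (F_conj fsF).
  by exists h => // x Px; rewrite hE // resE ?gP' // ffunE.
have imh1 : h1 @: P' = P.
  apply/eqP; rewrite eqEcard (card_imF Fh1) oP oP' leqnn andbT.
  by apply/subsetP=> _ /imsetP[y Py ->]; rewrite h1E // Ps ?gP'.
have [b Fb bE] : exists2 b, b \in F P' & {in P', forall x, b x = f (g x ^ s)%g}.
  have [|b Fb bE] := F_comp fsF Fh1 (g := f); first by rewrite imh1.
  by exists b => // x Px; rewrite bE // h1E.
have bP' x : x \in P' -> b x \in P' by move=> Px; rewrite bE // imset_f // Ps ?gP'.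
have imb : b @: P' = P'.
  by apply/eqP; rewrite eqEcard (card_imF Fb) leqnn andbT; apply/subsetP=> _ /imsetP[y Py ->]; apply: bP'.
have bZ x : x \in Z -> b x \in Z.
  move=> Zx; apply/negP=> /negP nZ; case: (norad sP'S oP'); exists b => //.
  by split=> //; exists x.
have bfix x : x \in Z -> b x = x.
  have [z Zz z1] := es_Z1; have eZ := es_gen p_pr oS esS expS Zz z1.
  have P'z := ZP' _ Zz.
  suffices bz : b z = z by rewrite eZ => /cycleP[i ->]; rewrite (FX fsF _ Fb) ?bz.
  have := bZ _ Zz; rewrite {1}eZ => /cycleP[i bzi].
  have it n : iter n b z = (z ^+ (i ^ n))%g.
    elim: n => [|n IH] //=; rewrite IH (FX fsF _ Fb) // bzi -expgM -expnS //.
  have it' n : iter n b z = f ((g z) ^ (s ^+ n))%g.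
    elim: n => [|n IH] /=; first by rewrite expg0 conjg1 fg.
    have Pc : (g z ^ (s ^+ n))%g \in P by rewrite memJ_norm ?gP' // groupX ?(subsetP nP).
    by rewrite IH bE ?imset_f // gf // -conjgM -expgSr.
  have := it' p; rewrite it (es_expp expS Ss) conjg1 fg //.
  move=> e; rewrite bzi -[RHS]e; apply/eqP; rewrite eq_expg_mod_order.
  by rewrite (es_order p_pr expS (es_ZS Zz) z1) eq_sym fermat_little.
have gZ x : x \in Z -> g x \in Z.
  move=> Zx; have P'x := ZP' _ Zx; have Px := gP' _ P'x.
  have gs : (g x ^ s)%g = g x by rewrite -[RHS](gf) ?gP' // -[in LHS](gf _ (Ps _ Px)) -bE // bfix // fg.
  apply/negP=> /negP nZ; case/negP: nPs.
  rewrite -(es2_cent p_pr oS esS sPS oP) inE Ss; apply/centP=> y.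
  rewrite {1}(es2_decomp p_pr oS esS expS sPS oP Px nZ) => /mulsgP[_ d /cycleP[i ->] Zd ->].
  have cs : commute s (g x) by apply/commute_sym/commgP/conjg_fixP.
  by apply: commuteM; [apply: commuteX | apply/commute_sym/(es_Z_cent Zd)].
have gZZ : g @: Z = Z.
  apply/eqP; rewrite eqEcard card_in_imset; last first.
    by move=> x y Zx Zy; apply: (F_inj fsF Fg); apply: ZP'.
  by rewrite leqnn andbT; apply/subsetP=> _ /imsetP[x Zx ->]; apply: gZ.
move=> x; rewrite -{1}gZZ => /imsetP[y Zy ->].
by rewrite fg // ZP'.
Qed.

Lemma norad_extend2 P f : P \subset S -> #|P| = (p ^ 2)%N -> f \in F P ->
  exists2 fb, fb \in F S & {in P, forall x, fb x = f x}.
Proof. by move=> sPS oP Ff; apply: extend_rank2 => //; apply: norad_center sPS oP Ff. Qed.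

(* Saturation extends f to 'C_S(P), which has order at least p^2. *)
Lemma norad_extend_fc P f : P \subset S -> #|P| = p -> f \in F P ->
  fully_centralized S F (f @: P) -> exists2 fb, fb \in F S & {in P, forall x, fb x = f x}.
Proof.
move=> sPS oP Ff fc; have [D [fb Fb [fbE sD]]] := sat_extend sPS Ff fc.
have sCD : 'C_S(P)%g \subset D.
  apply/subsetP=> s /setIP[Ss Cs]; apply: sD.
    by rewrite inE Ss (subsetP (cent_sub P)).
  exists 1%g; first by rewrite inE group1 group1.
  move=> x Px; rewrite conjg1; congr (f _).
  by apply/conjg_fixP/commgP/commute_sym/(centP Cs).
have [PZ|nPZ] := eqVneq (P : {set gT}) Z.
  have sSC : S \subset 'C_S(P)%g.
    by rewrite subsetI subxx PZ centsC subsetIr.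
  have sSD := subset_trans sSC sCD.
  exists (res S fb); first exact: (F_res fsF Fb sSD).
  by move=> x Px; rewrite resE ?fbE // (subsetP sPS).
pose R := (P <*> Z)%G.
have cPZ : Z \subset 'C(P)%g by rewrite (subset_trans (subsetIr S _)) ?centS.
have eR : R :=: (P * Z)%g by rewrite /= cent_joinEr.
have sRS : R \subset S by rewrite join_subG sPS center_sub.
have oR : #|R| = (p ^ 2)%N by rewrite eR (es_mulZ p_pr oS esS sPS oP nPZ).
have abP : P \subset 'C(P)%g by apply: cyclic_abelian; rewrite prime_cyclic // oP.
have sRC : R \subset 'C_S(P)%g by rewrite subsetI sRS join_subG abP.
have [h Fh hE] := norad_extend2 sRS oR (F_res fsF Fb (subset_trans sRC sCD)).
exists h => // x Px; have Rx : x \in R by rewrite mem_gen // inE Px.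
by rewrite hE // resE // fbE.
Qed.

(** It remains to see that the image of [f] is fully centralized. If it is Z(S), this is clear.
    Otherwise none of its conjugates is Z(S), since a morphism onto Z(S) extends to [S] and must
    start from Z(S); so their centralizers have order at most p^2, and that of the image attains
    this bound. *)
Lemma norad_extend1 P f : P \subset S -> #|P| = p -> f \in F P ->
  exists2 fb, fb \in F S & {in P, forall x, fb x = f x}.
Proof.
move=> sPS oP Ff.
have fcZ (D : {set gT}) : D = Z -> fully_centralized S F D.
  move=> -> h _; have -> : 'C_S(Z)%g = S by apply/setIidPl; rewrite centsC subsetIr.
  exact: subset_leq_card (subsetIl _ _).
have gP := F_im_group fsF Ff; pose P' := Group gP.
have sP'S : P' \subset S := imF_sub Ff.
have oP' : #|P'| = p by rewrite /= (card_imF Ff).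
have toZ (D : {group gT}) h : D \subset S -> #|D| = p -> h \in F D -> h @: D = Z -> D :=: Z.
  move=> sDS oD Fh hD.
  have [hb Fhb hbE] := norad_extend_fc sDS oD Fh (fcZ _ hD).
  have [g Fg gh] := F_inv fsF Fhb; rewrite (imF_S Fhb) in Fg.
  apply/eqP; rewrite eqEcard oD (es_cardZ p_pr oS esS) leqnn andbT; apply/subsetP=> x Dx.
  have Sx := subsetP sDS _ Dx; rewrite -(gh _ Sx); apply: (F_S_center Fg).
  by rewrite hbE // -hD imset_f.
apply: norad_extend_fc => //.
have [P'Z|nP'Z] := eqVneq (f @: P) Z; first exact: fcZ.
move=> h Fh; have gh := F_im_group fsF Fh; pose P'' := Group gh.
have -> : h @: (f @: P) = P'' by [].
have oP'' : #|P''| = p by rewrite /= (card_imF Fh).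
have nP''Z : P'' :!=: Z by apply: contraNneq nP'Z => e; apply/eqP/(toZ P' h).
have sP''S : P'' \subset S := imF_sub Fh.
apply: (@leq_trans (p ^ 2)%N).
  have : (#|'C_S(P'')%g| %| p ^ 3)%N by rewrite -oS cardSg ?subsetIl.
  case/(dvdn_pfactor _ _ p_pr) => m le_m oC; rewrite oC leq_exp2l ?prime_gt1 //.
  rewrite -ltnS ltn_neqAle le_m andbT; apply: contra nP''Z => /eqP m3.
  have eC : 'C_S(P'')%g = S by apply/eqP; rewrite eqEcard subsetIl oC m3 oS leqnn.
  rewrite eqEcard oP'' (es_cardZ p_pr oS esS) leqnn andbT subsetI sP''S centsC -eC.
  exact: subsetIr.
rewrite -(es_mulZ p_pr oS esS sP'S oP' nP'Z); apply: subset_leq_card.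
have abP : P' \subset 'C(P')%g by apply: cyclic_abelian; rewrite prime_cyclic // oP'.
rewrite mul_subG // subsetI; first by rewrite sP'S.
by rewrite center_sub (subset_trans (subsetIr S _)) ?centS.
Qed.

Lemma norad_constrained : constrained S F.
Proof.
exists S; split; last exact: subsetIl.
split=> [|P f sPS Ff]; first exact: normal_refl.
rewrite mulSGid //.
suffices [fb Fb fbE] : exists2 fb, fb \in F S & {in P, forall x, fb x = f x}.
  by exists fb => //; split=> //; apply: imF_S.
have : (#|P| %| p ^ 3)%N by rewrite -oS cardSg.
case/(dvdn_pfactor _ _ p_pr) => [[|[|[|[|m]]]] // _ oP].
- exists (res S (cjmap 1%g)); first by apply: (F_conj fsF); rewrite ?group1.
  have P1 : P :=: 1%g by apply/eqP; rewrite trivg_card1 oP.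
  move=> x; rewrite P1 => /set1P ->; rewrite resE ?group1 // ffunE conjg1.
  by rewrite (F1 fsF Ff).
- exact: norad_extend1.
- exact: norad_extend2.
have eP : P :=: S by apply/eqP; rewrite eqEcard sPS oP oS leqnn.
by exists f; rewrite -?eP.
Qed.
End NoRadical.
End Radical.

Lemma expp_pgroup (T : finGroupType) (p : nat) (G : {group T}) : prime p ->
  {in G, forall a, a ^+ p = 1}%g -> p.-group G.
Proof.
by move=> p_pr Gp; rewrite -pnat_exponent; apply: pnat_dvd (pnat_id p_pr); apply/exponentP.
Qed.

Lemma GLrep_exists p (A : 'M['F_p]_2) : \det A != 0 -> exists g : rep2_group (GLrep p), mx2 g = A.
Proof.
move=> dA; have uA : (A : 'M_(2.-1.+1)) \is a GRing.unit.
  by rewrite -[_ \is a _]/(A \in unitmx) unitmxE unitfE.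
by exists (FinRing.Unit uA).
Qed.

(** * Centric subgroups, and Aut_F(Q) when it moves the center *)

Section AutGroups.
Variables (gT : finGroupType) (p : nat) (S : {group gT}).
Variable F : {set gT} -> {set {ffun gT -> gT}}.
Hypotheses (p_pr : prime p) (oS : #|S| = (p ^ 3)%N) (esS : extraspecial S) (expS : exponent S = p).
Hypothesis satF : saturated S F p.
Variables (k : closedFieldType) (charp : p \in [pchar k]%R) (odd_p : odd p).
Implicit Types (P Q : {group gT}) (a : {perm gT}).
Local Notation Z := 'Z(S).
Local Notation fsF := (sat_fs satF).
Local Notation FF := 'F_p.

Definition AutFG P (sPS : P \subset S) : {group {perm gT}} := Group (AutF_group_set fsF sPS).

Lemma centricE Q : centric S F Q -> #|Q| = (p ^ 2)%N \/ Q :=: S.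
Proof.
move=> [sQS cQ]; have Fid := F_conj fsF sQS (group1 S).
have := cQ _ Fid; have -> : res Q (cjmap 1%g) @: Q = Q.
  rewrite -[RHS]imset_id; apply: eq_in_imset => x Qx.
  by rewrite resE // ffunE conjg1.
move=> sCQ.
have sZQ : Z \subset Q by apply: subset_trans sCQ; rewrite subsetI center_sub (subset_trans (subsetIr S _)) ?centS.
have : (#|Q| %| p ^ 3)%N by rewrite -oS cardSg.
case/(dvdn_pfactor _ _ p_pr) => [[|[|[|[|m]]]] // _ oQ].
- have := subset_leq_card sZQ; rewrite (es_cardZ p_pr oS esS) oQ expn0 leqNgt prime_gt1 //.
- have eQ : Z = Q by apply/eqP; rewrite eqEcard sZQ oQ (es_cardZ p_pr oS esS) expn1 leqnn.
  have : S \subset Q by apply: subset_trans sCQ; rewrite subsetI subxx -eQ centsC subsetIr.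
  by move/subset_leq_card; rewrite oS oQ leq_exp2l ?prime_gt1.
- by left.
by right; apply/eqP; rewrite eqEcard sQS oQ oS leqnn.
Qed.

Lemma centric2 Q : Q \subset S -> #|Q| = (p ^ 2)%N -> centric S F Q.
Proof.
move=> sQS oQ; split=> // f Ff; have gP := F_im_group fsF Ff; pose P' := Group gP.
have sP'S : P' \subset S := imF_sub satF Ff.
have oP' : #|P'| = (p ^ 2)%N by rewrite /= (card_imF satF Ff).
have -> : f @: Q = P' by [].
by rewrite (es2_cent p_pr oS esS sP'S oP').
Qed.

Lemma centricS : centric S F S.
Proof. by split=> // f Ff; rewrite (imF_S satF Ff) subsetIl. Qed.

Lemma InnG_pgroup P : P \subset S -> p.-group (InnG P).
Proof.
move=> sPS; apply: expp_pgroup => // a /InnGP[Aa [s Ps ea]]; apply/permP=> x; rewrite perm1 permX.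
have [Px|nPx] := boolP (x \in P); last first.
  by elim: (p) => //= n ->; rewrite (out_Aut Aa nPx).
suffices it n : iter n a x = (x ^ (s ^+ n))%g.
  by rewrite it (es_expp expS) ?conjg1 // (subsetP sPS).
elim: n => [|n IH] /=; first by rewrite expg0 conjg1.
by rewrite IH ea ?groupJ ?groupX // -conjgM expgSr.
Qed.

Section Descend.
Variables (P : {group gT}) (sPS : P \subset S).
Variable al : coset_of (InnG P) -> coset_of (InnG P) -> k.
Hypothesis cocP : cocycle2 (OutF F P) al.
(** Inflation to Aut_F(P), where restrictions can be composed; triviality descends again because
    Inn(P) is a p-group. *)
Definition upAut (a b : {perm gT}) := al (coset (InnG P) a) (coset (InnG P) b).

Lemma AutFG_norm : AutFG sPS \subset 'N(InnG P)%g.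
Proof.
by apply: subset_trans (InnG_norm P); apply/subsetP=> a; apply: AutF_Aut.
Qed.

Lemma upAut_cocycle : cocycle2 (AutFG sPS) upAut.
Proof. exact: (cocycle2_pull (f := coset_morphism (InnG P)) AutFG_norm (subxx _) cocP). Qed.

Lemma upAut_triv : triv (OutF F P) al -> triv (AutF F P) upAut.
Proof. exact: (triv_pull (f := coset_morphism (InnG P)) AutFG_norm). Qed.

Lemma Out_triv : triv (AutF F P) upAut -> triv (OutF F P) al.
Proof.
apply: (triv_descent charp (f := coset_morphism (InnG P)) AutFG_norm cocP).
apply: pgroupS (InnG_pgroup sPS); apply: subset_trans (subsetIr _ _) _.
by have /eqP := ker_coset (InnG P); rewrite eqEsubset => /andP[].
Qed.
End Descend.

Lemma AutF_conj P s : P \subset S -> s \in S -> s \in 'N(P)%g ->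
  exists2 a, a \in AutF F P & {in P, forall x, a x = x ^ s}%g.
Proof.
move=> sPS Ss nPs; have Fs := F_conj fsF sPS Ss.
have imP : res P (cjmap s) @: P = P.
  apply/eqP; rewrite eqEcard (card_imF satF Fs) leqnn andbT.
  by apply/subsetP=> _ /imsetP[y Py ->]; rewrite resE // ffunE memJ_norm.
have [a Aa ae] := F_perm fsF Fs imP; exists a => // x Px.
by rewrite ae resE // ffunE.
Qed.

Lemma AutF_center a x : a \in AutF F S -> x \in Z -> a x \in Z.
Proof. by move=> /AutF_F[f Ff af] Zx; rewrite af; apply: (F_S_center satF Ff). Qed.

Lemma AutF_extend Q a : Q \subset S -> #|Q| = (p ^ 2)%N -> a \in AutF F Q ->
  {in Z, forall x, a x \in Z} -> exists2 b, b \in AutF F S & {in Q, b =1 a}.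
Proof.
move=> sQS oQ /AutF_F[f Ff af] aZ.
have [|h Fh hE] := extend_rank2 p_pr oS esS expS satF sQS oQ Ff.
  by move=> x Zx; rewrite -af aZ.
have [b Ab bh] := F_perm fsF Fh (imF_S satF Fh); exists b => // x Qx.
by rewrite bh hE // af.
Qed.

(* d x := x^-1 * a x is then fixed by a, so that a^n x = x * (d x)^n. *)
Lemma Aut_expp (D : {set gT}) a : a \in Aut S -> D \subset S ->
  {in S, forall x, x^-1 * a x \in D}%g -> {in D, forall x, a x = x} -> (a ^+ p = 1)%g.
Proof.
move=> Aa sDS aD Da; apply/permP=> x; rewrite perm1 permX.
have [Sx|nSx] := boolP (x \in S); last first.
  by elim: (p) => //= n ->; rewrite (out_Aut Aa nSx).
set d := (x^-1 * a x)%g; have Dd : d \in D by apply: aD.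
have Sd : d \in S by apply: (subsetP sDS).
suffices it n : iter n a x = (x * d ^+ n)%g by rewrite it (es_expp expS) // mulg1.
elim: n => [|n IH] /=; first by rewrite expg0 mulg1.
rewrite IH; have -> : a (x * d ^+ n)%g = (a x * a d ^+ n)%g.
  by rewrite -!(autmE Aa) morphM ?groupX // morphX.
by rewrite (Da _ Dd) expgS [RHS]mulgA [in RHS]/d mulKVg.
Qed.

Section RadicalQ.
Variables (Q : {group gT}) (sQS : Q \subset S) (oQ : #|Q| = (p ^ 2)%N).
Variables (a0 : {perm gT}) (z : gT).
Hypotheses (Aa0 : a0 \in AutF F Q) (Zz : z \in Z) (nZq : a0 z \notin Z).
Let q := a0 z.

Let Qz : z \in Q. Proof. exact: (subsetP (es2_Z p_pr oS esS sQS oQ)). Qed.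
Let Qq : q \in Q. Proof. by apply: Aut_closed => //; apply: AutF_Aut Aa0. Qed.
Let Sq : q \in S := subsetP sQS _ Qq.
Let z1 : z != 1%g.
Proof.
apply: contraNneq nZq => ->; rewrite -(autmE (AutF_Aut Aa0)) morph1.
exact: group1.
Qed.
Let eZ : Z = <[z]> := es_gen p_pr oS esS expS Zz z1.

Lemma radical_coord : exists kap : gT -> 'rV[FF]_2, exists f : {morphism AutFG sQS >-> rep2_group (GLrep p)},
  [/\ {in Q &, forall x y, kap (x * y)%g = kap x + kap y}, {in Q &, injective kap},
      kap z = delta_mx 0 0, kap q = delta_mx 0 1 &
      forall a x, a \in AutF F Q -> x \in Q -> kap (a x) = kap x *m mx2 (f a)].
Proof.
have nq : q \notin <[z]> by rewrite -eZ.
have [kap [kM kI kz kq]] := abelem_coord p_pr (es2_abelem p_pr oS expS sQS oQ) oQ Qz Qq z1 nq.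
have sAQ : AutFG sQS \subset Aut Q by apply/subsetP=> a; apply: AutF_Aut.
have ker a x : a \in AutFG sQS -> x \in Q -> kap x = 0 -> kap (a x) = 0.
  move=> Aa Qx; rewrite -{1}(kap1 kM) => /(kI _ _ Qx (group1 _)) ->.
  by rewrite -(autmE (AutF_Aut Aa)) morph1 (kap1 kM).
have [f fE] := linearize kM Qz Qq kz kq sAQ ker.
by exists kap, f; split=> // a x; apply: fE.
Qed.

Section WithCoord.
Variables (kap : gT -> 'rV[FF]_2) (f : {morphism AutFG sQS >-> rep2_group (GLrep p)}).
Hypotheses (kM : {in Q &, forall x y, kap (x * y)%g = kap x + kap y}) (kI : {in Q &, injective kap}).
Hypotheses (kz : kap z = delta_mx 0 0) (kq : kap q = delta_mx 0 1).
Hypothesis fE : forall a x, a \in AutF F Q -> x \in Q -> kap (a x) = kap x *m mx2 (f a).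

Lemma row_mx2 a (i j : 'I_2) : a \in AutF F Q ->
  mx2 (f a) i j = kap (a (if i == 0 then z else q)) 0 j.
Proof.
move=> Aa; rewrite fE //; last by case: ifP.
case: (ord2P i) => -> /=; by rewrite ?kz ?kq -rowE mxE.
Qed.

(** Conjugation by elements of [S] fixes [z] and multiplies [q] by any prescribed power of [z]. *)
Lemma lower_in x : exists2 a, a \in AutF F Q & mx2 (f a) = lower2 x.
Proof.
have Zx : (z ^+ (x : nat))%g \in Z by rewrite groupX.
have [s Ss qs] := es_conj p_pr oS esS expS Sq nZq Zx.
have nQs : s \in 'N(Q)%g by apply: (subsetP (normal_norm (es2_normal p_pr oS sQS oQ))).
have [a Aa ae] := AutF_conj sQS Ss nQs; exists a => //.
have az : a z = z by rewrite ae //; apply/conjg_fixP/commgP/(es_Z_cent Zz).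
have aq : kap (a q) = delta_mx 0 1 + x *: delta_mx 0 0.
  by rewrite ae // qs kM ?groupX // kq (kapX kM) // kz natFp.
apply/matrixP=> i j; rewrite row_mx2 //; case: (ord2P i) => -> /=; rewrite ?az ?kz ?aq !mxE.
  by case: (ord2P j) => ->.
by case: (ord2P j) => -> /=; rewrite ?mulr1 ?mulr0 ?add0r ?addr0.
Qed.

(** The upper elementary matrices are conjugates of the lower ones: [a0] sends [z] to [q], so its
    matrix has first row (0, 1), and conjugating [lower2 (c * x)] by it yields [upper2 x], where c
    is its lower-left entry. *)
Lemma full_in (A : 'M[FF]_2) : \det A = 1 -> exists2 a, a \in AutF F Q & mx2 (f a) = A.
Proof.
pose G := (f @* AutFG sQS)%G.
have fG a : a \in AutF F Q -> f a \in G by move=> Aa; apply: mem_morphim.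
suffices full g : \det (mx2 g) = 1 -> g \in G.
  move=> dA; have dA0 : \det A != 0 by rewrite dA oner_eq0.
  have [g Dg] := GLrep_exists dA0.
  have : g \in G by apply: full; rewrite Dg.
  by case/morphimP=> a _ Aa eg; exists a => //; rewrite -eg.
move: g; apply: (sl2_ind (P := fun g => g \in G)).
- by move=> B dB; apply: GLrep_exists; rewrite dB oner_eq0.
- by move=> g h; apply: groupM.
- move=> g x Dg; pose c := mx2 (f a0) 1 0.
  have r0 j : mx2 (f a0) 0 j = (delta_mx 0 1 : 'rV[FF]_2) 0 j by rewrite row_mx2 //= -/q kq.
  have [b Ab Db] := lower_in (c * x).
  have -> : g = f (b ^ a0)%g; last by apply: fG; apply: (groupJ (G := AutFG sQS)).
  apply: mx2_inj; rewrite morphJ // mx2J Db Dg.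
  have e : lower2 (c * x) *m mx2 (f a0) = mx2 (f a0) *m upper2 x.
    by apply: mx2P; rewrite !mulmx2 !r0 !mxE /= -/c; ring.
  by rewrite -mulmxA e mulKmx ?mx2_unit.
move=> g x Dg; have [b Ab Db] := lower_in x.
by rewrite (mx2_inj (etrans Dg (esym Db))) fG.
Qed.

Lemma radical_triv (al : coset_of (InnG Q) -> coset_of (InnG Q) -> k) :
  cocycle2 (OutF F Q) al -> triv (OutF F Q) al.
Proof.
move=> cocQ; apply: (Out_triv sQS cocQ).
have injf : {in AutFG sQS &, injective f}.
  move=> a b Aa Ab e; apply: (@eq_Aut _ Q); rewrite ?AutF_Aut // ?(AutF_Aut Aa) ?(AutF_Aut Ab) // => x Qx.
  apply: kI; rewrite ?Aut_closed ?(AutF_Aut Aa) ?(AutF_Aut Ab) //.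
  by rewrite !fE // e.
have cocA := upAut_cocycle sQS cocQ.
have [|c' coc' c'E] := push_cocycle (f := f) cocA.
  by move=> a a' b b' Aa Aa' Ab Ab' /injf -> // /injf ->.
have [g [g0 gE]] : triv (f @* AutFG sQS) c'.
  apply: (triv_above_sl2 p_pr charp odd_p _ coc') => A /full_in[a Aa Da].
  by exists (f a) => //; apply: mem_morphim.
have := triv_pull (f := f) (subxx _) (ex_intro _ g (conj g0 gE)).
case=> h [h0 hE]; exists h; split=> // a b Aa Ab.
by rewrite -hE // c'E.
Qed.

Lemma diag_in (t : FF) : t != 0 -> exists2 a, a \in AutF F Q &
  a z = (z ^+ (t : nat))%g /\ a q = (q ^+ (t^-1 : FF)%R)%g.
Proof.
move=> t0; pose A : 'M[FF]_2 := \matrix_(i, j) (if i == j then (if i == 0 then t else t^-1) else 0).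
have [|a Aa Da] := @full_in A; first by rewrite det2 !mxE /= mulfV // mulr0 subr0.
have Aa' := AutF_Aut Aa.
exists a => //; split.
  apply: (kI (Aut_closed Aa' Qz) (groupX _ Qz)); rewrite (fE Aa Qz) Da (kapX kM) // natFp kz.
  by apply/rowP=> j; rewrite mulmx2 !mxE; case: (ord2P j) => -> /=; ring.
apply: (kI (Aut_closed Aa' Qq) (groupX _ Qq)); rewrite (fE Aa Qq) Da (kapX kM) // natFp kq.
by apply/rowP=> j; rewrite mulmx2 !mxE; case: (ord2P j) => -> /=; ring.
Qed.
End WithCoord.
End RadicalQ.
End AutGroups.

(** * The class on Out_F(S) *)

Section Limit.
Variables (gT : finGroupType) (p : nat) (S : {group gT}).
Variable F : {set gT} -> {set {ffun gT -> gT}}.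
Hypotheses (p_pr : prime p) (oS : #|S| = (p ^ 3)%N) (esS : extraspecial S) (expS : exponent S = p).
Hypothesis satF : saturated S F p.
Variables (k : closedFieldType) (charp : p \in [pchar k]%R) (odd_p : odd p).
Implicit Types (P Q : {group gT}) (a : {perm gT}).
Local Notation Z := 'Z(S).
Local Notation FF := 'F_p.
Local Notation fsF := (sat_fs satF).
Local Notation A := (AutFG satF (subxx S)).

Lemma InnG_Sylow : p.-Sylow(A) (InnG S).
Proof.
have [_ h _] := satF; have [f _|_ sylS] := h S (subxx S).
  by rewrite subset_leq_card // (setIidPl (normG S)) subsetIl.
suffices e : AutS S S = InnG S :> {set {perm gT}} by rewrite -e.
rewrite InnGE; apply/setP=> a; rewrite !in_set; congr (_ && _).
by apply: eq_existsb => s; rewrite (setIidPl (normG S)).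
Qed.

Lemma InnG_mem a : a \in A -> p.-elt a -> a \in InnG S.
Proof.
move=> Aa pa; rewrite (mem_normal_Hall InnG_Sylow) //.
by rewrite /normal (pHall_sub InnG_Sylow) AutFG_norm.
Qed.

Section FamilyS.
Variable al : coset_of (InnG S) -> coset_of (InnG S) -> k.
Hypothesis cocS : cocycle2 (OutF F S) al.
Let c := upAut al.
Let cocA : cocycle2 A c := upAut_cocycle satF (subxx S) cocS.

Definition stabA Q : {set {perm gT}} := [set a in AutF F S | a @: Q == Q].

Lemma stabAP Q a : reflect (a \in AutF F S /\ a @: Q = Q) (a \in stabA Q).
Proof. by apply: (iffP setIdP) => [] [Aa /eqP]. Qed.

Lemma stabA_group_set Q : group_set (stabA Q).
Proof.
apply/group_setP; split.
  apply/stabAP; split; first exact: (group1 A).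
  by rewrite -[RHS]imset_id; apply: eq_imset => x; rewrite perm1.
move=> a b /stabAP[Aa aQ] /stabAP[Ab bQ]; apply/stabAP; split; first exact: (groupM (G := A)).
by rewrite -[RHS]bQ -{2}aQ -imset_comp; apply: eq_imset => x; rewrite permM.
Qed.
Canonical stabA_group Q := Group (stabA_group_set Q).

Lemma stabA_sub Q : stabA Q \subset A.
Proof. by apply/subsetP=> a /stabAP[]. Qed.

Section WithRadical.
Variables (Q : {group gT}) (sQS : Q \subset S) (oQ : #|Q| = (p ^ 2)%N).
Variables (a0 : {perm gT}) (z : gT).
Hypotheses (Aa0 : a0 \in AutF F Q) (Zz : z \in Z) (nZq : a0 z \notin Z).
Hypothesis trivQ : triv (stabA Q) c.
Let q := a0 z.

Let sZQ : Z \subset Q := es2_Z p_pr oS esS sQS oQ.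
Let Qq : q \in Q. Proof. by apply: Aut_closed; [apply: AutF_Aut Aa0 | apply: (subsetP sZQ)]. Qed.
Let Sq : q \in S := subsetP sQS _ Qq.
Let defQ : Q :=: (<[q]> * Z)%g := es2_decomp p_pr oS esS expS sQS oQ Qq nZq.
Let nZS x : x \in S -> x \in 'N(Z)%g.
Proof. exact: (subsetP (normal_norm (center_normal S))). Qed.

Lemma triv_OutS : triv (OutF F S) al.
Proof.
have [v Sv nQv] : exists2 v, v \in S & v \notin Q.
  apply/subsetPn; apply/negP=> /subset_leq_card; rewrite oS oQ leqNgt ltn_exp2l ?prime_gt1 //.
have cqv : [~ q, v]%g != 1%g.
  apply: contra nQv => /commgP cqv; rewrite -(es2_cent p_pr oS esS sQS oQ) inE Sv.
  apply/centP=> y; rewrite {1}defQ => /mulsgP[_ d /cycleP[i ->] Zd ->].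
  by apply: commuteM; [apply/commuteX/commute_sym | apply/commute_sym/(es_Z_cent Zd)].
have Zqv : [~ q, v]%g \in Z := es_comm esS Sq Sv.
have oE : #|S / Z|%g = (p ^ 2)%N.
  rewrite card_quotient ?normal_norm ?center_normal // -divgS ?center_sub //.
  by rewrite oS (es_cardZ p_pr oS esS) expnS mulKn ?prime_gt0.
have abE : p.-abelem (S / Z)%g.
  rewrite abelemE //; apply/andP; split.
    by apply: sub_der1_abelian; rewrite (es_der esS).
  apply/exponentP=> _ /morphimP[x Nx Sx ->].
  by rewrite -morphX // (es_expp expS Sx) morph1.
have Eq : coset Z q \in (S / Z)%g by apply: mem_quotient.
have Ev : coset Z v \in (S / Z)%g by apply: mem_quotient.
have q1 : coset Z q != 1%g.
  by apply: contra nZq => /eqP/coset_idr; apply; apply: nZS.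
have nv : coset Z v \notin <[coset Z q]>.
  apply: contra nQv => /cycleP[i]; rewrite -morphX ?nZS // => e.
  have : coset Z (q ^- i * v)%g = 1%g.
    have Nqi := nZS (groupX i Sq).
    by rewrite (morphM _ (groupVr Nqi) (nZS Sv)) (morphV _ Nqi) /= e mulVg.
  have Sqv : (q ^- i * v)%g \in S by rewrite groupM // groupV groupX.
  move/(coset_idr (nZS Sqv)) => Zv.
  by rewrite defQ -[v](mulKVg (q ^+ i)%g) mem_mulg ?mem_cycle.
have [kb [kbM kbI kbq kbv]] := abelem_coord p_pr abE oE Eq Ev q1 nv.
pose kap x := kb (coset Z x).
have kM : {in S &, forall x y, kap (x * y)%g = kap x + kap y}.
  by move=> x y Sx Sy; rewrite /kap morphM ?nZS // kbM ?mem_quotient.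
have k0 x : x \in S -> kap x = 0 -> x \in Z.
  move=> Sx; rewrite -(kap1 kM) => /kbI e; apply: coset_idr; first exact: nZS.
  by rewrite e ?mem_quotient ?group1 // morph1.
have kZ x : x \in Z -> kap x = 0 by move=> Zx; rewrite -(kap1 kM) /kap coset_id // morph1.
have sAS : A \subset Aut S by apply/subsetP=> a; apply: AutF_Aut.
have ker a x : a \in A -> x \in S -> kap x = 0 -> kap (a x) = 0.
  by move=> Aa Sx /(k0 _ Sx) Zx; apply/kZ/(AutF_center satF Aa).
have [f fE] := linearize kM Sq Sv kbq kbv sAS ker.
have rowf a (i j : 'I_2) : a \in A -> mx2 (f a) i j = kap (a (if i == 0 then q else v)) 0 j.
  move=> Aa; rewrite fE //; last by case: ifP.
  by case: (ord2P i) => -> /=; rewrite ?[kap _]kbq ?[kap _]kbv -rowE mxE.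
have kJ x s : x \in S -> s \in S -> kap (x ^ s)%g = kap x.
  move=> Sx Ss; rewrite -[(x ^ s)%g](mulKVg x) -commgEl kM ?(es_ZS (es_comm esS Sx Ss)) //.
  by rewrite (kZ _ (es_comm esS Sx Ss)) addr0.
(* Acting trivially on S/Z(S), [a] fixes the commutator of [q] and [v], which generates Z(S). Then
   a^p = 1, and p-elements of Aut_F(S) are inner by the Sylow property. *)
have kerf a : a \in A -> f a = 1%g -> a \in InnG S.
  move=> Aa fa1; have Aa' := AutF_Aut Aa; apply: InnG_mem => //.
  have aS x : x \in S -> a x \in S by apply: Aut_closed.
  have aZ x : x \in S -> (x^-1 * a x)%g \in Z.
    move=> Sx; apply: k0; first by rewrite groupM ?groupV ?aS.
    by rewrite kM ?groupV ?aS // (kapV kM) // fE // fa1 mx21 mulmx1 addrC subrr.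
  have aq : a [~ q, v]%g = [~ q, v]%g.
    have -> : a [~ q, v]%g = [~ a q, a v]%g by rewrite -!(autmE Aa') morphR.
    rewrite -[a q](mulKVg q) -[a v](mulKVg v).
    have Z1 := aZ q Sq; have Z2 := aZ v Sv.
    rewrite commMgJ commgMJ.
    have -> : [~ (q^-1 * a q), (v * (v^-1 * a v))]%g = 1%g.
      by apply/eqP/commgP/(es_Z_cent Z1); rewrite groupM ?(es_ZS Z2).
    have -> : [~ q, (v^-1 * a v)]%g = 1%g.
      by apply/eqP/commgP/commute_sym/(es_Z_cent Z2).
    rewrite mul1g mulg1 -conjgM; apply/conjg_fixP/commgP/(es_Z_cent Zqv).
    by rewrite groupM ?(es_ZS Z1) ?(es_ZS Z2).
  have ap : (a ^+ p = 1)%g.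
    apply: (Aut_expp expS Aa' (center_sub S) aZ) => x.
    rewrite (es_gen p_pr oS esS expS Zqv cqv) => /cycleP[i ->].
    by rewrite -(autmE Aa') morphX ?(es_ZS Zqv) //= autmE aq.
  by rewrite /p_elt; apply: pnat_dvd (pnat_id p_pr); rewrite order_dvdn ap.
have fInn a : a \in InnG S -> f a = 1%g.
  move=> Ia; have Aa : a \in A by apply: (subsetP (pHall_sub InnG_Sylow)).
  case/InnGP: Ia => _ [s Ss ea]; apply: mx2_inj; rewrite mx21.
  apply/matrixP=> i j; rewrite rowf //; case: (ord2P i) => -> /=.
    by rewrite ea // kJ // [kap _]kbq !mxE; case: (ord2P j) => ->.
  by rewrite ea // kJ // [kap _]kbv !mxE; case: (ord2P j) => ->.
pose G := (f @* A)%G.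
have p'G : p^'.-group G.
  have := morphim_pHall f (pHall_sub InnG_Sylow) InnG_Sylow.
  have -> : f @* InnG S = 1%g.
    apply/trivgP/subsetP=> _ /morphimP[a _ Ia ->]; rewrite (fInn _ Ia); exact: group1.
  by case/and3P=> _ _; rewrite indexg1.
have [|c' coc' c'E] := push_cocycle (f := f) cocA.
  have cos a a' : a \in A -> a' \in A -> f a = f a' -> coset (InnG S) a = coset (InnG S) a'.
    move=> Aa Aa' e; have Aaa : (a * a'^-1)%g \in A by rewrite groupM ?groupV.
    have Ia : (a * a'^-1)%g \in InnG S.
      by apply: kerf => //; rewrite morphM ?morphV ?groupV // e mulgV.
    have nA := subsetP (AutFG_norm satF (subxx S)).
    by rewrite -[a](mulgKV a') (coset_kerl _ Ia).
  move=> a a' b b' Aa Aa' Ab Ab' ea eb.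
  by rewrite /c /upAut (cos a a') ?(cos b b').
pose w : 'rV[FF]_2 := delta_mx 0 0.
have w0 : w != 0 by apply/eqP=> /rowP/(_ 0)/eqP; rewrite !mxE oner_eq0.
have kq : kap q = w := kbq.
(* An automorphism stabilizing the line of [w] sends [q] into <q> Z(S) = Q. So this group comes from
   [stabA Q], and [trivQ] descends through a p-group kernel. *)
have trivw : triv (line_stab w G) c'.
  apply: (@trivS _ _ _ (f @* stabA Q)).
    apply/subsetP=> _ /line_stabP[/morphimP[a _ Aa ->] [t et]].
    apply: mem_morphim => //; apply/stabAP; split=> //.
    have Aa' := AutF_Aut Aa.
    apply/eqP; rewrite eqEcard card_imset; last exact: perm_inj.
    rewrite leqnn andbT; apply/subsetP=> _ /imsetP[y + ->].
    rewrite {1}defQ => /mulsgP[_ d /cycleP[i ->] Zd ->].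
    have aq : a q \in Q.
      have Saq : a q \in S by apply: Aut_closed.
      have : (q ^- (t : nat) * a q)%g \in Z.
        apply: k0; first by rewrite groupM ?groupV ?groupX.
        rewrite kM ?groupV ?groupX // (kapV kM) ?groupX // (kapX kM) // natFp kq.
        by rewrite fE // kq et addrC subrr.
      by move=> Zt; rewrite defQ -[a q](mulKVg (q ^+ (t : nat))%g) mem_mulg ?mem_cycle.
    have -> : a (q ^+ i * d)%g = (a q ^+ i * a d)%g.
      by rewrite -!(autmE Aa') morphM ?groupX ?(es_ZS Zd) // morphX.
    by rewrite groupM ?groupX // (subsetP sZQ) // (AutF_center satF Aa).
  apply: (triv_descent charp (stabA_sub Q)).
  - apply: cocycle2S coc'; apply: morphimS; exact: stabA_sub.
  - apply: pgroupS (InnG_pgroup p_pr expS (subxx S)); apply/subsetP=> a /setIP[/stabAP[Aa _] Ka].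
    by apply: kerf => //; apply/mker.
  case: trivQ => g [g0 gE]; exists g; split=> // a b Ba Bb.
  by rewrite c'E ?(subsetP (stabA_sub Q)) // gE.
have /cyclicP[d Dd] := field_unit_group_cyclic [set: {unit FF}].
pose t : FF := val d.
have t0 : t != 0 by rewrite -unitfE; apply: (valP d).
have [kapQ [fQ [kM' kI' kz' kq' fE']]] := radical_coord p_pr oS esS expS satF sQS oQ Aa0 Zz nZq.
have [dl Adl [dz dq]] := diag_in p_pr oS esS expS oQ Aa0 Zz nZq kM' kI' kz' kq' fE' t0.
have z1 : z != 1%g.
  apply: contraNneq nZq => ->; rewrite -(autmE (AutF_Aut Aa0)) morph1; exact: group1.
have eZ := es_gen p_pr oS esS expS Zz z1.
have dZ i : dl (z ^+ i)%g = (z ^+ i ^+ (t : nat))%g.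
  rewrite -(autmE (AutF_Aut Adl)) morphX ?(subsetP sZQ) //= autmE dz.
  by rewrite -!expgM mulnC.
have [|ta Ata tae] := AutF_extend p_pr oS esS expS satF sQS oQ Adl.
  by move=> x; rewrite {1}eZ => /cycleP[i ->]; rewrite dZ !groupX.
have Ata' := AutF_Aut Ata.
have taq : ta q = (q ^+ (t^-1 : FF)%R)%g by rewrite tae.
have wt : w *m mx2 (f ta) = t^-1 *: w by rewrite -kq -fE // taq (kapX kM) // natFp.
(* Two ways to compute [ta [~ q, v]]: bilinearity of the commutator gives the determinant t^-1 m1 as
   exponent, the action on Z(S) gives t. *)
have dt : \det (mx2 (f ta)) = t.
  have m0 j : mx2 (f ta) 0 j = (t^-1 *: w) 0 j by rewrite -wt -rowE mxE.
  set m1 := mx2 (f ta) 1 1; set m2 := mx2 (f ta) 1 0.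
  have -> : \det (mx2 (f ta)) = t^-1 * m1 by rewrite det2 !m0 !mxE /= mulr1 mulr0 mul0r subr0.
  have Stv : ta v \in S by apply: Aut_closed.
  pose y := (v ^+ (m1 : nat) * q ^+ (m2 : nat))%g.
  have Sy : y \in S by rewrite groupM ?groupX.
  have Zy : (y^-1 * ta v)%g \in Z.
    apply: k0; first by rewrite groupM ?groupV.
    rewrite kM ?groupV // (kapV kM) // kM ?groupX // !(kapX kM) // !natFp kq [kap v]kbv fE // [kap v]kbv.
    by apply/rowP=> j; rewrite mxE -rowE !mxE; case: (ord2P j) => -> /=; rewrite -/m1 -/m2; ring.
  have e1 : ta [~ q, v]%g = ([~ q, v] ^+ ((t^-1 : FF)%R * m1))%g.
    have -> : ta [~ q, v]%g = [~ ta q, ta v]%g by rewrite -!(autmE Ata') morphR.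
    rewrite -[ta v](mulKVg y) commgMJ.
    have -> : [~ ta q, (y^-1 * ta v)]%g = 1%g.
      by apply/eqP/commgP/commute_sym/(es_Z_cent Zy); apply: Aut_closed.
    rewrite mul1g taq /y commgMJ.
    have -> : [~ q ^+ (t^-1 : FF)%R, q ^+ (m2 : nat)]%g = 1%g.
      by apply/eqP/commgP/commute_sym/commuteX/commute_sym/commuteX.
    rewrite mul1g commXXg; try by apply/commute_sym/(es_Z_cent Zqv).
    rewrite -conjgM; apply/conjg_fixP/commgP/(es_Z_cent (groupX _ Zqv)).
    by rewrite groupM ?groupX ?(es_ZS Zy).
  have e2 : ta [~ q, v]%g = ([~ q, v] ^+ (t : nat))%g.
    by rewrite tae ?(subsetP sZQ) //; move: Zqv; rewrite {1}eZ => /cycleP[i ->]; rewrite dZ.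
  move: e1; rewrite e2 => /eqP; rewrite eq_expg_mod_order (es_order p_pr expS (es_ZS Zqv) cqv) => /eqP e.
  have cast n : (n %% p)%:R = n%:R :> FF by apply: Fp_nat_mod.
  by rewrite -[RHS](natFp t) -[(t : nat)%:R]cast e cast natrM !natFp.
have Gta : f ta \in G by apply: mem_morphim.
have wtau : w *m mx2 (f ta) = (\det (mx2 (f ta)))^-1 *: w by rewrite dt.
have gen x : x \in <[detu (f ta)]>.
  have -> : detu (f ta) = d by apply: val_inj; rewrite /= dt.
  by rewrite -[<[d]>]Dd inE.
have [g gG] := triv_of_line_stab p_pr w0 p'G charp odd_p coc' trivw Gta wtau gen.
apply: (Out_triv p_pr expS satF charp (subxx S) cocS).
have [h [h0 hE]] := triv_pull (f := f) (subxx A) (ex_intro _ g gG).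
exists h; split=> // a b Aa Ab; by rewrite -hE // c'E.
Qed.
End WithRadical.
End FamilyS.
End Limit.

Lemma triv_cohomologous (k : fieldType) (T : finGroupType) (H : {group T}) (c c' : T -> T -> k) :
  cohomologous H c c' -> triv H c <-> triv H c'.
Proof.
move=> [g [g0 gE]]; split=> [] [h [h0 hE]].
  exists (fun x => h x / g x); split=> [x Hx|x y Hx Hy]; first by rewrite mulf_neq0 ?invr_eq0 ?h0 ?g0.
  have gxy := g0 _ (groupM Hx Hy); have := hE _ _ Hx Hy; rewrite gE // => e.
  have gx := g0 _ Hx; have gy := g0 _ Hy.
  transitivity (h x * h y / (g x * g y)); last by field; rewrite gx gy.
  by rewrite -e; field; rewrite gx gy gxy.
exists (fun x => h x * g x); split=> [x Hx|x y Hx Hy]; first by rewrite mulf_neq0 ?h0 ?g0.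
have gxy := g0 _ (groupM Hx Hy); have := hE _ _ Hx Hy => e.
transitivity (h x * h y * (g x * g y)); last by ring.
by rewrite gE // -e; field.
Qed.

(** * Restriction from S to rank-two subgroups, and the conclusion *)

Section Restriction.
Variables (gT : finGroupType) (p : nat) (S : {group gT}).
Variable F : {set gT} -> {set {ffun gT -> gT}}.
Hypotheses (p_pr : prime p) (oS : #|S| = (p ^ 3)%N) (esS : extraspecial S) (expS : exponent S = p).
Hypothesis satF : saturated S F p.
Variables (k : closedFieldType) (charp : p \in [pchar k]%R).
Variables (Q : {group gT}) (sQS : Q \subset S) (oQ : #|Q| = (p ^ 2)%N).
Local Notation Z := 'Z(S).
Local Notation fsF := (sat_fs satF).
Local Notation stab := (stabA_group satF Q).

Lemma stab_norm : stab \subset 'N(Q | 'P)%g.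
Proof.
apply/subsetP=> a /stabAP[_ aQ]; rewrite !inE; apply/subsetP=> x Qx.
by rewrite inE /= apermE -aQ imset_f.
Qed.

Lemma restr_AutF a : a \in stab -> restr_perm Q a \in AutF F Q.
Proof.
move=> sa; have Na := subsetP stab_norm _ sa; have /stabAP[Aa aQ] := sa.
have Ra := Aut_restr_perm sQS (AutF_Aut Aa); rewrite inE Ra.
have -> : finfun (restr_perm Q a) = res Q (finfun a).
  apply/ffunP=> x; rewrite !ffunE; case: ifPn => Qx; first by rewrite restr_permE.
  exact: out_Aut Ra Qx.
by apply: (F_res fsF _ sQS); case/setIdP: Aa.
Qed.

Lemma restr_sub : restr_perm Q @* stab \subset AutFG satF sQS.
Proof. by apply/subsetP=> _ /morphimP[a _ sa ->]; apply: restr_AutF. Qed.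

Lemma restr_triv (c : {perm gT} -> {perm gT} -> k) : triv (AutF F Q) c ->
  triv stab (fun a b => c (restr_perm Q a) (restr_perm Q b)).
Proof. by move=> tr; apply: (triv_pull stab_norm); apply: trivS tr; apply: restr_sub. Qed.

(** If [a] is trivial on the normal subgroup [Q], each x^-1 * a x centralizes [Q] and so lies in it;
    [Aut_expp] then applies with [Q] as the set of fixed points. *)
Lemma restr_ker : p.-group ('ker_stab (restr_perm Q)).
Proof.
apply: expp_pgroup => // a /setIP[sa Ka]; have /stabAP[Aa _] := sa.
have Na := subsetP stab_norm _ sa.
have aQ x : x \in Q -> a x = x by move=> Qx; rewrite -(restr_permE Na Qx) (mker Ka) perm1.
have Aa' := AutF_Aut Aa; have aS x : x \in S -> a x \in S by apply: Aut_closed.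
apply: (Aut_expp expS Aa' sQS _ aQ) => x Sx.
rewrite -(es2_cent p_pr oS esS sQS oQ) inE groupM ?groupV ?aS //=.
apply/centP=> y Qy; have Sy : y \in S by apply: (subsetP sQS).
apply/commute_sym/commgP/conjg_fixP.
have yx' : (y ^ x^-1)%g \in Q.
  by rewrite memJ_norm // groupV (subsetP (normal_norm (es2_normal p_pr oS sQS oQ))).
have e' : ((y ^ x^-1) ^ a x = y)%g.
  by rewrite -[in LHS](aQ _ yx') -!(autmE Aa') -morphJ ?(subsetP sQS _ yx') //= conjgKV autmE aQ.
by rewrite conjgM e'.
Qed.

Lemma restr_triv_inv (c : {perm gT} -> {perm gT} -> k) :
  cocycle2 (AutF F Q) c -> {in AutF F Q & Z, forall (a : {perm gT}) x, a x \in Z} ->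
  triv stab (fun a b => c (restr_perm Q a) (restr_perm Q b)) -> triv (AutF F Q) c.
Proof.
move=> coc aZ tr.
have tr' := triv_descent charp stab_norm (cocycle2S restr_sub coc) restr_ker tr.
apply: trivS tr'; apply/subsetP=> a Aa.
have [|b Ab ba] := AutF_extend p_pr oS esS expS satF sQS oQ Aa; first by move=> x; apply: aZ.
have Aa' := AutF_Aut Aa.
have sb : b \in stab.
  apply/stabAP; split=> //; rewrite -[RHS](Aut_im Aa').
  exact: eq_in_imset.
have Nb := subsetP stab_norm _ sb.
apply/morphimP; exists b => //; apply: (@eq_Aut _ Q) => //.
  exact: AutF_Aut (restr_AutF sb).
by move=> x Qx; rewrite restr_permE // ba.
Qed.
End Restriction.

Theorem theorem4p4 (gT : finGroupType) (p : nat) (k : closedFieldType)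
    (S : {group gT}) (F : {set gT} -> {set {ffun gT -> gT}}) :
  prime p -> odd p -> (p \in [pchar k])%R ->
  #|S| = (p ^ 3)%N -> extraspecial S -> exponent S = p ->
  saturated S F p -> ~ constrained S F ->
  forall alpha : @h2family gT k,
    compatible_family S F alpha ->
    forall Q : {group gT}, centric S F Q ->
      cohomologous (OutF F Q) (alpha Q) (fun _ _ => 1%R).
Proof.
move=> p_pr odd_p charp oS esS expS satF ncF alpha [coc _ comp] Q cQ.
have fsF := sat_fs satF; have cS := centricS satF.
have rad (P : {group gT}) (sPS : P \subset S) (a : {perm gT}) x : #|P| = (p ^ 2)%N -> a \in AutF F P -> x \in 'Z(S)%g ->
    a x \notin 'Z(S)%g -> triv (OutF F P) (alpha P).
  move=> oP Aa Zx nZ; have cP := centric2 p_pr oS esS satF sPS oP.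
  have [kap [f [kM kI kz kq fE]]] := radical_coord p_pr oS esS expS satF sPS oP Aa Zx nZ.
  exact: (radical_triv p_pr oS esS expS charp odd_p oP Aa Zx nZ kM kI kz kq fE (coc P cP)).
have [P [sPS oP [a Aa [x Zx nZ]]]] : exists P : {group gT}, [/\ P \subset S, #|P| = (p ^ 2)%N &
    exists2 a : {perm gT}, a \in AutF F P & exists2 x, x \in 'Z(S)%g & a x \notin 'Z(S)%g].
  (* A boolean form of the property, so that the case distinction is decidable and its failure gives
     the hypothesis of [norad_constrained]. *)
  pose B (P : {group gT}) := [&& P \subset S, #|P| == (p ^ 2)%N &
    [exists a : {perm gT} in AutF F P, [exists x in 'Z(S)%g, a x \notin 'Z(S)%g]]].
  have [[P /and3P[sPS /eqP oP /exists_inP[a Aa /exists_inP[x Zx nZ]]]]|noB] := altP (existsP (P := B)).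
    by exists P; split=> //; exists a => //; exists x.
  case: ncF; apply: (norad_constrained p_pr oS esS expS satF) => P sPS oP [f Ff [fP [x Zx nZ]]].
  case/existsP: noB; exists P; rewrite /B sPS oP eqxx /=.
  have [a Aa af] := F_perm fsF Ff fP; apply/exists_inP; exists a => //.
  by apply/exists_inP; exists x; rewrite ?af.
have cP := centric2 p_pr oS esS satF sPS oP.
have tS : triv (OutF F S) (alpha S).
  apply: (triv_OutS p_pr oS esS expS satF charp odd_p (coc S cS) sPS oP Aa Zx nZ).
  (* Compatibility for [P] inside [S] carries the triviality of alpha_P to alpha_S on the stabilizer
     of [P]. *)
  apply/(@triv_cohomologous _ _ (stabA_group satF P) _ _ (comp P S cP cS sPS)).
  exact: (restr_triv satF sPS (upAut_triv satF sPS (rad P sPS a x oP Aa Zx nZ))).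
suffices tQ : triv (OutF F Q) (alpha Q).
  have [sQS _] := cQ.
  exact: (proj2 (cohomologous1P (AutFG satF sQS / InnG Q)%G _) tQ).
case: (centricE p_pr oS esS satF cQ) => [oQ|eQ]; last by rewrite (group_inj eQ).
have [sQS _] := cQ.
have [/exists_inP[b Ab /exists_inP[y Zy nZy]]|noR] :=
  boolP [exists b : {perm gT} in AutF F Q, [exists y in 'Z(S)%g, b y \notin 'Z(S)%g]].
  exact: (rad Q sQS b y).
apply: (Out_triv p_pr expS satF charp sQS (coc Q cQ)).
apply: (restr_triv_inv p_pr oS esS expS charp sQS oQ (upAut_cocycle satF sQS (coc Q cQ))).
  move=> b y Ab Zy; apply: contraR noR => nZy; apply/exists_inP; exists b => //.
  by apply/exists_inP; exists y.
apply/(@triv_cohomologous _ _ (stabA_group satF Q) _ _ (comp Q S cQ cS sQS)).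
apply: (trivS _ (upAut_triv satF (subxx S) tS)); exact: (stabA_sub satF Q).
Qed.
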